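(* Consider weighted scale-free percolation $\mathrm{SFP}_{W,L}$ on $\mathbb{Z}^d$ with parameters $\lambda>0$, $\alpha>d$, vertex-weight distribution $W$ with $\mathbb{P}(W>t)=\ell(t)/t^{\tau-1}$ for some $\tau>1$ and $\ell$ slowly varying at infinity, $\gamma:=\alpha(\tau-1)/d\in(1,2)$, and edge-weight distribution $L$. Let $x\in\mathbb{Z}^d$ be an arbitrary fixed vertex. (1) (Explosive part) If $\mathbf{I}(L)<\infty$, then there is a random variable $V_x$ with $V_x<\infty$ almost surely such that, as $n\to\infty$, $$\tau_n(x)\to V_x \quad\text{and}\quad M_n(x)\to V_x\qquad\text{almost surely.}$$ (2) (Conservative part) If $\mathbf{I}(L)=\infty$, then, as $n\to\infty$, $\tau_n(x)\to\infty$ and $M_n(x)\to\infty$ almost surely. Further, in this case, $$\frac{M_n(x)}{\sum_{k=1}^n F_L^{(-1)}\big(\exp\{-(1/(\gamma-1))^{k}\}\big)}\to 1\qquad\text{almost surely.}$$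
   Context: Scale-free percolation model. Fix $d\ge1$, $\alpha>d$ and $\lambda>0$. Each $x\in\mathbb{Z}^d$ gets an i.i.d. vertex-weight $W_x$ distributed as $W$, where $\mathbb{P}(W\ge1)=1$ and $\mathbb{P}(W>t)=\ell(t)/t^{\tau-1}$, with $\tau>1$ and $\ell$ slowly varying at infinity. Conditionally on $(W_x)_{x\in\mathbb{Z}^d}$, edges are present independently: each pair $x,y$ with $\|x-y\|=1$ (Euclidean norm) is always connected by an edge, and each pair with $\|x-y\|>1$ is connected with probability $1-\exp\{-\lambda W_xW_y/\|x-y\|^\alpha\}$. The resulting graph is denoted $\mathrm{SFP}_W$. Then every present edge $e$ is given an i.i.d. edge-weight $L_e\ge 0$ distributed as $L$, independent of everything else; the resulting weighted graph is $\mathrm{SFP}_{W,L}$. Set $\gamma:=\alpha(\tau-1)/d$. Distances. $\mathrm{d}_L(x,y)$ is the infimum over paths $\pi$ from $x$ to $y$ of $\sum_{e\in\pi}L_e$, and $\mathrm{d}_G(x,y)$ is the graph distance (minimal number of edges). Let $B^L_t(x)=\{y:\mathrm{d}_L(x,y)\le t\}$, $B^G_n(x)=\{y:\mathrm{d}_G(x,y)\le n\}$, and $\Delta B^G_n(x)=B_n^G(x)\setminus B_{n-1}^G(x)$. Hitting times. $\tau_n(x):=\inf\{t: |B_t^L(x)|\ge n\}$ and $M_n(x):=\inf\{\mathrm{d}_L(x,y): y\in\Delta B_n^G(x)\}$. Notation. $F_L(t)=\mathbb{P}(L\le t)$, $F_L^{(-1)}(y)=\inf\{t\in\mathbb{R}:F_L(t)\ge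 y\}$, and $\mathbf{I}(L):=\int_0^\infty F_L^{(-1)}(\exp\{-e^{y}\})\,dy$. *)

(* Defs.v *)
From HB Require Import structures.
From mathcomp Require Import all_boot all_order all_algebra.
From mathcomp Require Import all_classical all_reals all_analysis.
From mathcomp Require Import measurable_realfun.

Set Implicit Arguments.
Unset Strict Implicit.
Unset Printing Implicit Defensive.

Import Order.TTheory GRing.Theory Num.Theory.
Import numFieldNormedType.Exports.

Local Open Scope classical_set_scope.
Local Open Scope ring_scope.

Section distances.
Context {R : realType} {V : eqType}.
Variables (adj : rel V) (len : V -> V -> R).
Implicit Types (x y : V) (p : seq V).

(* The path with vertices x :: p. Vertices may repeat: for nonnegative edge
   lengths this does not affect the infima below. *)
Definition is_path x y p : bool := path adj x p && (last x p == y).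

Definition path_length x p : R := \sum_(e <- zip (x :: p) p) len e.1 e.2.

Definition dL x y : \bar R :=
  ereal_inf [set (path_length x p)%:E | p in [set p | is_path x y p]].

Definition dG x y : \bar R :=
  ereal_inf [set (size p)%:R%:E | p in [set p | is_path x y p]].

Definition ballL (t : R) x : set V := [set y | (dL x y <= t%:E)%E].

Definition ballG (r : R) x : set V := [set y | (dG x y <= r%:E)%E].

(* The radius is real, so that the sphere of radius 0 is [set x]. *)
Definition sphereG (n : nat) x : set V := ballG n%:R x `\` ballG (n%:R - 1) x.

Definition size_hitting_time (n : nat) x : \bar R :=
  ereal_inf [set t%:E | t in [set t : R | (`I_n #<= ballL t x)%card]].

Definition sphere_hitting_time (n : nat) x : \bar R :=
  ereal_inf [set dL x y | y in sphereG n x].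

End distances.

Definition euclidean_dist {R : realType} {d : nat} (x y : 'rV[int]_d) : R :=
  Num.sqrt (\sum_(i < d) ((x 0 i - y 0 i)%:~R) ^+ 2).

(* A finite set of unordered pairs {u, v} with u != v, each of them listed once
   and in one orientation. *)
Definition pair_list {V : eqType} (F : seq (V * V)) : Prop :=
  uniq F /\ {in F, forall e, (e.2, e.1) \notin F}.

Section scale_free_percolation.
Context {R : realType} {d : nat} (lambda alpha : R).
Context {dS : measure_display} {S : measurableType dS} {Q : probability S R}.
Context (W L : {RV Q >-> R}).
Context {dT : measure_display} {T : measurableType dT} (P : probability T R).

Local Notation Zd := 'rV[int]_d.

Definition connection_prob (w : Zd -> R) (x y : Zd) : R :=
  1 - expR (- (lambda * w x * w y / euclidean_dist x y `^ alpha)).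

Definition vertex_events (w : Zd -> T -> R) : set (set T) :=
  [set A | exists x B, measurable B /\ A = w x @^-1` B].

Definition edge_events (E : Zd -> Zd -> set T) : set (set T) :=
  [set A | exists x y, A = E x y].

(* W and L only serve through their distributions. *)
Record weighted_sfp := WeightedSFP {
  vertex_weight : Zd -> {RV P >-> R};
  (* the event that there is an edge between x and y *)
  edge : Zd -> Zd -> set T;
  (* the value on the complement of [edge x y] is irrelevant *)
  edge_weight : Zd -> Zd -> {RV P >-> R};

  vertex_weight_law : forall x (B : set R), measurable B ->
    P (vertex_weight x @^-1` B) = Q (W @^-1` B);
  vertex_weight_indep : forall (s : seq Zd) (B : Zd -> set R),
    uniq s -> (forall x, measurable (B x)) ->
    P (\bigcap_(x in [set` s]) vertex_weight x @^-1` B x) =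
      (\prod_(x <- s) P (vertex_weight x @^-1` B x))%E;

  measurable_edge : forall x y, measurable (edge x y);
  edge_sym : forall x y, edge x y = edge y x;
  edge_irrefl : forall x, edge x x = set0;
  edge_near : forall x y, @euclidean_dist R d x y = 1 -> edge x y = setT;
  (* Independence given the vertex weights: the product of the connection
     probabilities is a conditional probability, given the sigma-algebra
     generated by the vertex weights, that all the pairs of F are edges. *)
  edge_far : forall (F : seq (Zd * Zd)) (A : set T),
    pair_list F -> {in F, forall e, 1 < @euclidean_dist R d e.1 e.2} ->
    <<s vertex_events vertex_weight >> A ->
    P (A `&` \bigcap_(e in [set` F]) edge e.1 e.2) =
      (\int[P]_(w in A)
         (\prod_(e <- F)
            connection_prob (fun x => vertex_weight x w) e.1 e.2)%:E)%E;

  edge_weight_sym : forall x y w, edge_weight x y w = edge_weight y x w;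
  (* Given the vertex weights and the graph, the weights of the edges present
     are i.i.d. copies of L. *)
  edge_weight_iid : forall (F : seq (Zd * Zd)) (B : Zd * Zd -> set R)
      (A : set T),
    pair_list F -> (forall e, measurable (B e)) ->
    <<s vertex_events vertex_weight `|` edge_events edge >> A ->
    {in F, forall e, A `<=` edge e.1 e.2} ->
    P (A `&` \bigcap_(e in [set` F]) edge_weight e.1 e.2 @^-1` B e) =
      (P A * \prod_(e <- F) Q (L @^-1` B e))%E
}.

Variable G : weighted_sfp.

Definition sfp_adj (w : T) : rel Zd := fun x y => `[< edge G x y w >].

Definition sfp_len (w : T) (x y : Zd) : R := edge_weight G x y w.

Definition tau_ (n : nat) (x : Zd) (w : T) : \bar R :=
  size_hitting_time (sfp_adj w) (sfp_len w) n x.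

Definition M_ (n : nat) (x : Zd) (w : T) : \bar R :=
  sphere_hitting_time (sfp_adj w) (sfp_len w) n x.

End scale_free_percolation.

Definition slowly_varying {R : realType} (l : R -> R) : Prop :=
  (exists2 a : R, 0 < a &
     measurable_fun `[a, +oo[ l /\ (forall t, a <= t -> 0 < l t)) /\
  (forall c : R, 0 < c -> l (c * t) / l t @[t --> +oo] --> (1 : R)).

Section explosion_integral.
Context {R : realType} {dS : measure_display} {S : measurableType dS}.
Context {Q : probability S R} (L : {RV Q >-> R}).

Definition quantile (y : R) : R := inf [set t : R | (y%:E <= cdf L t)%E].

Definition explosion_integral : \bar R :=
  (\int[lebesgue_measure]_(y in `[0%R, +oo[)
     (quantile (expR (- expR y)))%:E)%E.

End explosion_integral.

(* Main.v *)
(* Call k the level of a vertex when its weight lies in [e^k, e^(k+1)[, and write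
   beta := 1 / (gamma - 1), which is > 1.

   Upper bound on the growth. Since P(W >= e^j) is e^(-(tau - 1 + o(1)) j), the
   expected number of self-avoiding paths x = v_0, .., v_k with level(v_i) <=
   A b^i for i < k and level(v_k) > A b^k is at most C^k e^(-c A b^k) as soon as
   b > beta. Hence almost surely, for a random A, the k-th vertex of every
   self-avoiding path from x has level at most A b^k, and the expected number of
   such paths of length k is at most e^(C b^k). Comparing with the probability
   that an edge weight falls below a quantile, the k-th edge of every long
   self-avoiding path weighs at least F^(-1)(exp(- c b^k)), which bounds M_n from
   below.

   Lower bound on the growth. If 1 < b < beta, a vertex of weight exp(b^k) has at
   least exp(2 eta b^k) neighbours of weight exp(b^(k+1)) in a cube of side
   exp((1 + b) b^k / alpha), one of which is reached through an edge of weight at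
   most F^(-1)(exp(- eta b^k)). The probability that this fails is doubly
   exponentially small, so a union bound over all vertices of a large box makes it
   hold simultaneously, and following these edges gives a path that uses a single
   edge per generation. By the first part its vertices are at the right graph
   distance from x, which bounds M_n from above.

   As b tends to beta, both bounds are (1 + o(1)) times the sum of the
   F^(-1)(exp(- beta^k)), which is finite iff I(L) is, by the integral test applied
   to the nonincreasing function y |-> F^(-1)(exp(- e^y)). Finally tau_n and M_n
   have the same limit in any locally finite graph. *)

Require Import Defs.
From HB Require Import structures.
From mathcomp Require Import all_boot all_order all_algebra.
From mathcomp Require Import all_classical all_reals all_analysis.
From mathcomp Require Import measurable_realfun.
From mathcomp Require Import lra ring zify.

Set Implicit Arguments.
Unset Strict Implicit.
Unset Printing Implicit Defensive.

Import Order.TTheory GRing.Theory Num.Theory.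
Import numFieldNormedType.Exports.

Local Open Scope classical_set_scope.
Local Open Scope ring_scope.

(** * Hitting times in locally finite graphs *)

(** The threshold beta comes from a balance of moments. An edge probability is bounded by the
    theta-th power of lambda W W' / dist^alpha, with theta slightly above d / alpha so that its sum
    over the lattice converges. An interior vertex of a path then contributes a moment of order 2
    theta, which is infinite since tau - 1 = gamma d / alpha and gamma < 2. Truncating the level of
    vertex m at A b^m bounds it by a constant times e^((2 theta - s) A b^m), with s just below tau -
    1. A last vertex above the truncation gains e^(- (s - theta) A b^k), and this beats the product
    of the earlier factors iff b (s - theta) > theta; in the limit, b (gamma - 1) > 1. A constant c
    in F^(-1)(exp(- c b^k)) only shifts the argument of y |-> F^(-1)(exp(- e^y)), and a slight
    change of b absorbs the shift. The sums are compared up to a factor (N + 1) / N and an additive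
    constant, for every N; this single estimate serves both parts of the theorem. The model
    prescribes only probabilities that given pairs are all edges, so the probability that every good
    neighbour is missing has to be recovered by expanding products of complements. *)

Section graph.
Context {R : realType} {V : eqType}.
Variables (adj : rel V) (len : V -> V -> R).
Hypothesis len_ge0 : forall u v, adj u v -> 0 <= len u v.
Implicit Types (x y : V) (p : seq V).

Lemma path_length_nil x : path_length len x [::] = 0.
Proof. by rewrite /path_length big_nil. Qed.

Lemma path_length_cons x y p :
  path_length len x (y :: p) = len x y + path_length len y p.
Proof. by rewrite /path_length /= big_cons. Qed.

Lemma path_length_cat x p q :
  path_length len x (p ++ q) = path_length len x p + path_length len (last x p) q.
Proof.
elim: p x => [|y p IH] x /=; first by rewrite path_length_nil add0r.
by rewrite !path_length_cons IH addrA.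
Qed.

Lemma path_length_ge0 x p : path adj x p -> 0 <= path_length len x p.
Proof.
elim: p x => [|y p IH] x /=; first by rewrite path_length_nil.
by move=> /andP[xy yp]; rewrite path_length_cons addr_ge0 ?len_ge0 ?IH.
Qed.

(** Loop erasure. If [x] recurs in the path already made simple, the piece up to the recurrence is
    dropped; as edge lengths are nonnegative, this cannot lengthen the path. *)
Lemma uniq_subpath x p : path adj x p ->
  exists p', [/\ path adj x p', last x p' = last x p, uniq (x :: p'),
    (size p' <= size p)%N & path_length len x p' <= path_length len x p].
Proof.
elim: p x => [|y p IH] x /=; first by exists [::].
move=> /andP[xy /IH[q [yq lq uq sq le]]].
have [xin|xnin] := boolP (x \in y :: q); last first.
  exists (y :: q); split => //=.
  - by rewrite xy.
  - by rewrite xnin.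
  - by rewrite !path_length_cons lerD2l.
have: path adj x (y :: q) by rewrite /= xy.
have: last x (y :: q) = last y p by [].
have: path_length len x (y :: q) <= path_length len x (y :: p).
  by rewrite !path_length_cons lerD2l.
have: (size (y :: q) <= (size p).+1)%N by [].
case/splitPr: xin uq => q1 q2.
rewrite cat_uniq => /and3P[_ _ uq2].
rewrite -cat_rcons path_length_cat last_rcons last_cat last_rcons cat_path last_rcons.
rewrite size_cat => sz le2 lst /andP[p1 p2]; exists q2; split => //.
  exact: leq_trans (leq_addl _ _) sz.
by apply: le_trans le2; rewrite lerDr path_length_ge0.
Qed.

Lemma ballGP x y (n : nat) :
  ballG (R := R) adj n%:R x y <-> exists2 p, is_path adj x y p & (size p <= n)%N.
Proof.
rewrite /ballG /= /dG; split.
- move=> le; have : (ereal_inf [set ((size p)%:R : R)%:E | p in is_path adj x y] < (n.+1%:R)%:E)%E.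
    by apply: le_lt_trans le _; rewrite lte_fin ltr_nat.
  case/ereal_inf_ltP => _ [p pp <-]; rewrite lte_fin ltr_nat ltnS => ?.
  by exists p.
- by case=> p pp pn; apply: ge_ereal_inf; exists ((size p)%:R%:E); [exists p|rewrite lee_fin ler_nat].
Qed.

Lemma sphereGP x y (n : nat) :
  sphereG (R := R) adj n.+1 x y <->
  ballG (R := R) adj n.+1%:R x y /\ ~ ballG (R := R) adj n%:R x y.
Proof.
rewrite /sphereG /setD /=.
by have -> : n.+1%:R - 1 = n%:R :> R by rewrite -addn1 natrD addrK.
Qed.

Lemma ballG_le x m n : (m <= n)%N ->
  ballG (R := R) adj m%:R x `<=` ballG (R := R) adj n%:R x.
Proof.
move=> mn y /ballGP[p pp pm]; apply/ballGP; exists p => //.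
exact: leq_trans mn.
Qed.

Lemma ballG_adj x y z n : ballG (R := R) adj n%:R x y -> adj y z ->
  ballG (R := R) adj n.+1%:R x z.
Proof.
move=> /ballGP[p /andP[xp /eqP yp] pn] yz; apply/ballGP.
exists (rcons p z); last by rewrite size_rcons.
by rewrite /is_path rcons_path xp yp yz last_rcons /=.
Qed.

Local Notation M := (sphere_hitting_time adj len).
Local Notation tau := (size_hitting_time adj len).

(** One edge raises the graph distance by at most one, so a path ending outside the ball of radius
    [n] meets the sphere of radius [n.+1], and its part up to there is no longer than the whole. *)
Lemma sphere_hitting_time_le_dL x y n :
  ~ ballG (R := R) adj n%:R x y -> (M n.+1 x <= dL adj len x y)%E.
Proof.
move=> yn; apply/ereal_infP => _ [p /andP[xp /eqP ly] <-].
have [q [r [pE qn]]] : exists q r, p = q ++ r /\ sphereG (R := R) adj n.+1 x (last x q).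
  have x0 : ballG (R := R) adj n%:R x x.
    by apply/ballGP; exists [::]; rewrite // /is_path /= eqxx.
  move: xp; rewrite -ly in yn; elim/last_ind: p {ly} yn => [//|p z IH].
  rewrite last_rcons rcons_path => zn /andP[xp pz].
  have [lb|nlb] := pselect (ballG (R := R) adj n%:R x (last x p)).
    exists (rcons p z), [::]; rewrite cats0 last_rcons; split=> //.
    by apply/sphereGP; split => //; exact: ballG_adj pz.
  have [q [r [-> H]]] := IH nlb xp.
  by exists q, (rcons r z); rewrite rcons_cat.
move: xp; rewrite pE cat_path => /andP[pq pr].
apply: (@le_trans _ _ (dL adj len x (last x q))).
  by apply: ereal_inf_lbound; exists (last x q).
apply: ge_ereal_inf; exists (path_length len x q)%:E.
  by exists q => //; rewrite /= /is_path pq eqxx.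
by rewrite lee_fin path_length_cat lerDl path_length_ge0.
Qed.

Lemma dL_ge0 x y : (0 <= dL adj len x y)%E.
Proof.
apply/ereal_infP => _ [p /andP[xp _] <-]; rewrite lee_fin.
exact: path_length_ge0.
Qed.

Lemma sphere_hitting_time_ge0 n x : (0 <= M n x)%E.
Proof. by apply/ereal_infP => _ [y _ <-]; exact: dL_ge0. Qed.

Lemma sphere_hitting_time_nondecreasing x :
  {homo (fun n => M n x) : n m / (n <= m)%N >-> (n <= m)%E}.
Proof.
suff H n : (M n x <= M n.+1 x)%E by apply/nondecreasing_seqP.
case: n => [|n].
  (* The sphere of radius 0 is [x] itself, since no path has size at most -1; it is hit at time
     0. *)
  apply: (@le_trans _ _ 0%E); last exact: sphere_hitting_time_ge0.
  apply: ge_ereal_inf; exists (dL adj len x x).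
    exists x => //; split.
      by apply/(ballGP _ _ 0); exists [::]; rewrite // /is_path /= eqxx.
    rewrite sub0r /ballG /= /dG => /(@le_lt_trans _ _ _ _ 0%E).
    move=> /(_ ltac:(by rewrite lte_fin ltrN10)) /ereal_inf_ltP[_ [p _ <-]].
    by rewrite lte_fin ltrn0.
  apply: ge_ereal_inf; exists 0%E => //; exists [::]; last by rewrite path_length_nil.
  by rewrite /= /is_path /= eqxx.
apply/ereal_infP => _ [y /sphereGP[_ yn] <-].
by apply: sphere_hitting_time_le_dL => yn'; apply: yn; exact: ballG_le yn'.
Qed.

Lemma uniq_path_length_ge x p (q : nat -> R) K : (0 < K)%N ->
  (forall p z, path adj x (rcons p z) -> uniq (x :: rcons p z) ->
     (K <= (size p).+1)%N -> q (size p).+1 <= len (last x p) z) ->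
  path adj x p -> uniq (x :: p) ->
  \sum_(K <= k < (size p).+1) q k <= path_length len x p.
Proof.
move=> K0 qlen; elim/last_ind: p => [|p z IH] xp uq.
  by rewrite big_geq ?path_length_nil.
have [Kp|pK] := leqP K (size p).+1; last first.
  by rewrite big_geq ?size_rcons// path_length_ge0.
rewrite size_rcons big_nat_recr //= -cats1 path_length_cat path_length_cons.
rewrite path_length_nil addr0 lerD //; last exact: qlen.
apply: IH; first by move: xp; rewrite rcons_path => /andP[].
by move: uq; rewrite -rcons_cons rcons_uniq => /andP[].
Qed.

(** Erasing loops keeps the endpoint, so a path to the sphere of radius [n] still has at least [n]
    edges, and those from the [K]-th on are bounded below by [q]. *)
Lemma sphere_hitting_time_ge x (q : nat -> R) K n : (0 < K)%N ->
  (forall k, 0 <= q k) ->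
  (forall p z, path adj x (rcons p z) -> uniq (x :: rcons p z) ->
     (K <= (size p).+1)%N -> q (size p).+1 <= len (last x p) z) ->
  ((\sum_(K <= k < n.+1) q k)%:E <= M n x)%E.
Proof.
move=> K0 q0 qlen; case: n => [|n].
  by rewrite big_geq //; exact: sphere_hitting_time_ge0.
apply/ereal_infP => _ [y /sphereGP[_ yn] <-].
apply/ereal_infP => _ [p /andP[xp /eqP ly] <-].
have [p' [xp' lp' uq _ le]] := uniq_subpath xp.
rewrite lee_fin; apply: le_trans le.
apply: le_trans (uniq_path_length_ge K0 qlen xp' uq).
have np : (n.+1 <= size p')%N.
  rewrite ltnNge; apply/negP => le; apply: yn; apply/ballGP; exists p' => //.
  by rewrite /is_path xp' lp' ly eqxx.
have [Kn|nK] := leqP K n.+2; last by rewrite big_geq ?sumr_ge0// ltnW.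
rewrite [leRHS](big_cat_nat (n := n.+2)) //=.
by rewrite lerDl sumr_ge0.
Qed.

Lemma ballG_finite x n : (forall v, finite_set [set u | adj v u]) ->
  finite_set (ballG (R := R) adj n%:R x).
Proof.
move=> lf; elim: n => [|n IH].
  apply: (@sub_finite_set _ _ [set x]) => // y /ballGP[[|//] /andP[_ /eqP <-]] //.
apply: (@sub_finite_set _ _ (ballG (R := R) adj n%:R x `|`
  \bigcup_(v in ballG (R := R) adj n%:R x) [set u | adj v u])); last first.
  by rewrite finite_setU; split => //; exact: bigcup_finite.
move=> y /ballGP[p]; case/lastP: p => [|p z] /andP[xp /eqP ly] sz.
  by left; apply/ballGP; exists [::] => //; rewrite /is_path ly eqxx.
right; move: xp ly sz; rewrite rcons_path last_rcons size_rcons => /andP[xp pz] zy pn.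
exists (last x p); last by rewrite -zy.
by apply/ballGP; exists p; rewrite // /is_path xp eqxx.
Qed.

Lemma card_ge_injective_seq (A : set V) n (y : nat -> V) : injective y ->
  (forall i, A (y i)) -> (`I_n #<= A)%card.
Proof.
move=> yi yA.
have := @inj_card_eq _ _ `I_n y (in2W yi).
rewrite card_eq_sym card_eq_le => /andP[le _]; apply: (card_le_trans le).
by apply: subset_card_le => _ [i _ <-].
Qed.

Lemma size_hitting_time_nondecreasing x :
  {homo (fun n => tau n x) : n m / (n <= m)%N >-> (n <= m)%E}.
Proof.
move=> n m nm; apply: ereal_inf_le_tmp => _ [t mt <-]; exists t => //=.
by apply: card_le_trans mt; rewrite card_le_II.
Qed.

(* Both hitting times are nondecreasing in n, so it suffices to compare their
   suprema: a ball of finite L-radius is infinite iff it meets every sphere. *)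
Lemma size_hitting_time_cvg x : (forall v, finite_set [set u | adj v u]) ->
  tau n x @[n --> \oo] --> ereal_sup (range (fun n => M n x)).
Proof.
move=> lf.
suff <- : ereal_sup (range (fun n => tau n x)) = ereal_sup (range (fun n => M n x)).
  exact/ereal_nondecreasing_cvgn/size_hitting_time_nondecreasing.
apply/eqP; rewrite eq_le; apply/andP; split.
- apply/ereal_supP => _ [n _ <-]; rewrite leNgt; apply/negP => lt.
  (* With such a [t], every sphere has a vertex at L-distance below [t]. Spheres are disjoint, so
     these vertices are distinct and the ball of radius [t] is infinite. *)
  have [t Mt tn] : exists2 t : R, (forall k, (M k x < t%:E)%E) & (t%:E < tau n x)%E.
    have M0 : (0 <= ereal_sup (range (fun n => M n x)))%E.
      apply: le_trans (sphere_hitting_time_ge0 0 x) _.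
      by apply: ereal_sup_ubound; exists 0.
    have ub k : (M k x <= ereal_sup (range (fun n => M n x)))%E.
      by apply: ereal_sup_ubound; exists k.
    have [s sE] : exists s : R, ereal_sup (range (fun n => M n x)) = s%:E.
      by case: (ereal_sup _) M0 lt => [s| |] // _; [exists s|rewrite ltNge leey].
    rewrite sE in lt ub.
    have [t st tn] : exists2 t : R, s < t & (t%:E < tau n x)%E.
      case: (tau n x) lt => [u| |] //; last by exists (s + 1); rewrite ?ltry ?ltrDl.
      by rewrite lte_fin => su; exists ((s + u) / 2); rewrite ?lte_fin; lra.
    by exists t => // k; apply: le_lt_trans (ub k) _; rewrite lte_fin.
  move: tn; apply/negP; rewrite -leNgt; apply: ereal_inf_lbound; exists t => //=.
  have H k : exists y, sphereG (R := R) adj k.+1 x y /\ (dL adj len x y < t%:E)%E.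
    by have /ereal_inf_ltP[_ [y ys <-] yt] := Mt k.+1; exists y.
  have [y yP] := choice H.
  apply: (@card_ge_injective_seq _ _ y) => [i j yij|i]; last first.
    by rewrite /ballL /=; apply: ltW; case: (yP i).
  wlog ij : i j yij / (i < j)%N.
    by move=> W; case: (ltngtP i j) => // ?; [exact: W|apply/esym; exact: W].
  have [/sphereGP[bi _] _] := yP i.
  have [/sphereGP[_ nb] _] := yP j; exfalso; apply: nb; rewrite -yij.
  exact: ballG_le bi.
- apply/ereal_supP => _ [n _ <-]; rewrite leNgt; apply/negP => lt.
  have [t Mt tn] : exists2 t : R, (forall k, (tau k x <= t%:E)%E) & (t%:E < M n x)%E.
    have ub k : (tau k x <= ereal_sup (range (fun n => tau n x)))%E.
      by apply: ereal_sup_ubound; exists k.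
    move: (ereal_sup _) ub lt (sphere_hitting_time_ge0 n x) => [s| |] // ub lt Mn0.
    - by exists s.
    - by move: lt; rewrite ltNge leey.
    - exists (-1); last by apply: lt_le_trans Mn0; rewrite lte_fin ltrN10.
      by move=> k; apply: le_trans (ub k) _; rewrite leNye.
  (* The infimum defining [tau] need not be attained, hence a radius [u] above [t]. The ball of
     radius [u] still lies in the finite graph ball of radius [n]. *)
  have [u tu uM] : exists2 u : R, t < u & (u%:E < M n x)%E.
    move: (M n x) tn => [s| |] //; last by exists (t + 1); rewrite ?ltry // ltrDl.
    by rewrite lte_fin => ts; exists ((t + s) / 2); rewrite ?lte_fin; lra.
  have sub : ballL adj len u x `<=` ballG (R := R) adj n%:R x.
    move=> y yu; apply: contrapT => yn; move: yu; rewrite /ballL /= leNgt => /negP; apply.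
    apply: lt_le_trans uM _; apply: le_trans (sphere_hitting_time_le_dL yn).
    exact: sphere_hitting_time_nondecreasing.
  have /finite_setP[m mE] := sub_finite_set sub (ballG_finite x n lf).
  have : (tau m.+1 x < u%:E)%E by apply: le_lt_trans (Mt _) _; rewrite lte_fin.
  case/ereal_inf_ltP => _ [v vm <-]; rewrite lte_fin => vu.
  have : (`I_m.+1 #<= `I_m)%card.
    apply: card_le_trans vm _; move: mE; rewrite card_eq_le => /andP[mE _].
    apply: card_le_trans mE; apply: subset_card_le => y; rewrite /ballL /= => yv.
    by apply: le_trans yv _; rewrite lee_fin ltW.
  by rewrite card_le_II ltnn.
Qed.

End graph.

(** * Union bounds and the Borel-Cantelli lemma *)

Section covered.
Context {R : realType} {dT : measure_display} {T : measurableType dT}.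
Variable P : probability T R.
Implicit Types (A B : set T) (c : R).

(** A bound on the outer probability: unions over paths and other composite events then need no
    proof of measurability. *)
Definition covered A c := exists B, [/\ measurable B, A `<=` B & (P B <= c%:E)%E].

Lemma coveredS A B c : A `<=` B -> covered B c -> covered A c.
Proof. by move=> AB [D [mD BD PD]]; exists D; split => // w /AB/BD. Qed.

Lemma covered_le A c1 c2 : c1 <= c2 -> covered A c1 -> covered A c2.
Proof.
move=> c12 [D [mD BD PD]]; exists D; split => //.
by apply: le_trans PD _; rewrite lee_fin.
Qed.

Lemma covered_measurable A c : measurable A -> (P A <= c%:E)%E -> covered A c.
Proof. by move=> mA PA; exists A; split. Qed.

Lemma covered_set0 c : 0 <= c -> covered set0 c.
Proof. by move=> c0; exists set0; split; rewrite ?measure0 ?lee_fin. Qed.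

Lemma covered_ge0 A c : covered A c -> 0 <= c.
Proof. by case=> B [mB _ PB]; rewrite -lee_fin; exact: le_trans PB. Qed.

Lemma nneseries_le_bound (u : nat -> \bar R) (C : \bar R) :
  (forall n, 0 <= u n)%E -> (forall N, \sum_(0 <= n < N) u n <= C)%E ->
  (\sum_(0 <= n <oo) u n <= C)%E.
Proof.
move=> u0 uC; apply: lime_le; first by apply: is_cvg_nneseries => n _ _; exact: u0.
by apply: nearW => N; exact: uC.
Qed.

Lemma sum_pickle_inv_le (I : countType) (w : I -> R) C N :
  (forall s : seq I, uniq s -> \sum_(i <- s) w i <= C) ->
  \sum_(0 <= n < N) (if @pickle_inv I n is Some i then w i else 0) <= C.
Proof.
move=> wC; apply: le_trans (wC _ (pmap_uniq (@pickle_invK I) (iota_uniq 0 N))).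
rewrite /index_iota subn0; elim: (iota 0 N) => [|n s IH]; first by rewrite !big_nil.
rewrite big_cons /=; case: pickle_inv => [i|] /=; last by rewrite add0r.
by rewrite big_cons lerD2l.
Qed.

(** Countable subadditivity, with summability expressed through duplicate-free lists, so that no
    enumeration of the lattice or of the levels appears in the hypotheses. *)
Lemma covered_bigcup (I : countType) (F : I -> set T) (w : I -> R) C :
  (forall i, covered (F i) (w i)) ->
  (forall s : seq I, uniq s -> \sum_(i <- s) w i <= C) ->
  covered (\bigcup_i F i) C.
Proof.
move=> Fw wC; have [B BP] := choice Fw.
pose G n := if @pickle_inv I n is Some i then B i else set0.
have mG n : measurable (G n).
  by rewrite /G; case: pickle_inv => [i|] //; case: (BP i).
exists (\bigcup_n G n); split; first exact: bigcupT_measurable.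
  move=> x [i _ Fix]; exists (pickle i) => //; rewrite /G pickleK_inv.
  by case: (BP i) => _ + _; apply.
apply: le_trans (measure_sigma_subadditive P mG _ _) _ => //.
  exact: bigcupT_measurable.
apply: nneseries_le_bound => // N.
apply: (@le_trans _ _ (\sum_(0 <= n < N) (if @pickle_inv I n is Some i then w i else 0))%:E).
  rewrite -sumEFin; apply: lee_sum => n _; rewrite /G.
  by case: pickle_inv => [i|]; [case: (BP i)|rewrite measure0].
by rewrite lee_fin sum_pickle_inv_le.
Qed.

Lemma coveredU A B a b : covered A a -> covered B b -> covered (A `|` B) (a + b).
Proof.
move=> cA cB.
apply: (@coveredS _ (\bigcup_(i : bool) (if i then A else B))).
  by move=> x [?|?]; [exists true|exists false].
apply: (@covered_bigcup _ _ (fun i : bool => if i then a else b)) => [[]//|s us].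
have := covered_ge0 cA; have := covered_ge0 cB => b0 a0.
apply: (@le_trans _ _ (\sum_(i : bool) (if i then a else b))).
  rewrite big_uniq //= big_mkcond /=; apply: ler_sum => i _.
  by case: ifP => // _; case: i.
by rewrite big_bool.
Qed.

Lemma covered_negligible A : (forall e, 0 < e -> covered A e) -> P.-negligible A.
Proof.
move=> cA; have [B BP] := choice (fun n : nat => cA n.+1%:R^-1 ltac:(by rewrite invr_gt0 ltr0n)).
exists (\bigcap_n B n); split.
- by apply: bigcap_measurableType => n _; case: (BP n).
- apply/eqP; rewrite eq_le measure_ge0 andbT; apply/lee_addgt0Pr => e e0; rewrite add0e.
  have /filter_ex[n] := near_infty_natSinv_lt (PosNum e0); rewrite /= => ne.
  case: (BP n) => mB _ /le_trans PB; apply: (@le_trans _ _ (P (B n))).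
    apply: le_measure; rewrite ?inE //; last by move=> x; apply.
    by apply: bigcap_measurableType => k _; case: (BP k).
  by apply: PB; rewrite lee_fin ltW.
- by move=> w Aw n _; case: (BP n) => _ + _; apply.
Qed.

Lemma sum_geometric_half (C : R) N : 0 <= C ->
  \sum_(0 <= k < N) C / 2 ^+ k <= 2 * C.
Proof.
move=> C0; suff -> : \sum_(0 <= k < N) C / 2 ^+ k = 2 * C - 2 * C / 2 ^+ N.
  by rewrite gerBl divr_ge0 ?mulr_ge0 ?exprn_ge0.
elim: N => [|N IH]; first by rewrite big_geq // expr0 divr1 subrr.
rewrite big_nat_recr //= IH exprS invfM.
by field; rewrite expf_neq0.
Qed.

Lemma borel_cantelli_covered (A : nat -> set T) (c : nat -> R) C :
  (forall k, covered (A k) (c k)) -> (forall N, \sum_(0 <= k < N) c k <= C) ->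
  {ae P, forall w, exists K, forall k, (K <= k)%N -> ~ A k w}.
Proof.
move=> cA cC; have [B BP] := choice cA.
have mB k : measurable (B k) by case: (BP k).
apply: (@negligibleS _ _ _ _ (lim_sup_set B)); last first.
  apply/negligibleP.
    by apply: bigcap_measurableType => n _; exact: bigcup_measurable.
  apply: lim_sup_set_cvg0 => //.
  apply: (@le_lt_trans _ _ C%:E); last by rewrite ltry.
  apply: nneseries_le_bound => // N.
  apply: le_trans (_ : (\sum_(0 <= k < N) c k)%:E <= _)%E; last by rewrite lee_fin.
  by rewrite -sumEFin; apply: lee_sum => k _; case: (BP k).
move=> w /= nK n _; apply: contrapT => nB; apply: nK; exists n => k nk Ak.
by apply: nB; exists k => //=; case: (BP k) => _ + _; apply.
Qed.

(** Before [k0] the events are replaced by the empty set, so a bound valid only from [k0] on is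
    enough. *)
Lemma borel_cantelli_geometric (A : nat -> set T) C k0 :
  (forall k, (k0 <= k)%N -> covered (A k) (C / 2 ^+ k)) ->
  {ae P, forall w, exists K, forall k, (K <= k)%N -> ~ A k w}.
Proof.
move=> cA; have C0 : 0 <= C.
  by have := covered_ge0 (cA _ (leqnn k0)); rewrite pmulr_lge0 // invr_gt0 exprn_gt0.
have := @borel_cantelli_covered (fun k => if (k0 <= k)%N then A k else set0)
  (fun k => C / 2 ^+ k) (2 * C).
move=> /(_ _ (fun N => sum_geometric_half N C0)) H.
apply: filterS (H _) => [w [K HK]|k].
  exists (maxn K k0) => k; rewrite geq_max => /andP[Kk kk].
  by have := HK k Kk; rewrite kk.
by case: ifP => kk; [exact: cA|apply: covered_set0; rewrite divr_ge0 ?exprn_ge0].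
Qed.

(** Along the enumeration by [pickle], no event occurs beyond some code, and only finitely many
    indices have a smaller code. *)
Lemma borel_cantelli_countable (I : countType) (F : I -> set T) (w : I -> R) C :
  (forall i, covered (F i) (w i)) ->
  (forall s : seq I, uniq s -> \sum_(i <- s) w i <= C) ->
  {ae P, forall t, finite_set [set i | F i t]}.
Proof.
move=> Fw wC.
have := @borel_cantelli_covered (fun n => if @pickle_inv I n is Some i then F i else set0)
  (fun n => if @pickle_inv I n is Some i then w i else 0) C.
move=> /(_ _ (fun N => sum_pickle_inv_le N wC)) H.
apply: filterS (H _) => [t [K HK]|n]; last first.
  by case: pickle_inv => [i|] //; exact: covered_set0.
apply: (@sub_finite_set _ _ (pickle @^-1` `I_K)).
  move=> i Fi /=; rewrite ltnNge; apply/negP => /HK.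
  by rewrite pickleK_inv.
apply: finite_preimage; last exact: finite_II.
by move=> i j _ _; exact: (pcan_inj (@pickleK I)).
Qed.

Lemma ae_forall_countable (I : countType) (A : I -> T -> Prop) :
  (forall i, {ae P, forall t, A i t}) -> {ae P, forall t, forall i, A i t}.
Proof.
move=> aeA.
have := (@ae_foralln _ _ _ P (fun n t => if @pickle_inv I n is Some i then A i t else True)).
move=> H; apply: filterS (H _) => [t At i|n].
  by have := At (pickle i); rewrite pickleK_inv.
by case: pickle_inv => [i|]; [exact: aeA|exact: aeW].
Qed.

End covered.

(** * Edge probabilities given the vertex weights *)

Section sigma.
Context {dd : measure_display} {T : measurableType dd}.
Variable C : set (set T).
Notation sC := <<s C>>.

Lemma gen_sub A : C A -> sC A.
Proof. exact: sub_gen_smallest. Qed.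

Lemma gen_setT : sC setT.
Proof. exact: (@measurableT _ (g_sigma_algebraType C)). Qed.

Lemma gen_setI A B : sC A -> sC B -> sC (A `&` B).
Proof. exact: (@measurableI _ (g_sigma_algebraType C)). Qed.

Lemma gen_bigcap (I : choiceType) (s : seq I) (F : I -> set T) :
  (forall i, i \in s -> sC (F i)) -> sC (\bigcap_(i in [set` s]) F i).
Proof.
move=> sF; rewrite bigcap_seq big_seq.
apply: (big_rec (fun A => sC A)) => [|i A /sF sFi sA]; first exact: gen_setT.
exact: gen_setI.
Qed.

Lemma gen_measurable A : C `<=` measurable -> sC A -> measurable A.
Proof.
by move=> Cm; apply: smallest_sub => //; exact: sigma_algebra_measurable.
Qed.

End sigma.

Section dist.
Context {R : realType} {d : nat}.
Local Notation Zd := 'rV[int]_d.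
Local Notation dist := (@euclidean_dist R d).

Lemma euclidean_distxx (x : Zd) : dist x x = 0.
Proof. by rewrite /euclidean_dist big1 ?sqrtr0// => i _; rewrite subrr expr0n. Qed.

Lemma euclidean_dist_coord (x y : Zd) i : `|(x 0 i - y 0 i)%:~R| <= dist x y.
Proof.
rewrite /euclidean_dist -sqrtr_sqr ler_wsqrtr // (bigD1 i) //= lerDl.
by apply: sumr_ge0 => j _; exact: sqr_ge0.
Qed.

Lemma euclidean_dist_ge1 (x y : Zd) : x != y -> 1 <= dist x y.
Proof.
move=> xy; have [i xyi] : exists i, x 0 i != y 0 i.
  apply/existsP; rewrite -negb_forall; apply: contra xy => /forallP xy.
  by apply/eqP/rowP => i; apply/eqP.
apply: le_trans (euclidean_dist_coord x y i).
by rewrite -intr_norm -[1]/(1%:~R) ler_int -gtz0_ge1 normr_gt0 subr_eq0.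
Qed.

Lemma euclidean_dist_far (x y : Zd) : x != y -> dist x y = 1 \/ 1 < dist x y.
Proof.
move=> /euclidean_dist_ge1; rewrite le_eqVlt => /orP[/eqP|]; first by left.
by right.
Qed.

End dist.

Lemma measurable_RV_preimage {R : realType} {dS : measure_display}
    {S : measurableType dS} {Q : probability S R} (X : {RV Q >-> R}) (B : set R) :
  measurable B -> measurable (X @^-1` B).
Proof. by move=> mB; rewrite -[X in measurable X]setTI; exact: measurable_funP. Qed.

Section model.
Context {R : realType} {d : nat} {lambda alpha : R}.
Context {dS : measure_display} {S : measurableType dS} {Q : probability S R}.
Context {W L : {RV Q >-> R}}.
Context {dT : measure_display} {T : measurableType dT} {P : probability T R}.
Variable G : @weighted_sfp R d lambda alpha dS S Q W L dT T P.

Local Notation Zd := 'rV[int]_d.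
Local Notation dist := (@euclidean_dist R d).
Local Notation ww := (vertex_weight G).
Local Notation conn w e :=
  (connection_prob lambda alpha (fun x => ww x w) e.1 e.2).
Local Notation sW := <<s vertex_events ww >>.
Local Notation sWE := <<s vertex_events ww `|` edge_events (edge G) >>.

Lemma measurable_conn (e : Zd * Zd) :
  measurable_fun setT (fun w => conn w e).
Proof.
apply: measurable_funB => //; apply: measurableT_comp => //.
apply: measurable_funN; apply: measurable_funM => //; apply: measurable_funM => //.
exact: measurable_funM.
Qed.

Lemma sW_measurable A : sW A -> measurable A.
Proof.
by apply: gen_measurable => _ [x [B [mB ->]]]; exact: measurable_RV_preimage.
Qed.

Lemma sWE_measurable A : sWE A -> measurable A.
Proof.
apply: gen_measurable => B [[x [C [mC ->]]]|[x [y ->]]]; last exact: measurable_edge.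
exact: measurable_RV_preimage.
Qed.

Lemma sW_vertex x B : measurable B -> sW (ww x @^-1` B).
Proof. by move=> mB; apply: gen_sub; exists x, B. Qed.

Lemma sWE_vertex x B : measurable B -> sWE (ww x @^-1` B).
Proof. by move=> mB; apply: gen_sub; left; exists x, B. Qed.

Lemma sWE_edge x y : sWE (edge G x y).
Proof. by apply: gen_sub; right; exists x, y. Qed.

Lemma conn_ge0 w e : 0 < lambda -> 0 <= ww e.1 w -> 0 <= ww e.2 w ->
  0 <= conn w e.
Proof.
move=> l0 w1 w2; rewrite /connection_prob subr_ge0 -expR0 ler_expR lerNl oppr0.
by rewrite divr_ge0 ?powR_ge0 // mulr_ge0 // mulr_ge0 // ltW.
Qed.

(* Neighbours at distance 1 are always connected, so they need a bound c >= 1. *)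
Lemma edges_prob_le (F : seq (Zd * Zd)) A (c : Zd * Zd -> R) :
  0 < lambda -> pair_list F -> sW A ->
  {in F, forall e, [/\ e.1 != e.2, 0 <= c e,
    (dist e.1 e.2 = 1 -> 1 <= c e) &
    forall w, A w -> [/\ 0 <= ww e.1 w, 0 <= ww e.2 w & conn w e <= c e]]} ->
  (P (A `&` \bigcap_(e in [set` F]) edge G e.1 e.2) <=
    P A * (\prod_(e <- F) c e)%:E)%E.
Proof.
move=> l0 [uF sF] sA cP.
(* Pairs at distance 1 are dropped from the intersection because [edge_far] covers only far pairs;
   their factors, all at least 1, are put back at the end. *)
pose far (e : Zd * Zd) := 1 < dist e.1 e.2.
have mA := sW_measurable sA.
have plF : pair_list ([seq e <- F | far e]).
  split; first exact: filter_uniq.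
  move=> e; rewrite mem_filter => /andP[_ /sF]; apply: contra.
  by rewrite mem_filter => /andP[].
have farF : {in [seq e <- F | far e], forall e, 1 < dist e.1 e.2}.
  by move=> e; rewrite mem_filter => /andP[].
have edge_bigcap (F' : seq (Zd * Zd)) : measurable (\bigcap_(e in [set` F']) edge G e.1 e.2).
  apply: sWE_measurable; apply: (@gen_bigcap _ _ _ _ F') => e _; exact: sWE_edge.
apply: (@le_trans _ _ (P (A `&` \bigcap_(e in [set` [seq e <- F | far e]]) edge G e.1 e.2))).
  apply: le_measure; rewrite ?inE; try by apply: measurableI.
  apply: setIS => w Fw e /=; rewrite mem_filter => /andP[_ eF].
  exact: Fw.
rewrite (edge_far plF farF sA).
have prod_meas : measurable_fun A
    (fun w => (\prod_(e <- [seq e <- F | far e]) conn w e)%:E).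
  apply/measurable_EFinP; apply: measurable_funTS.
  elim: ([seq e <- F | far e]) => [|e s IH].
    by under eq_fun do rewrite big_nil; exact: measurable_cst.
  under eq_fun do rewrite big_cons.
  by apply: measurable_funM => //; exact: measurable_conn.
apply: (@le_trans _ _ (\int[P]_(w in A) (cst (\prod_(e <- [seq e <- F | far e]) c e)%:E w))%E).
  apply: ge0_le_integral => //.
  - move=> w Aw; rewrite lee_fin big_seq; apply: prodr_ge0 => e.
    rewrite mem_filter => /andP[_ /cP[_ _ _ /(_ _ Aw)[? ? _]]].
    exact: conn_ge0.
  - move=> w Aw; rewrite lee_fin big_seq [leRHS]big_seq; apply: ler_prod => e.
    rewrite mem_filter => /andP[_ /cP[_ _ _ /(_ _ Aw)[? ? ->]]].
    by rewrite conn_ge0.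
rewrite integral_cst // muleC; apply: lee_wpmul2l => //.
rewrite lee_fin big_filter [leRHS](bigID far) /= ler_peMr //.
  by rewrite big_seq_cond; apply: prodr_ge0 => e /andP[/cP[]].
rewrite big_seq_cond; apply: (big_rec (fun y => 1 <= y)) => // e y /andP[/cP[ne _ c1 _] nf].
move=> y1; rewrite -[leLHS]mulr1 ler_pM //.
by apply: c1; case: (euclidean_dist_far (R := R) ne) => // H; rewrite /far H in nf.
Qed.

End model.

(** * First moment of self-avoiding paths *)

(** The left side is at most min(1, X), hence at most any power of X with exponent in [0, 1]. A
    small exponent lowers the moments of the weights at the expense of decay in the distance. *)
Lemma one_subr_expRN_le {R : realType} (z X theta : R) :
  z <= X -> 0 < X -> 0 <= theta <= 1 -> 1 - expR (- z) <= X `^ theta.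
Proof.
move=> zX X0 /andP[t0 t1]; have [X1|X1] := leP 1 X.
  apply: (@le_trans _ _ (X `^ 0)); last exact: ler_powR.
  by rewrite powRr0 gerBl expR_ge0.
apply: (@le_trans _ _ X); last by apply: ger1_powR => //; rewrite X0 ltW.
by have := expR_ge1Dx (- z); lra.
Qed.

Section pairs.
Context {V : eqType}.
Implicit Types p : seq V.

Definition consecutive p : seq (V * V) := zip p (behead p).

Lemma consecutive_cons2 x y p :
  consecutive (x :: y :: p) = (x, y) :: consecutive (y :: p).
Proof. by []. Qed.

Lemma mem_consecutive p e : e \in consecutive p -> (e.1 \in p) && (e.2 \in behead p).
Proof.
elim: p => [|x [|y p] IH] //.
rewrite consecutive_cons2 [e \in _]in_cons => /orP[/eqP->|/IH /andP[e1 e2]].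
  by rewrite !inE !eqxx.
by rewrite in_cons e1 orbT /= in_cons e2 orbT.
Qed.

(** A pair repeated in either orientation would repeat a vertex. This makes the edges of a
    self-avoiding path admissible for the independence axioms of the model. *)
Lemma uniq_consecutive p : uniq p -> pair_list (consecutive p) /\
  {in consecutive p, forall e, e.1 != e.2}.
Proof.
elim: p => [|x [|y p] IH]; first by split => //; split.
  by split => //; split.
rewrite cons_uniq => /andP[xyp /IH[[up sp] np]].
have xnin e : e \in consecutive (y :: p) -> (x != e.1) && (x != e.2).
  move=> /mem_consecutive /andP[e1 e2]; apply/andP; split; apply: contraNneq xyp => ->//.
  by rewrite inE e2 orbT.
have xy : x != y by apply: contraNneq xyp => ->; rewrite inE eqxx.
split; last first.
  by rewrite consecutive_cons2 => e; rewrite inE => /orP[/eqP->//|]; exact: np.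
split; rewrite consecutive_cons2.
  rewrite cons_uniq up andbT; apply/negP => /xnin /=.
  by rewrite eqxx.
move=> e; rewrite !inE => /orP[/eqP-> /=|eyp].
  rewrite xpair_eqE negb_or eq_sym (negbTE xy) /=; apply/negP => /xnin /=.
  by rewrite eqxx andbF.
rewrite negb_or (sp _ eyp) andbT; apply/negP => /eqP[e2 e1].
by have := xnin _ eyp; rewrite e2 eqxx andbF.
Qed.

End pairs.

Section first_moment.
Context {R : realType} {d : nat} {lambda alpha : R}.
Context {dS : measure_display} {S : measurableType dS} {Q : probability S R}.
Context {W L : {RV Q >-> R}}.
Context {dT : measure_display} {T : measurableType dT} {P : probability T R}.
Variable G : @weighted_sfp R d lambda alpha dS S Q W L dT T P.
Variable theta : R.
Hypothesis lambda_gt0 : 0 < lambda.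
Hypothesis theta01 : 0 < theta <= 1.

Local Notation Zd := 'rV[int]_d.
Local Notation dist := (@euclidean_dist R d).
Local Notation ww := (vertex_weight G).
Local Notation conn w e :=
  (connection_prob lambda alpha (fun x => ww x w) e.1 e.2).
Local Notation sW := <<s vertex_events ww >>.
Local Notation sWE := <<s vertex_events ww `|` edge_events (edge G) >>.

Definition level_itv (j : nat) : set R := `[expR j%:R, expR j.+1%:R[.

Definition level_tail (j : nat) : R := fine (Q (W @^-1` `[expR j%:R, +oo[)).

Definition at_level (v : Zd) j : set T := ww v @^-1` level_itv j.

Definition kernel (u v : Zd) : R := dist u v `^ (- (alpha * theta)).

(** The factor e^2 pays for rounding both weights down to their levels. The maximum with 1 keeps
    [pair_bound] at least 1 at distance 1, where the edge is always present. *)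
Definition kernel_const : R := (Num.max 1 lambda * expR 2) `^ theta.

Definition pair_bound (t t' : Zd * nat) : R :=
  kernel_const * expR (theta * (t.2%:R + t'.2%:R)) * kernel t.1 t'.1.

Lemma level_tail_ge0 j : 0 <= level_tail j.
Proof. exact: fine_ge0. Qed.

Lemma pair_bound_ge0 t t' : 0 <= pair_bound t t'.
Proof. by rewrite !mulr_ge0 ?expR_ge0 ?powR_ge0. Qed.

Lemma measurable_level_itv j : measurable (level_itv j).
Proof. exact: measurable_itv. Qed.

Lemma conn_le_pair_bound w t t' : t.1 != t'.1 ->
  at_level t.1 t.2 w -> at_level t'.1 t'.2 w ->
  conn w (t.1, t'.1) <= pair_bound t t'.
Proof.
move=> tt; rewrite /at_level /level_itv /= !in_itv /= => /andP[l1 u1] /andP[l2 u2].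
have D1 := euclidean_dist_ge1 (R := R) tt.
have D0 : 0 < dist t.1 t'.1 by apply: lt_le_trans D1.
have m0 : 0 < Num.max 1 lambda by rewrite lt_max ltr01.
pose X := Num.max 1 lambda * expR 2 * expR (t.2%:R + t'.2%:R) * dist t.1 t'.1 `^ (- alpha).
have -> : pair_bound t t' = X `^ theta.
  rewrite /pair_bound /kernel_const /kernel /X !powRM ?mulr_ge0 ?expR_ge0 ?powR_ge0 ?(ltW m0)//.
  by rewrite (mulrC theta) expRM -powRrM mulNr.
apply: one_subr_expRN_le; last 2 first.
- by rewrite /X !mulr_gt0 ?expR_gt0 ?powR_gt0 ?m0.
- by case/andP: theta01 => /ltW-> ->.
rewrite /X powRN; apply: ler_wpM2r; first by rewrite invr_ge0 powR_ge0.
rewrite /= -!mulrA -expRD; apply: ler_pM.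
- exact: ltW.
- by rewrite mulr_ge0 ?(le_trans (expR_ge0 _) l1)// (le_trans (expR_ge0 _) l2).
- by rewrite le_max lexx orbT.
- have -> : 2 + (t.2%:R + t'.2%:R) = t.2.+1%:R + t'.2.+1%:R :> R by rewrite !mulrS; ring.
  rewrite expRD; apply: ler_pM; rewrite ?(le_trans (expR_ge0 _) l1)// ?(le_trans (expR_ge0 _) l2)//.
  + exact: ltW.
  + exact: ltW.
Qed.

Lemma pair_bound_near t t' : dist t.1 t'.1 = 1 -> 1 <= pair_bound t t'.
Proof.
move=> D1; rewrite /pair_bound /kernel D1 powR1 mulr1 -[leLHS]mulr1.
have t0 : 0 <= theta by case/andP: theta01 => /ltW.
apply: ler_pM => //; last by rewrite -expR0 ler_expR mulr_ge0 // addr_ge0.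
rewrite -(powRr0 (Num.max 1 lambda * expR 2)); apply: ler_powR => //.
rewrite -[leLHS]mulr1 ler_pM ?le_max ?lexx//.
by rewrite -expR0 ler_expR.
Qed.

(* Lists of (vertex, level) pairs are traversed from the last vertex of the path
   to the first, so that paths grow at the head of the list. *)
Fixpoint weight_bound (p : seq (Zd * nat)) : R :=
  if p is t :: p1 then
    level_tail t.2 * (if p1 is t' :: _ then pair_bound t t' else 1) * weight_bound p1
  else 1.

Definition path_event (p : seq (Zd * nat)) : set T :=
  (\bigcap_(t in [set` p]) at_level t.1 t.2) `&`
  \bigcap_(e in [set` consecutive (map fst p)]) edge G e.1 e.2.

Lemma weight_bound_ge0 p : 0 <= weight_bound p.
Proof.
elim: p => [|t p IH]; first exact: ler01.
apply: mulr_ge0 => //; apply: mulr_ge0; first exact: level_tail_ge0.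
by case: p {IH} => [|t' p]; [exact: ler01|exact: pair_bound_ge0].
Qed.

Lemma sWE_path_event p : sWE (path_event p).
Proof.
rewrite /path_event; apply: gen_setI; [apply: (@gen_bigcap _ _ _ _ p)|apply: (@gen_bigcap _ _ _ _ (consecutive (map fst p)))] => t _; last exact: sWE_edge.
by apply: sWE_vertex; exact: measurable_level_itv.
Qed.

Lemma prob_at_level_le v j : (P (at_level v j) <= (level_tail j)%:E)%E.
Proof.
rewrite /at_level vertex_weight_law; last exact: measurable_level_itv.
rewrite /level_tail fineK; last by apply: fin_num_measure; exact: measurable_RV_preimage.
apply: le_measure; rewrite ?inE.
- by apply: measurable_RV_preimage; exact: measurable_level_itv.
- by apply: measurable_RV_preimage; exact: measurable_itv.
by move=> w /=; rewrite /level_itv /= !in_itv /= => /andP[->].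
Qed.

Lemma prob_path_event_le p : uniq (map fst p) ->
  (P (path_event p) <= (weight_bound p)%:E)%E.
Proof.
(* The vertices of [p] are distinct, so a level can be read off its vertex; [edges_prob_le] wants
   bounds indexed by pairs of vertices alone. *)
move=> up; pose lv v := nth 0%N (map snd p) (index v (map fst p)).
have lvE : {in p, forall t, lv t.1 = t.2}.
  elim: p @lv up => [//|t p IH] /= /andP[tp up] t'; rewrite inE => /orP[/eqP->|t'p].
    by rewrite eqxx.
  case: ifP => [/eqP tt|_]; last exact: IH.
  by move: tp; rewrite tt => /negP[]; apply: map_f.
pose c (e : Zd * Zd) := pair_bound (e.1, lv e.1) (e.2, lv e.2).
have [plp np] := uniq_consecutive up.
rewrite /path_event.
set A := \bigcap_(t in _) _.
have sA : sW A.
  by apply: gen_bigcap => t _; apply: sW_vertex; exact: measurable_level_itv.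
have inA w v : A w -> v \in map fst p -> at_level v (lv v) w.
  by move=> Aw /mapP[t tp ->]; rewrite lvE //; exact: Aw.
apply: (@le_trans _ _ (P A * (\prod_(e <- consecutive (map fst p)) c e)%:E)%E).
  apply: edges_prob_le => // e ep; split; first exact: np.
  - exact: pair_bound_ge0.
  - exact: (@pair_bound_near (_, _) (_, _)).
  - have /andP[e1 /mem_behead e2] := mem_consecutive ep.
    move=> w Aw; have W1 := inA _ _ Aw e1; have W2 := inA _ _ Aw e2; split.
    + by move: W1; rewrite /at_level /level_itv /= in_itv /= => /andP[/(le_trans (expR_ge0 _))].
    + by move: W2; rewrite /at_level /level_itv /= in_itv /= => /andP[/(le_trans (expR_ge0 _))].
    + exact: (@conn_le_pair_bound w (e.1, lv e.1) (e.2, lv e.2) (np _ ep) W1 W2).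
have PA : (P A <= (\prod_(t <- p) level_tail t.2)%:E)%E.
  have -> : A = \bigcap_(v in [set` map fst p]) ww v @^-1` level_itv (lv v).
    apply/seteqP; split => w Aw.
      by move=> v /= /mapP[t tp ->]; rewrite lvE //; exact: Aw.
    by move=> t /= tp; have := Aw t.1 (map_f _ tp); rewrite lvE.
  rewrite vertex_weight_indep //; last by move=> x; exact: measurable_level_itv.
  rewrite big_map -prodEFin big_seq [leRHS]big_seq.
  apply: (proj2 (_ : (0 <= _)%E /\ _)).
  apply: (big_ind2 (fun x y : \bar R => (0 <= x)%E /\ (x <= y)%E))
    => [|x1 x2 y1 y2 [x10 x12] [y10 y12]|t tp].
  - by split; rewrite ?lee_fin.
  - by split; [exact: mule_ge0|exact: lee_pmul].
  - by split => //; rewrite lvE //; exact: prob_at_level_le.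
apply: (@le_trans _ _ ((\prod_(t <- p) level_tail t.2)%:E *
    (\prod_(e <- consecutive (map fst p)) c e)%:E)%E).
  apply: lee_wpmul2r => //; rewrite lee_fin.
  by apply: prodr_ge0 => e _; exact: pair_bound_ge0.
rewrite -EFinM lee_fin le_eqVlt; apply/orP; left; apply/eqP.
move: lvE; rewrite /c; move: lv {A sA inA PA c plp np up} => lv.
elim: p => [|t p IH] lvE; first by rewrite !big_nil mulr1.
rewrite big_cons /= -IH; last by move=> t' t'p; apply: lvE; rewrite in_cons t'p orbT.
case: p lvE {IH} => [|t' p] lvE; first by rewrite /consecutive /= !big_nil !mulr1.
rewrite [map _ _]/= consecutive_cons2 !big_cons /= !lvE ?in_cons ?eqxx ?orbT//.
by case: (t) (t') => [u i] [u' i']; ring.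
Qed.

End first_moment.

Lemma ler_sum_uniq_nat {R : realType} (f : nat -> R) a (s : seq nat) :
  (forall j, 0 <= f j) -> (forall n, \sum_(0 <= j < n) f j <= a) ->
  uniq s -> \sum_(j <- s) f j <= a.
Proof.
move=> f0 fa us; apply: le_trans (fa (\max_(j <- s) j).+1).
rewrite [leRHS](bigID (mem s) xpredT) -[X in _ <= X + _]big_filter.
rewrite [X in _ <= X + _](perm_big s) ?lerDl ?sumr_ge0//.
apply: uniq_perm => //; first exact/filter_uniq/iota_uniq.
move=> j; rewrite mem_filter mem_index_iota ltnS.
rewrite /=; have [js|//] := boolP (j \in s).
by apply: (@leq_bigmax_seq _ _ xpredT (fun j => j)).
Qed.

(** * Union bound over the extensions of a path *)

Section grow.
Context {R : realType} {d : nat} {lambda alpha : R}.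
Context {dS : measure_display} {S : measurableType dS} {Q : probability S R}.
Context {W L : {RV Q >-> R}}.
Context {dT : measure_display} {T : measurableType dT} {P : probability T R}.
Variable G : @weighted_sfp R d lambda alpha dS S Q W L dT T P.
Variable theta : R.
Hypothesis lambda_gt0 : 0 < lambda.
Hypothesis theta01 : 0 < theta <= 1.

Local Notation Zd := 'rV[int]_d.
Local Notation ww := (vertex_weight G).
Local Notation h := (@level_tail R dS S Q W).
Local Notation pb := (@pair_bound R d lambda alpha theta).
Local Notation weight_bound := (@weight_bound R d lambda alpha dS S Q W theta).
Local Notation kernel := (@kernel R d alpha theta).
Local Notation kernel_const := (@kernel_const R lambda theta).
Local Notation path_event := (path_event G).

(** Lists run backwards, so the two entries at the head form the last edge of the path. *)
Definition last_event (B : set R) (p : seq (Zd * nat)) : set T :=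
  if p is t :: t' :: _ then edge_weight G t'.1 t.1 @^-1` B else setT.

(** [path_event] belongs to the sigma-algebra of the weights and the graph and forces the last edge
    to be present, so the weight of that edge is still an independent copy of L. *)
Lemma prob_path_last_le t t' p B q : uniq (map fst [:: t, t' & p]) ->
  measurable B -> (Q (L @^-1` B) <= q%:E)%E ->
  (P (path_event [:: t, t' & p] `&` last_event B [:: t, t' & p]) <=
    (weight_bound [:: t, t' & p] * q)%:E)%E.
Proof.
move=> up mB Qq.
have := @edge_weight_iid _ _ _ _ _ _ _ _ _ _ _ _ G [:: (t'.1, t.1)] (fun=> B)
  (path_event [:: t, t' & p]).
rewrite big_seq1 /= => H.
have -> : path_event [:: t, t' & p] `&` edge_weight G t'.1 t.1 @^-1` B =
  path_event [:: t, t' & p] `&`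
   \bigcap_(e in [set` [:: (t'.1, t.1)]]) edge_weight G e.1 e.2 @^-1` B.
  by congr (_ `&` _); rewrite bigcap_seq big_seq1.
have tt : t.1 != t'.1.
  by move: up => /= /andP[+ _]; apply: contraNneq => ->; rewrite in_cons eqxx.
rewrite H //.
- rewrite EFinM; apply: lee_pmul => //; apply: prob_path_event_le => //.
- split => // e; rewrite !inE => /eqP-> /=; apply/eqP => -[e1 _].
  by rewrite e1 eqxx in tt.
- exact: sWE_path_event.
- move=> e; rewrite inE => /eqP-> /= w [_ /(_ (t.1, t'.1))].
  by rewrite edge_sym; apply; rewrite /= consecutive_cons2 in_cons eqxx.
Qed.

(** Adds one vertex: [c0] bounds the path so far, which ends in [(v, i)], and [b j] bounds all that
    follows a new vertex of level [j] apart from its edge to [v]. As [pair_bound] splits into a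
    factor for positions and one for levels, the two sums separate. *)
Lemma grow_covered c0 (v : Zd) i (F : Zd -> nat -> set T) (b : nat -> R) a Z :
  0 <= c0 -> (forall j, 0 <= b j) ->
  (forall n, \sum_(0 <= j < n) expR (theta * j%:R) * h j * b j <= a) ->
  (forall s, uniq s -> \sum_(u <- s) kernel u v <= Z) ->
  (forall u j, covered P (F u j) (h j * pb (u, j) (v, i) * c0 * b j)) ->
  covered P (\bigcup_u \bigcup_j F u j)
    (c0 * expR (theta * i%:R) * (kernel_const * Z) * a).
Proof.
move=> c00 b0 ha hZ cF.
have a0 : 0 <= a by have := ha 0%N; rewrite big_geq.
have k0 : 0 <= kernel_const by exact: powR_ge0.
apply: (@covered_bigcup _ _ _ _ Zd _
  (fun u => c0 * expR (theta * i%:R) * kernel_const * a * kernel u v)) => [u|s us].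
  apply: (@covered_bigcup _ _ _ _ nat _
    (fun j => h j * pb (u, j) (v, i) * c0 * b j)) => [j|s us]; first exact: cF.
  apply: (@le_trans _ _ (c0 * expR (theta * i%:R) * kernel_const * kernel u v *
      \sum_(j <- s) expR (theta * j%:R) * h j * b j)).
    rewrite mulr_sumr; apply: ler_sum => j _; rewrite /pair_bound /= mulrDr expRD.
    by rewrite le_eqVlt; apply/orP; left; apply/eqP; ring.
  rewrite -[leRHS]mulrA (mulrC a) mulrA; apply: ler_wpM2l.
    by rewrite !mulr_ge0 ?expR_ge0 ?powR_ge0.
  apply: ler_sum_uniq_nat => // j.
  by rewrite !mulr_ge0 ?expR_ge0 ?level_tail_ge0.
rewrite -mulr_sumr; apply: (@le_trans _ _ (c0 * expR (theta * i%:R) * kernel_const * a * Z)).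
  by apply: ler_wpM2l; [rewrite !mulr_ge0 ?expR_ge0|exact: hZ].
by rewrite le_eqVlt; apply/orP; left; apply/eqP; ring.
Qed.

Variable cst : nat -> nat -> bool.

(* The level of the vertex at position i of the path satisfies [cst i]. *)
Fixpoint level_constraint (p : seq (Zd * nat)) : bool :=
  if p is t :: p1 then cst (size p1) t.2 && level_constraint p1 else true.

(** [q] holds the [r.+1] vertices added after the path [p], the newest at the head. *)
Definition extends (B : set R) r (p : seq (Zd * nat)) : set T :=
  [set w | exists q : seq (Zd * nat), [/\ size q = r.+1, uniq (map fst (q ++ p)),
     level_constraint (q ++ p), path_event (q ++ p) w & last_event B (q ++ p) w]].

Lemma level_constraint_cat q p : level_constraint (q ++ p) -> level_constraint p.
Proof. by elim: q => //= t q IH /andP[_ /IH]. Qed.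

(* Peeling off the first new vertex: summing over its position gives the factor
   kernel_const * Z, and summing over its level gives a m. *)
Lemma extends_covered (B : set R) (y Z z : R) (a : nat -> R) k :
  measurable B -> (Q (L @^-1` B) <= y%:E)%E ->
  (forall v s, uniq s -> \sum_(u <- s) kernel u v <= Z) ->
  (forall n, \sum_(0 <= j < n) expR (theta * j%:R) * h j * (cst k j)%:R <= z) ->
  (forall m, 0 <= a m) ->
  (forall m n, (m < k)%N ->
    \sum_(0 <= j < n) expR (2 * theta * j%:R) * h j * (cst m j)%:R <= a m) ->
  forall r t p, ((size p).+1 + r = k)%N ->
  covered P (extends B r (t :: p))
   (weight_bound (t :: p) * expR (theta * t.2%:R) * (kernel_const * Z) ^+ r.+1 *
     (\prod_((size p).+1 <= m < k) a m) * (z * y)).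
Proof.
move=> mB Qy hZ hz a0 ha.
have y0 : 0 <= y by rewrite -lee_fin; apply: le_trans Qy.
have z0 : 0 <= z by have := hz 0%N; rewrite big_geq.
have Z0 : 0 <= Z by have := hZ 0 [::] isT; rewrite big_nil.
have k0 : 0 <= kernel_const by exact: powR_ge0.
elim=> [|r IH] [v i] p pk.
  have -> : weight_bound ((v, i) :: p) * expR (theta * i%:R) * (kernel_const * Z) ^+ 1 *
     (\prod_((size p).+1 <= m < k) a m) * (z * y) =
     weight_bound ((v, i) :: p) * expR (theta * i%:R) * (kernel_const * Z) * (z * y).
    by rewrite -pk addn0 big_geq // mulr1 expr1.
  pose F u j := [set w | [/\ uniq (map fst [:: (u, j), (v, i) & p]), cst k j,
    path_event [:: (u, j), (v, i) & p] w & last_event B [:: (u, j), (v, i) & p] w]].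
  apply: (@coveredS _ _ _ _ _ (\bigcup_u \bigcup_j F u j)).
    move=> w [[|[u j] [|? ?]] [sq up cp pw lw]] //.
    exists u; first by [].
    exists j; first by [].
    split => //.
    by move: cp => /andP[+ _]; rewrite /= -pk addn0.
  apply: (@grow_covered _ _ _ _ (fun j => (cst k j)%:R * y)).
  - exact: weight_bound_ge0.
  - by move=> j; rewrite mulr_ge0.
  - move=> n; under eq_bigr do rewrite mulrA.
    by rewrite -mulr_suml; apply: ler_wpM2r.
  - exact: hZ.
  - move=> u j.
    have w0 : 0 <= weight_bound ((u, j) :: (v, i) :: p) by exact: weight_bound_ge0.
    have [cj|ncj] := boolP (cst k j); last first.
      apply: (@coveredS _ _ _ _ _ set0).
        by move=> w [_ cj _ _]; rewrite cj in ncj.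
      by apply: covered_set0; rewrite mul0r mulr0.
    have [up|nup] := boolP (uniq (map fst ((u, j) :: (v, i) :: p))); last first.
      apply: (@coveredS _ _ _ _ _ set0).
        by move=> w [up _ _ _]; rewrite up in nup.
      by apply: covered_set0; apply: mulr_ge0; [exact: w0|rewrite mulr_ge0].
    rewrite mul1r.
    apply: (@coveredS _ _ _ _ _ (path_event ((u, j) :: (v, i) :: p) `&`
        last_event B ((u, j) :: (v, i) :: p))).
      by move=> w [_ _ ? ?].
    apply: covered_measurable; last exact: prob_path_last_le.
    apply: measurableI; first by apply: (@sWE_measurable _ _ _ _ _ _ _ _ _ _ _ _ G); exact: sWE_path_event.
    exact: measurable_RV_preimage.
have pk' : ((size p).+2 + r = k)%N by rewrite -pk addnS.
have prod0 : 0 <= \prod_((size p).+2 <= m < k) a m by apply: prodr_ge0.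
have -> : weight_bound ((v, i) :: p) * expR (theta * i%:R) * (kernel_const * Z) ^+ r.+2 *
     (\prod_((size p).+1 <= m < k) a m) * (z * y) =
     weight_bound ((v, i) :: p) * expR (theta * i%:R) * (kernel_const * Z) *
     (a (size p).+1 * ((kernel_const * Z) ^+ r.+1 *
     (\prod_((size p).+2 <= m < k) a m) * (z * y))).
  rewrite [in LHS]big_ltn; last by rewrite -pk' leq_addr.
  by rewrite (exprS _ r.+1); ring.
pose C := (kernel_const * Z) ^+ r.+1 * (\prod_((size p).+2 <= m < k) a m) * (z * y).
have C0 : 0 <= C by rewrite !mulr_ge0 // exprn_ge0 // mulr_ge0.
apply: (@coveredS _ _ _ _ _ (\bigcup_u \bigcup_j
   (if cst (size p).+1 j then extends B r ((u, j) :: (v, i) :: p) else set0))).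
  move=> w [q [sq uq cq pq lq]].
  (* The vertex added right after [(v, i)] is the last entry of [q]. *)
  case/lastP: q sq uq cq pq lq => [//|q [u j]]; rewrite size_rcons cat_rcons => -[sq] uq cq pq lq.
  exists u => //; exists j => //.
  have /= /andP[-> _] := level_constraint_cat cq.
  by exists q.
apply: (@grow_covered _ _ _ _ (fun j => (cst (size p).+1 j)%:R * expR (theta * j%:R) * C)).
- exact: weight_bound_ge0.
- by move=> j; apply: mulr_ge0 => //; rewrite mulr_ge0 ?expR_ge0.
(* The new vertex will lie on two edges of the path, each contributing e^(theta j); hence the
   truncated moment of order 2 theta bounded by [a]. *)
- move=> n; rewrite [leLHS](_ : _ = (\sum_(0 <= j < n)
     expR (2 * theta * j%:R) * h j * (cst (size p).+1 j)%:R) * C).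
    by apply: ler_wpM2r => //; apply: ha; rewrite -pk' ltnS leq_addr.
  rewrite mulr_suml; apply: eq_bigr => j _.
  have -> : 2 * theta * j%:R = theta * j%:R + theta * j%:R by ring.
  by rewrite expRD; ring.
- exact: hZ.
- move=> u j; case: ifP => cj; last first.
    by apply: covered_set0; rewrite !mul0r mulr0.
  apply: (covered_le _ (IH (u, j) ((v, i) :: p) pk')).
  have -> : weight_bound [:: (u, j), (v, i) & p] =
    h j * pb (u, j) (v, i) * weight_bound ((v, i) :: p) by [].
  have E (h1 b1 w1 e1 k1 p1 zy : R) : h1 * b1 * w1 * e1 * k1 * p1 * zy =
    h1 * b1 * w1 * (1 * e1 * (k1 * p1 * zy)) by ring.
  by rewrite le_eqVlt; apply/orP; left; apply/eqP; exact: E.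
Qed.

End grow.

(** * Lattice sums, regular variation and quantiles *)

(** Telescopes r (n+2)^(-(1+r)) <= (n+1)^(-r) - (n+2)^(-r). This follows from e^t >= 1 + t used
    twice: (n+2)/(n+1) >= e^(1/(n+2)) and e^(r/(n+2)) >= 1 + r/(n+2). *)
Lemma sum_powR_le {R : realType} (r : R) N : 0 < r ->
  \sum_(0 <= n < N) n.+1%:R `^ (- (1 + r)) <= 1 + r^-1.
Proof.
move=> r0.
have H n : r * n.+2%:R `^ (- (1 + r)) <= n.+1%:R `^ (- r) - n.+2%:R `^ (- r).
  have n1 : (0 : R) < n.+1%:R by rewrite ltr0n.
  have n2 : (0 : R) < n.+2%:R by rewrite ltr0n.
  have -> : n.+1%:R `^ (- r) = n.+2%:R `^ (- r) * (n.+2%:R / n.+1%:R) `^ r :> R.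
    rewrite powRM ?invr_ge0 ?(ltW n1) ?(ltW n2)// -powR_inv1 ?(ltW n1)// -powRrM mulN1r.
    rewrite mulrA -powRD; last by rewrite (gt_eqF n2) implybT.
    by rewrite addNr powRr0 mul1r.
  have -> : n.+2%:R `^ (- (1 + r)) = n.+2%:R `^ (- r) / n.+2%:R :> R.
    rewrite -[X in _ / X]powRr1 ?(ltW n2)// -powRB; last by rewrite (gt_eqF n2) implybT.
    by congr (_ `^ _); ring.
  rewrite -[X in _ - X]mulr1 -mulrBr mulrCA; apply: ler_wpM2l; first exact: powR_ge0.
  rewrite lerBrDr addrC; apply: (@le_trans _ _ (expR (n.+2%:R^-1) `^ r)); last first.
    apply: ge0_ler_powR; rewrite ?nnegrE ?expR_ge0 ?divr_ge0 ?(ltW n1) ?(ltW n2) ?(ltW r0)//.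
    rewrite -[leLHS]invrK -expRN -[leRHS]invf_div lef_pV2 ?posrE ?expR_gt0 ?divr_gt0//.
    apply: le_trans (expR_ge1Dx _); rewrite le_eqVlt; apply/orP; left; apply/eqP.
    by rewrite [n.+2%:R]mulrS; field; rewrite -mulrS; apply: lt0r_neq0.
  rewrite -expRM; apply: le_trans (expR_ge1Dx _).
  by rewrite [r * _]mulrC.
case: N => [|N]; first by rewrite big_geq // addr_ge0 // invr_ge0 ltW.
rewrite big_nat_recl //= powR1 lerD2l.
suff : r * \sum_(0 <= i < N) i.+2%:R `^ (- (1 + r)) <= 1 - N.+1%:R `^ (- r).
  move=> le; rewrite -(ler_pM2l r0) divff ?gt_eqF//; apply: le_trans le _.
  by rewrite gerBl powR_ge0.
rewrite mulr_sumr; elim: N => [|N IH]; first by rewrite big_geq // powR1 subrr.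
rewrite big_nat_recr //=; apply: le_trans (lerD IH (H N)) _.
by rewrite addrA subrK.
Qed.

(** * Summability of the distance kernel over the lattice *)

Section lattice.
Context {R : realType} {d : nat}.
Local Notation Zd := 'rV[int]_d.

(** A point is determined by the signs and absolute values of its coordinate differences to [v]. The
    sum over all such data factorises into d equal sums, each counting every absolute value
    twice. *)
Lemma sum_prod_lattice_le (g : nat -> R) (Z : R) (v : Zd) (s : seq Zd) :
  (forall n, 0 <= g n) -> (forall N, \sum_(0 <= n < N) g n <= Z) -> uniq s ->
  \sum_(u <- s) \prod_(i < d) g (absz (u 0 i - v 0 i)%R) <= (2 * Z) ^+ d.
Proof.
move=> g0 gZ us.
pose N := \max_(u <- s) \max_(i < d) absz ((u : Zd) 0 i - v 0 i)%R.
pose enc (u : Zd) : {ffun 'I_d -> bool * 'I_N.+1} :=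
  [ffun i => (u 0 i < v 0 i, inord (absz (u 0 i - v 0 i)%R))].
have leN u i : u \in s -> (absz (u 0 i - v 0 i)%R < N.+1)%N.
  move=> su; rewrite ltnS; apply: (@leq_trans (\max_(i < d) absz (u 0 i - v 0 i)%R)).
    exact: (@leq_bigmax _ (fun i => absz (u 0 i - v 0 i)%R)).
  exact: (@leq_bigmax_seq _ _ xpredT (fun u : Zd => \max_(i < d) absz (u 0 i - v 0 i)%R)).
have enc_inj : {in s &, injective enc}.
  move=> u1 u2 s1 s2 /ffunP E; apply/rowP => i; have := E i; rewrite !ffunE => -[lt].
  move=> /(congr1 val) /=; rewrite !inordK ?leN // => ab.
  by move: lt ab; case: ltP; case: ltP; lia.
have -> : \sum_(u <- s) \prod_(i < d) g (absz (u 0 i - v 0 i)%R) =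
    \sum_(f <- map enc s) \prod_(i < d) g (f i).2.
  rewrite big_map big_seq [RHS]big_seq; apply: eq_bigr => u su.
  by apply: eq_bigr => i _; rewrite ffunE /= inordK // leN.
apply: (@le_trans _ _ (\sum_(f : {ffun 'I_d -> bool * 'I_N.+1}) \prod_(i < d) g (f i).2)).
  rewrite big_uniq ?map_inj_in_uniq//= big_mkcond /=; apply: ler_sum => f _.
  by case: ifP => // _; exact: prodr_ge0.
rewrite -(@bigA_distr_bigA _ _ _ _ _ _ _ (fun _ j => g (j : bool * 'I_N.+1).2)) /=.
rewrite prodr_const card_ord; apply: lerXn2r; rewrite ?nnegrE.
- exact: sumr_ge0.
- by rewrite mulr_ge0 //; have := gZ 0%N; rewrite big_geq.
rewrite -(pair_bigA _ (fun _ n => g (nat_of_ord n))) /= sumr_const card_bool.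
rewrite -[leLHS]mulr_natl; apply: ler_wpM2l => //.
by rewrite -(big_mkord xpredT).
Qed.

(** Each |u_i - v_i| + 1 is at most 2 dist(u, v). So dist^(-p) is at most 2^p times the product over
    i of (|u_i - v_i| + 1)^(-p/d), where p/d = 1 + r > 1. *)
Lemma kernel_sum_le (alpha theta : R) : (0 < d)%N -> d%:R < alpha * theta ->
  exists Z : R, forall (v : Zd) s, uniq s ->
    \sum_(u <- s) @kernel R d alpha theta u v <= Z.
Proof.
move=> d0 dat; set p := alpha * theta in dat *.
have dR : (0 : R) < d%:R by rewrite ltr0n.
have p0 : 0 < p by apply: lt_trans dat.
pose r := p / d%:R - 1.
have r0 : 0 < r by rewrite subr_gt0 ltr_pdivlMr // mul1r.
pose g n : R := n.+1%:R `^ (- (1 + r)).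
exists (2 `^ p * (2 * (1 + r^-1)) ^+ d) => v s us.
apply: (@le_trans _ _ (2 `^ p * \sum_(u <- s) \prod_(i < d) g (absz (u 0 i - v 0 i)%R))); last first.
  apply: ler_wpM2l; first exact: powR_ge0.
  apply: sum_prod_lattice_le => //; last by move=> N; exact: sum_powR_le.
  by move=> n; exact: powR_ge0.
rewrite mulr_sumr; apply: ler_sum => u _; rewrite /kernel -/p.
have prod0 : 0 <= \prod_(i < d) g (absz (u 0 i - v 0 i)%R).
  by apply: prodr_ge0 => i _; exact: powR_ge0.
move: prod0; have [-> prod0|uv prod0] := eqVneq u v.
  (* The diagonal term vanishes, as [powR] of 0 with a nonzero exponent is 0. *)
  rewrite euclidean_distxx.
  by rewrite powR0 ?oppr_eq0 ?gt_eqF//; apply: mulr_ge0; rewrite ?powR_ge0.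
have D1 := euclidean_dist_ge1 (R := R) uv.
set D := euclidean_dist u v in D1 *.
have D0 : 0 < D by apply: lt_le_trans D1.
have gE n : g n = (n.+1%:R `^ ((1 + r)))^-1 by rewrite /g powRN.
rewrite powRN -ler_pdivrMl ?powR_gt0// -invfM -powRM ?(ltW D0)//.
rewrite (eq_bigr _ (fun i _ => gE _)) prodfV lef_pV2 ?posrE ?powR_gt0 ?mulr_gt0//; last first.
  by apply: prodr_gt0 => i _; rewrite powR_gt0.
have -> : (2 * D) `^ p = \prod_(i < d) (2 * D) `^ (1 + r).
  rewrite prodr_const card_ord -powR_mulrn ?powR_ge0// -powRrM; congr (_ `^ _).
  by rewrite /r addrC subrK divfK ?gt_eqF.
apply: ler_prod => i _; rewrite powR_ge0 /=.
have r1 : 0 <= 1 + r by rewrite addr_ge0 // ltW.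
have D2 : 0 <= 2 * D by rewrite mulr_ge0 // ltW.
apply: ge0_ler_powR; rewrite ?nnegrE//.
have := euclidean_dist_coord (R := R) u v i; rewrite -/D.
rewrite -intr_norm -abszE -pmulrn. rewrite -natr1; lra.
Qed.

End lattice.

(** * Power bounds on the weight tail from slow variation *)

Section tail.
Context {R : realType} {dS : measure_display} {S : measurableType dS}.
Context {Q : probability S R} {W : {RV Q >-> R}}.
Variables (tau : R) (ell : R -> R).
Hypothesis ell_sv : slowly_varying ell.
Hypothesis tailE : forall t : R, 0 < t -> ccdf W t = (ell t / t `^ (tau - 1))%:E.

Local Notation h := (@level_tail R dS S Q W).
(** [tailE] concerns the strict tail P(W > e^j) while [level_tail] is P(W >= e^j), hence the
    sandwich a j <= h j <= a (j - 1) below. *)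
Let a (j : nat) : R := fine (ccdf W (expR j%:R)).

(** Slow variation is used at the single factor e: consecutive tails have a ratio tending to
    e^(-(tau - 1)), which yields power bounds with any slightly worse exponent. *)
Lemma ccdf_level_ratio (e : R) : 0 < e -> exists J, forall j, (J <= j)%N ->
  0 < a j /\ `|a j.+1 / a j * expR (tau - 1) - 1| < e.
Proof.
move=> e0; case: ell_sv => -[A0 A00 [_ ell_gt0]] /(_ (expR 1) (expR_gt0 _)) cv.
have /cvgrPdist_lt /(_ e e0) [A [Ar HA]] := cv.
exists (Num.bound (Num.max `|A| A0)) => j Jj.
have jM : Num.max `|A| A0 < expR j%:R.
  apply: (@lt_le_trans _ _ j%:R).
    apply: (@lt_le_trans _ _ (Num.bound (Num.max `|A| A0))%:R); last by rewrite ler_nat.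
    by apply: archi_boundP; rewrite le_max normr_ge0.
  by apply: le_trans (expR_ge1Dx _); rewrite lerDr.
have jA : A < expR j%:R.
  by apply: le_lt_trans jM; rewrite le_max ler_norm.
have jA0 : A0 < expR j%:R by apply: le_lt_trans jM; rewrite le_max lexx orbT.
have aE k : a k = ell (expR k%:R) / expR k%:R `^ (tau - 1).
  by rewrite /a tailE ?expR_gt0.
have l0 : 0 < ell (expR j%:R) by apply: ell_gt0; exact: ltW.
split; first by rewrite aE divr_gt0 // powR_gt0 ?expR_gt0.
have := HA _ jA; rewrite distrC; congr (`| _ - 1| < e).
rewrite !aE -!expRM mulrS mulrDl mul1r !expRD.
have := expR_gt0 (tau - 1); have := expR_gt0 (j%:R * (tau - 1)) => ? ?.
by field; rewrite !gt_eqF ?expR_gt0.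
Qed.

Lemma fine_preimage_le (B C : set R) : measurable B -> measurable C -> B `<=` C ->
  fine (Q (W @^-1` B)) <= fine (Q (W @^-1` C)).
Proof.
move=> mB mC BC; apply: fine_le.
- by apply: fin_num_measure; exact: measurable_RV_preimage.
- by apply: fin_num_measure; exact: measurable_RV_preimage.
apply: le_measure; rewrite ?inE.
- exact: measurable_RV_preimage.
- exact: measurable_RV_preimage.
- by move=> w; exact: BC.
Qed.

Lemma level_tailS_le j : h j.+1 <= a j.
Proof.
apply: fine_preimage_le => // t /=; rewrite !in_itv /= !andbT.
by apply: lt_le_trans; rewrite ltr_expR ltr_nat.
Qed.

Lemma le_level_tail j : a j <= h j.
Proof. by apply: fine_preimage_le => // t /=; rewrite !in_itv /= !andbT => /ltW. Qed.

Lemma level_tail_le1 j : h j <= 1.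
Proof.
rewrite -lee_fin fineK; last by apply: fin_num_measure; exact: measurable_RV_preimage.
by apply: probability_le1; exact: measurable_RV_preimage.
Qed.

(** The moment of order [s] is finite: with [s'] strictly between [s] and tau - 1, the tails
    eventually shrink by e^(-s') per level, and the first levels cost only the factor e^(s' (J +
    1)). *)
Lemma level_tail_upper s : 0 < s < tau - 1 ->
  exists M, forall n, \sum_(0 <= j < n) expR (s * j%:R) * h j <= M.
Proof.
move=> /andP[s0 st]; pose s' := (s + (tau - 1)) / 2.
have [ss' s't] : s < s' /\ s' < tau - 1 by rewrite /s'; split; lra.
have e0 : 0 < expR (tau - 1 - s') - 1 by rewrite subr_gt0 expR_gt1 subr_gt0.
have [J HJ] := ccdf_level_ratio e0.
have aS j : (J <= j)%N -> a j.+1 <= expR (- s') * a j.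
  move=> /HJ[a0]; rewrite ltr_norml => /andP[_].
  rewrite ltrBlDr subrK -ltr_pdivlMr ?expR_gt0// => /ltW.
  rewrite ler_pdivrMr // => /le_trans; apply; apply: ler_wpM2r; first exact: ltW.
  rewrite -expRN -expRD le_eqVlt; apply/orP; left; apply/eqP; congr expR; ring.
have aJ k : a (J + k)%N <= expR (- (s' * k%:R)).
  elim: k => [|k IH].
    rewrite addn0 mulr0 oppr0 expR0; exact: le_trans (le_level_tail _) (level_tail_le1 _).
  rewrite addnS; apply: le_trans (aS _ (leq_addr _ _)) _.
  rewrite mulrS mulrDr mulr1 opprD expRD; apply: ler_wpM2l => //; exact: expR_ge0.
have hle j : h j <= expR (s' * J.+1%:R) * expR (- (s' * j%:R)).
  have s'0 : 0 < s' by apply: lt_trans ss'.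
  rewrite -expRD -mulrBr; have [jJ|Jj] := leqP j J.+1.
    apply: le_trans (level_tail_le1 _) _; rewrite leNgt expR_lt1 -leNgt.
    by rewrite mulr_ge0 ?(ltW s'0)// subr_ge0 ler_nat.
  rewrite -(subnKC Jj) addSn addSnnS; apply: le_trans (level_tailS_le _) _.
  rewrite -addnS; apply: le_trans (aJ _) _; rewrite ler_expR.
  by rewrite -mulrN ler_wpM2l ?(ltW s'0)// natrD -addn1 !natrD; lra.
pose r := expR (s - s').
have r1 : r < 1 by rewrite expR_lt1 subr_lt0.
exists (expR (s' * J.+1%:R) / (1 - r)) => n.
apply: (@le_trans _ _ (\sum_(0 <= j < n) expR (s' * J.+1%:R) * r ^+ j)).
  apply: ler_sum => j _; rewrite mulrC; apply: le_trans (ler_wpM2r (expR_ge0 _) (hle j)) _.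
  rewrite -mulrA -expRD ler_wpM2l ?expR_ge0// /r -expRM_natl ler_expR; lra.
rewrite -mulr_sumr ler_wpM2l ?expR_ge0// -[leRHS]mul1r ler_pdivlMr ?subr_gt0//.
have := subrX1 r n; rewrite -(big_mkord xpredT (fun j => r ^+ j)) => H.
by have := exprn_ge0 n (expR_ge0 (s - s')); rewrite -/r; lra.
Qed.

(** From [J] on, each tail is at least e^(-s) times the previous one. Rounding [y] up to an integer
    costs one more factor e^(-s), whence the constant a J e^(-s). *)
Lemma level_tail_lower s : 1 < tau -> tau - 1 < s -> exists2 c, 0 < c &
  forall y, 0 <= y -> c * expR (- (s * y)) <= fine (Q (W @^-1` `[expR y, +oo[)).
Proof.
move=> tau1 st; have e0 : 0 < 1 - expR (tau - 1 - s).
  by rewrite subr_gt0 expR_lt1 subr_lt0.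
have [J HJ] := ccdf_level_ratio e0.
have aS j : (J <= j)%N -> expR (- s) * a j <= a j.+1.
  move=> /HJ[a0]; rewrite ltr_norml => /andP[+ _].
  rewrite opprB ltrBlDr addrC addrNK -ltr_pdivrMr ?expR_gt0// => /ltW.
  rewrite -expRN -expRD ler_pdivlMr // => le; apply: le_trans le.
  apply: ler_wpM2r; first exact: ltW.
  rewrite le_eqVlt; apply/orP; left; apply/eqP; congr expR; ring.
have aJ k : a J * expR (- (s * k%:R)) <= a (J + k)%N.
  elim: k => [|k IH]; first by rewrite addn0 mulr0 oppr0 expR0 mulr1.
  rewrite addnS; apply: le_trans (aS _ (leq_addr _ _)).
  by rewrite mulrS mulrDr mulr1 opprD expRD mulrCA ler_wpM2l ?expR_ge0.
have [aJ0 _] := HJ _ (leqnn J).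
have s0 : 0 < s by apply: lt_trans st; rewrite subr_gt0.
exists (a J * expR (- s)); first by rewrite mulr_gt0 ?expR_gt0.
move=> y y0; have := truncn_itv y0; set k := Num.truncn y => /andP[ky yk].
apply: (@le_trans _ _ (a (J + k.+1)%N)).
  apply: le_trans (aJ _); rewrite -mulrA -expRD ler_wpM2l ?(ltW aJ0)// ler_expR.
  by have := ler_wpM2l (ltW s0) ky; rewrite -natr1; lra.
apply: fine_preimage_le => // t /=; rewrite !in_itv /= !andbT => /ltW.
apply: le_trans; rewrite ler_expR; apply: le_trans (ltW yk) _.
by rewrite ler_nat leq_addl.
Qed.


End tail.

(** * Quantiles of the edge-weight law *)

Section quantile.
Context {R : realType} {dS : measure_display} {S : measurableType dS}.
Context {Q : probability S R} {L : {RV Q >-> R}}.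
Hypothesis L_ge0 : Q [set s | 0 <= L s] = 1%E.
Implicit Types y : R.

Lemma prob_L_lt0 : Q (L @^-1` `]-oo, 0%R[) = 0%E.
Proof.
rewrite (_ : L @^-1` `]-oo, 0%R[ = ~` (L @^-1` `[0%R, +oo[)); last first.
  by apply/seteqP; split => s /=; rewrite !in_itv /= andbT ltNge => /negP.
rewrite probability_setC; last exact: measurable_RV_preimage.
rewrite (_ : L @^-1` `[0%R, +oo[ = [set s | 0 <= L s]) ?L_ge0 ?subee//.
by apply/seteqP; split => s /=; rewrite in_itv /= andbT.
Qed.

Lemma quantile_lbound y : 0 < y -> lbound [set t : R | (y%:E <= cdf L t)%E] 0.
Proof.
move=> y0 t /= yt; rewrite leNgt; apply/negP => t0.
have : (cdf L t <= 0)%E.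
  have -> : cdf L t = Q (L @^-1` `]-oo, t]) by [].
  rewrite -prob_L_lt0; apply: le_measure; rewrite ?inE.
  - exact: measurable_RV_preimage.
  - exact: measurable_RV_preimage.
  - by move=> s /=; rewrite !in_itv /= => /le_lt_trans; apply.
by move=> /(le_trans yt); rewrite lee_fin leNgt y0.
Qed.

Lemma quantile_has_inf y : 0 < y < 1 -> has_inf [set t : R | (y%:E <= cdf L t)%E].
Proof.
move=> /andP[y0 y1]; split; last by exists 0; exact: quantile_lbound.
apply: contrapT => nex; have H := cvg_cdfy1 L.
have : (lim (cdf L t @[t --> (+oo)%R]) <= y%:E)%E.
  apply: lime_le; first by apply/cvg_ex; exists 1%E.
  by apply: nearW => t; apply: contrapT => /negP; rewrite -ltNge => /ltW yt; apply: nex; exists t.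
by rewrite (cvg_lim _ H) // lee_fin leNgt y1.
Qed.

Lemma quantile_ge0 y : 0 < y < 1 -> 0 <= quantile L y.
Proof.
move=> y01; have [ne _] := quantile_has_inf y01.
by apply: lb_le_inf => //; apply: quantile_lbound; case/andP: y01.
Qed.

Lemma quantile_le y1 y2 : 0 < y1 -> y1 <= y2 -> y2 < 1 -> quantile L y1 <= quantile L y2.
Proof.
move=> y10 y12 y21; have [y20 y11] : 0 < y2 /\ y1 < 1.
  by split; [exact: lt_le_trans y12|exact: le_lt_trans y21].
apply: lb_le_inf.
  by have [] := @quantile_has_inf y2 ltac:(by rewrite y20).
move=> t /= yt; apply: ge_inf; first by exists 0; exact: quantile_lbound.
by apply: le_trans yt; rewrite lee_fin.
Qed.

(** Right-continuity of the distribution function puts the infimum into the set. *)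
Lemma cdf_quantile y : 0 < y < 1 -> (y%:E <= cdf L (quantile L y))%E.
Proof.
move=> y01; have [ne lb] := quantile_has_inf y01.
have H := @cdf_right_continuous _ _ _ _ L (quantile L y).
rewrite -(cvg_lim _ H) //; apply: lime_ge; first by apply/cvg_ex; eexists; exact: H.
near=> t.
have /(inf_lt ne)[u /= yu ut] : quantile L y < t by near: t; exact: nbhs_right_gt.
by apply: le_trans yu _; apply: cdf_nondecreasing; exact: ltW.
Unshelve. all: end_near. Qed.

(** Left of the quantile the distribution function is below [y], and continuity from below carries
    this over to the open half-line. *)
Lemma prob_lt_quantile y : 0 < y < 1 -> (Q (L @^-1` `]-oo, quantile L y[) <= y%:E)%E.
Proof.
move=> y01; have [ne lb] := quantile_has_inf y01.
pose F n := L @^-1` `]-oo, quantile L y - n.+1%:R^-1].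
have FE : L @^-1` `]-oo, quantile L y[ = \bigcup_n F n.
  apply/seteqP; split => [s /=|s [n _]]; rewrite /F /= !in_itv /= => H; last first.
    by apply: le_lt_trans H _; rewrite ltrBlDr ltrDl invr_gt0.
  have e0 : 0 < quantile L y - L s by rewrite subr_gt0.
  have /filter_ex[n] := near_infty_natSinv_lt (PosNum e0); rewrite /= => ne'.
  by exists n => //=; rewrite in_itv /= lerBrDr addrC -lerBrDr ltW.
have mF n : measurable (F n) by exact: measurable_RV_preimage.
have H : (Q \o F) x @[x --> \oo] --> Q (\bigcup_n F n).
  apply: nondecreasing_cvg_mu => //; first exact: bigcupT_measurable.
  move=> n m nm; apply/subsetPset => s /=; rewrite /F /= !in_itv /= => /le_trans; apply.
  by rewrite lerD2l lerN2 lef_pV2 ?posrE ?ltr0n// ler_nat.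
rewrite FE -(cvg_lim _ H) //; apply: lime_le; first by apply/cvg_ex; eexists; exact: H.
apply: nearW => n; apply: contrapT => /negP; rewrite -ltNge => /ltW yt.
have : quantile L y <= quantile L y - n.+1%:R^-1 by apply: ge_inf.
by rewrite lerBrDr gerDl leNgt invr_gt0 ltr0n.
Qed.

End quantile.

(** * Upper bound on the growth *)

Section real_lemmas.
Context {R : realType}.

Lemma expR_archi (c e : R) : 0 < c -> 0 < e ->
  exists A0 : nat, forall A : nat, (A0 <= A)%N -> expR (- (c * A%:R)) <= e.
Proof.
move=> c0 e0; exists (Num.bound (e^-1 / c)) => A AA.
have H : e^-1 / c < A%:R.
  apply: (@lt_le_trans _ _ (Num.bound (e^-1 / c))%:R); last by rewrite ler_nat.
  by apply: archi_boundP; rewrite divr_ge0 ?invr_ge0 ?ltW.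
rewrite expRN -[leRHS]invrK lef_pV2 ?posrE ?expR_gt0 ?invr_gt0//.
apply: le_trans (expR_ge1Dx _); move: H; rewrite ltr_pdivrMr // mulrC => /ltW.
by move=> /le_trans; apply; rewrite lerDr.
Qed.

Lemma exprn_ge_affine (b : R) k : 1 <= b -> 1 + k%:R * (b - 1) <= b ^+ k.
Proof.
move=> b1; elim: k => [|k IH]; first by rewrite mul0r addr0 expr0.
rewrite exprS -natr1; apply: (@le_trans _ _ (b * (1 + k%:R * (b - 1)))).
  have : 0 <= k%:R * (b - 1) * (b - 1) by rewrite !mulr_ge0 ?subr_ge0.
  lra.
by apply: ler_wpM2l => //; apply: le_trans b1.
Qed.

Lemma sum_exprn_le (b : R) k : 1 < b ->
  \sum_(1 <= m < k) b ^+ m <= b ^+ k / (b - 1).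
Proof.
move=> b1; rewrite ler_pdivlMr ?subr_gt0//; case: k => [|k].
  by rewrite big_geq // mul0r expr0 ler01.
elim: k => [|k IH]; first by rewrite big_geq // mul0r exprn_ge0 // ltW // (lt_trans ltr01).
by rewrite big_nat_recr //= mulrDl [b ^+ k.+2]exprS; lra.
Qed.

(* AM-GM: (k ln b)^2 / 2 >= E k - E^2 / (2 (ln b)^2), hence b^k dominates any
   linear function of k. *)
Lemma exprn_ge_linear (b E : R) : 1 < b -> exists C, forall k, E * k%:R <= b ^+ k + C.
Proof.
move=> b1; have l0 : 0 < ln b by rewrite ln_gt0.
exists ((E / ln b) ^+ 2 / 2) => k.
have -> : b ^+ k = expR (k%:R * ln b).
  by rewrite expRM_natl lnK // posrE (lt_trans ltr01).
have kl : 0 <= k%:R * ln b by rewrite mulr_ge0 // ltW.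
have := expR_ge1Dxn 1 kl; set u := k%:R * ln b => H.
have -> : E * k%:R = (E / ln b) * u by rewrite /u mulrCA divfK ?gt_eqF// mulrC.
set t := E / ln b.
have := sqr_ge0 (u - t); rewrite sqrrB; move: H; rewrite (_ : 2`!%:R = 2) // => H1 H2.
by lra.
Qed.

(** Since 2 D <= e^(2 D), a linear function of k with slope 2 D absorbs D^k and 2^k together. *)
Lemma geometric_expR_bound (D b : R) : 0 <= D -> 1 < b ->
  exists2 C, 0 <= C & forall k, D ^+ k * expR (- b ^+ k) <= C / 2 ^+ k.
Proof.
move=> D0 b1; have [C HC] := exprn_ge_linear (2 * D) b1.
exists (expR C); first exact: expR_ge0.
move=> k; rewrite ler_pdivlMr ?exprn_gt0// mulrAC -exprMn mulrC.
apply: (@le_trans _ _ (expR (- b ^+ k) * expR (2 * D * k%:R))).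
  apply: ler_wpM2l; first exact: expR_ge0.
  rewrite expRM_natr lerXn2r ?nnegrE ?expR_ge0 ?mulr_ge0//.
  rewrite mulrC; apply: le_trans (expR_ge1Dx _); lra.
by rewrite -expRD ler_expR; have := HC k; lra.
Qed.

End real_lemmas.

(** * Truncated paths: levels and edge weights along self-avoiding paths *)

Section growth.
Context {R : realType} {d : nat} {lambda alpha : R}.
Context {dS : measure_display} {S : measurableType dS} {Q : probability S R}.
Context {W L : {RV Q >-> R}}.
Context {dT : measure_display} {T : measurableType dT} {P : probability T R}.
Variable G : @weighted_sfp R d lambda alpha dS S Q W L dT T P.
Variables (theta s Z M b : R) (x : 'rV[int]_d).
Hypothesis lambda_gt0 : 0 < lambda.
Hypothesis theta01 : 0 < theta <= 1.
Hypothesis theta_s : theta < s <= 2 * theta.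
Hypothesis b_gt1 : 1 < b.
Hypothesis b_theta : theta < b * (s - theta).

Local Notation Zd := 'rV[int]_d.
Local Notation ww := (vertex_weight G).
Local Notation h := (@level_tail R dS S Q W).
Local Notation kernel := (@kernel R d alpha theta).
Local Notation kernel_const := (@kernel_const R lambda theta).
Local Notation extends := (@extends R d lambda alpha dS S Q W L dT T P G).
Local Notation at_level := (@at_level R d lambda alpha dS S Q W L dT T P G).
Local Notation adj := (sfp_adj G).

Hypothesis Z_bound : forall (v : Zd) us, uniq us -> \sum_(u <- us) kernel u v <= Z.
Hypothesis M_bound : forall n, \sum_(0 <= j < n) expR (s * j%:R) * h j <= M.
Hypothesis W_ge1 : Q [set t | 1 <= W t] = 1%E.
Hypothesis L_ge0 : Q [set t | 0 <= L t] = 1%E.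

Let M_ge0 : 0 <= M.
Proof. by have := M_bound 0; rewrite big_geq. Qed.

Let Z_ge0 : 0 <= Z.
Proof. by have := Z_bound 0 (us := [::]) isT; rewrite big_nil. Qed.

Let kc_ge0 : 0 <= kernel_const.
Proof. exact: powR_ge0. Qed.

Definition level (w : T) (v : Zd) : nat := Num.truncn (ln (ww v w)).

Lemma ae_weight_ge1 : {ae P, forall w, forall v : Zd, 1 <= ww v w}.
Proof.
apply: ae_forall_countable => v.
apply: (@negligibleS _ _ _ _ (~` (ww v @^-1` `[1, +oo[))).
  by move=> w /= n1; rewrite in_itv /= andbT.
have mA : measurable (ww v @^-1` `[1, +oo[) by exact: measurable_RV_preimage.
have PA : P (~` (ww v @^-1` `[1, +oo[)) = 0%E.
  rewrite probability_setC // vertex_weight_law //.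
  rewrite (_ : W @^-1` `[1, +oo[ = [set t | 1 <= W t]) ?W_ge1 ?subee//.
  by apply/funext => w; rewrite /preimage /= in_itv /= andbT.
by apply/negligibleP => //; exact: measurableC.
Qed.

Lemma at_level_level w v : 1 <= ww v w -> at_level v (level w v) w.
Proof.
move=> w1; have w0 : 0 < ww v w by apply: lt_le_trans w1.
rewrite /at_level /level_itv /= in_itv /=.
have /andP[l u] := truncn_itv (ln_ge0 w1).
rewrite -[X in _ <= X < _]lnK ?posrE// ler_expR ltr_expR.
by rewrite l u.
Qed.

(** Reduces every truncated moment in the path count to the moment of order [s]. *)
Lemma sum_level_tail_le (f : nat -> R) (p : nat -> bool) C n :
  0 <= C -> (forall j, 0 <= f j) -> (forall j, p j -> f j <= C * expR (s * j%:R)) ->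
  \sum_(0 <= j < n) f j * h j * (p j)%:R <= C * M.
Proof.
move=> C0 f0 fC.
apply: (@le_trans _ _ (C * \sum_(0 <= j < n) expR (s * j%:R) * h j)); last first.
  by apply: ler_wpM2l.
rewrite mulr_sumr; apply: ler_sum => j _; rewrite mulrA.
case: (boolP (p j)) => [/fC le|_]; last by rewrite mulr0 !mulr_ge0 ?expR_ge0 ?level_tail_ge0.
by rewrite mulr1; apply: ler_wpM2r => //; exact: level_tail_ge0.
Qed.

Lemma sum_level_tail_theta n : \sum_(0 <= j < n) expR (theta * j%:R) * h j <= M.
Proof.
have := @sum_level_tail_le (fun j => expR (theta * j%:R)) xpredT 1 n ler01.
rewrite mul1r => H; apply: le_trans (H _ _) => [|j|j _].
- by apply: ler_sum => j _; rewrite mulr1.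
- exact: expR_ge0.
- by rewrite mul1r ler_expR ler_wpM2r //; case/andP: theta_s => /ltW.
Qed.

(** The start vertex lies on one edge and costs [M]. Vertex m, for 0 < m < k, costs M e^((2 theta -
    s) A b^m), and these exponents add up to at most (2 theta - s) A b^k / (b - 1). The factors [z]
    and [y] stand for the last vertex and the last edge. *)
Lemma first_moment_covered (cst : nat -> nat -> bool) (B : set R) (A y z : R) k :
  (0 < k)%N -> 0 <= A -> measurable B -> (Q (L @^-1` B) <= y%:E)%E ->
  (forall m j, (m < k)%N -> cst m j -> j%:R <= A * b ^+ m) ->
  (forall n, \sum_(0 <= j < n) expR (theta * j%:R) * h j * (cst k j)%:R <= z) ->
  covered P (\bigcup_j extends cst B k.-1 [:: (x, j)])
    ((kernel_const * Z * M) ^+ k * expR ((2 * theta - s) * A * (b ^+ k / (b - 1)))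
      * (z * y)).
Proof.
move=> k0 A0 mB Qy hc hz.
have y0 : 0 <= y by rewrite -lee_fin; apply: le_trans Qy.
have z0 : 0 <= z by have := hz 0%N; rewrite big_geq.
have [ths s2] := andP theta_s.
pose X m := A * b ^+ m.
have X0 m : 0 <= X m by rewrite mulr_ge0 // exprn_ge0 // ltW // (lt_trans ltr01).
pose a m := expR ((2 * theta - s) * X m) * M.
have ha m n : (m < k)%N ->
    \sum_(0 <= j < n) expR (2 * theta * j%:R) * h j * (cst m j)%:R <= a m.
  move=> mk; apply: sum_level_tail_le => [|j|j /(hc _ _ mk) jX]; rewrite ?expR_ge0//.
  rewrite -expRD ler_expR; have : (2 * theta - s) * j%:R <= (2 * theta - s) * X m.
    by apply: ler_wpM2l => //; rewrite subr_ge0.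
  lra.
have prod_le : \prod_(1 <= m < k) a m <=
    M ^+ k.-1 * expR ((2 * theta - s) * A * (b ^+ k / (b - 1))).
  rewrite /a big_split /= prodr_const_nat subn1 mulrC.
  apply: ler_wpM2l; first exact: exprn_ge0.
  rewrite -expR_sum ler_expR /X -mulr_sumr -mulr_sumr -mulrA.
  by do 2 (apply: ler_wpM2l => //; rewrite ?subr_ge0 //); exact: sum_exprn_le.
pose D := (kernel_const * Z) ^+ k * (M ^+ k.-1 *
  expR ((2 * theta - s) * A * (b ^+ k / (b - 1)))) * (z * y).
have D0 : 0 <= D by rewrite !mulr_ge0 ?exprn_ge0 ?expR_ge0 ?mulr_ge0.
have -> : (kernel_const * Z * M) ^+ k * expR ((2 * theta - s) * A * (b ^+ k / (b - 1)))
   * (z * y) = D * M.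
  by rewrite /D exprMn -[in M ^+ k](prednK k0) exprS; ring.
apply: (@covered_bigcup _ _ _ _ nat _ (fun j => expR (theta * j%:R) * h j * D)) => [j|js ujs].
  have := @extends_covered _ _ _ _ _ _ _ _ _ _ _ _ G theta lambda_gt0 theta01 cst B y Z z a k
    mB Qy Z_bound hz _ ha k.-1 (x, j) [::].
  rewrite /= add1n prednK // => /(_ _ erefl) H.
  apply: (covered_le _ (H _)); last by move=> m; rewrite /a mulr_ge0 ?expR_ge0.
  have E (h1 e1 k1 p1 q1 : R) : h1 * 1 * 1 * e1 * k1 * p1 * q1 = e1 * h1 * (k1 * p1 * q1).
    by ring.
  rewrite E /D.
  apply: ler_wpM2l; first by rewrite mulr_ge0 ?expR_ge0 ?level_tail_ge0.
  apply: ler_wpM2r; first by rewrite mulr_ge0.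
  by apply: ler_wpM2l => //; rewrite exprn_ge0 // mulr_ge0.
rewrite -mulr_suml mulrC; apply: ler_wpM2l => //.
apply: ler_sum_uniq_nat => // [j|n]; last exact: sum_level_tail_theta.
by rewrite mulr_ge0 ?expR_ge0 ?level_tail_ge0.
Qed.

Local Notation typed w := (fun v : Zd => (v, level w v)).

Lemma rev_cons_last (V : Type) (u : V) us : rev (u :: us) = last u us :: rev (belast u us).
Proof. by rewrite lastI rev_rcons. Qed.

Lemma path_event_typed w vs : (forall v, 1 <= ww v w) -> path (adj w) x vs ->
  path_event G (map (typed w) (rev (x :: vs))) w.
Proof.
move=> w1 xvs; split.
  by move=> t /= /mapP[v _ ->]; exact: at_level_level.
rewrite -map_comp map_id => e /=; elim/last_ind: vs xvs => [//|vs z IH].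
rewrite rcons_path -rcons_cons rev_rcons => /andP[xvs lz].
rewrite rev_cons_last consecutive_cons2 in_cons => /orP[/eqP->/=|].
  by rewrite edge_sym; exact/asboolP.
by rewrite -rev_cons_last; exact: IH.
Qed.

Lemma level_constraint_typed w vs (cst : nat -> nat -> bool) :
  (forall i, (i <= size vs)%N -> cst i (level w (nth x (x :: vs) i))) ->
  level_constraint cst (map (typed w) (rev (x :: vs))).
Proof.
elim/last_ind: vs => [|vs z IH] H; first by rewrite /= andbT; exact: (H 0%N).
rewrite -rcons_cons rev_rcons /= size_map size_rev; apply/andP; split.
  have := H (size vs).+1; rewrite size_rcons ltnS leqnn => /(_ isT).
  by rewrite /= nth_rcons ltnn eqxx.
apply: IH => i ivs; have := H i; rewrite size_rcons => /(_ (leqW ivs)).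
by rewrite -rcons_cons nth_rcons /= ltnS ivs.
Qed.

Lemma extends_path w vs z (cst : nat -> nat -> bool) (B : set R) : (forall v, 1 <= ww v w) ->
  path (adj w) x (rcons vs z) -> uniq (x :: rcons vs z) ->
  (forall i, (i <= (size vs).+1)%N -> cst i (level w (nth x (x :: rcons vs z) i))) ->
  B (edge_weight G (last x vs) z w) ->
  (\bigcup_j extends cst B (size vs) [:: (x, j)]) w.
Proof.
move=> w1 xvs uvs cvs Bw; exists (level w x) => //.
exists (map (typed w) (rev (rcons vs z))).
have -> : map (typed w) (rev (rcons vs z)) ++ [:: (x, level w x)] =
    map (typed w) (rev (x :: rcons vs z)).
  by rewrite rev_cons map_rcons cats1.
split.
- by rewrite size_map size_rev size_rcons.
- by rewrite -map_comp map_id rev_uniq.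
- by apply: level_constraint_typed => i; rewrite size_rcons; exact: cvs.
- exact: path_event_typed.
- by rewrite -rcons_cons rev_rcons rev_cons_last.
Qed.

Let D := kernel_const * Z * M.
(** Net rate of decay: the gain s - theta of a last vertex above the truncation minus the cost (2
    theta - s) / (b - 1) of the vertices before it. *)
Let c := ((s - theta) * b - theta) / (b - 1).

Let c_gt0 : 0 < c.
Proof. by rewrite /c divr_gt0 ?subr_gt0// mulrC. Qed.

Let D_ge0 : 0 <= D.
Proof. by rewrite !mulr_ge0. Qed.

(** Vertex k is the first one above the truncation: requiring the earlier levels to be truncated is
    what keeps the first moment under control. *)
Definition escape (A k : nat) : set T :=
  \bigcup_j extends (fun m j => if (m < k)%N then j%:R <= A%:R * b ^+ m
    else A%:R * b ^+ k < j%:R) setT k.-1 [:: (x, j)].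

Lemma escape_covered (A k : nat) : (0 < k)%N ->
  covered P (escape A k) (D ^+ k * M * expR (- (c * A%:R * b ^+ k))).
Proof.
move=> k0; have [ths s2] := andP theta_s.
have QT : (Q (L @^-1` setT) <= 1%:E)%E.
  by apply: probability_le1; exact: measurable_RV_preimage.
apply: (covered_le _ (@first_moment_covered _ setT A%:R 1
  (expR (- ((s - theta) * (A%:R * b ^+ k))) * M) k k0 _ _ QT _ _)) => //.
- have -> : expR (- (c * A%:R * b ^+ k)) =
      expR ((2 * theta - s) * A%:R * (b ^+ k / (b - 1))) *
      expR (- ((s - theta) * (A%:R * b ^+ k))).
    rewrite -expRD; congr expR; rewrite /c; field.
    by rewrite subr_eq0 gt_eqF.
  have E (a1 a2 a3 a4 : R) : a1 * a2 * (a3 * a4 * 1) = a1 * a4 * (a2 * a3) by ring.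
  by rewrite E.
- by move=> m j mk; rewrite mk.
- move=> n; rewrite ltnn; apply: sum_level_tail_le => [|j|j jA]; rewrite ?expR_ge0//.
  rewrite -expRD ler_expR.
  have : (s - theta) * (A%:R * b ^+ k) <= (s - theta) * j%:R.
    by apply: ler_wpM2l; rewrite ?subr_ge0 ltW.
  lra.
Qed.

Lemma prob_at_level_gt (A : nat) :
  covered P (\bigcup_j (if (A < j)%N then at_level x j else set0)) (expR (- (s * A%:R)) * M).
Proof.
have [t0 _] := andP theta01; have [ths _] := andP theta_s.
apply: (@covered_bigcup _ _ _ _ nat _ (fun j => 1 * h j * (A < j)%N%:R)) => [j|js ujs].
  case: ifP => _; last by apply: covered_set0; rewrite mulr0.
  rewrite mul1r mulr1; apply: covered_measurable; last exact: prob_at_level_le.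
  by apply: measurable_RV_preimage; exact: measurable_level_itv.
apply: ler_sum_uniq_nat => // [j|n]; first by rewrite mul1r mulr_ge0 ?level_tail_ge0.
apply: sum_level_tail_le => [|//|j Aj]; first exact: expR_ge0.
rewrite -expRD leNgt expR_lt1 -leNgt addrC -mulrBr mulr_ge0 ?subr_ge0 ?ler_nat 1?ltnW//.
by apply: ltW; apply: lt_trans ths.
Qed.

Lemma escape_or_high_covered (e : R) : 0 < e -> exists A : nat,
  covered P ((\bigcup_j (if (A < j)%N then at_level x j else set0)) `|`
    \bigcup_k escape A k.+1) e.
Proof.
move=> e0; have [t0 _] := andP theta01; have [ths _] := andP theta_s.
have s0 : 0 < s by apply: lt_trans ths.
have b10 : 0 < b - 1 by rewrite subr_gt0.
have M1 : 0 < M + 1 by apply: ltr_wpDl.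
have e'0 : 0 < e / (4 * (M + 1)) by rewrite divr_gt0 // mulr_gt0.
(* [A1] handles the level of [x] and [A2] makes the sum over k small. [A3] makes it geometric: by
   Bernoulli b^k >= 1 + k (b - 1), so each further vertex costs D e^(-c (b - 1) A) <= 1/2. *)
have [A1 HA1] := expR_archi s0 e'0.
have [A2 HA2] := expR_archi c_gt0 e'0.
have D1 : 0 < (2 * (D + 1))^-1 by rewrite invr_gt0 mulr_gt0 // ltr_wpDl.
have [A3 HA3] := expR_archi (mulr_gt0 c_gt0 b10) D1.
pose A := maxn A1 (maxn A2 A3); exists A.
have {}HA1 := HA1 A (leq_maxl _ _).
have {}HA2 : expR (- (c * A%:R)) <= e / (4 * (M + 1)).
  by apply: HA2; rewrite /A (leq_trans (leq_maxl A2 A3)) ?leq_maxr.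
have {}HA3 : expR (- (c * (b - 1) * A%:R)) <= (2 * (D + 1))^-1.
  by apply: HA3; rewrite /A (leq_trans (leq_maxr A2 A3)) ?leq_maxr.
have HM a : 0 <= a -> a <= e / (4 * (M + 1)) -> a * M <= e / 4.
  move=> a0 ae; apply: (@le_trans _ _ (a * (M + 1))).
    by apply: ler_wpM2l => //; rewrite lerDl.
  by apply: le_trans (ler_wpM2r (ltW M1) ae) _; rewrite invfM mulrA divfK ?gt_eqF.
apply: (@covered_le _ _ _ _ _ (e / 4 + 2 * (expR (- (c * A%:R)) * M))).
  by have := HM _ (expR_ge0 _) HA2; lra.
apply: coveredU.
  by apply: (covered_le _ (prob_at_level_gt A)); apply: HM => //; exact: expR_ge0.
apply: (@covered_bigcup _ _ _ _ nat _ (fun k => expR (- (c * A%:R)) * M / 2 ^+ k)) => [k|ks uks].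
  apply: (covered_le _ (escape_covered A (ltn0Sn k))).
  have -> : D ^+ k.+1 * M * expR (- (c * A%:R * b ^+ k.+1)) =
      D ^+ k.+1 * expR (- (c * A%:R * b ^+ k.+1)) * M by rewrite mulrAC.
  rewrite [leRHS]mulrAC; apply: ler_wpM2r => //.
  apply: (@le_trans _ _ (D ^+ k.+1 *
      (expR (- (c * A%:R)) * expR (- (c * (b - 1) * A%:R)) ^+ k.+1))).
    apply: ler_wpM2l; first exact: exprn_ge0.
    rewrite -expRM_natl -expRD ler_expR.
    have cA0 : 0 <= c * A%:R by rewrite mulr_ge0 // ltW.
    have := ler_wpM2l cA0 (exprn_ge_affine k.+1 (ltW b_gt1)); lra.
  rewrite mulrCA; apply: ler_wpM2l; first exact: expR_ge0.
  rewrite -exprMn; apply: (@le_trans _ _ ((2^-1 : R) ^+ k.+1)).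
    apply: lerXn2r; rewrite ?nnegrE ?mulr_ge0 ?expR_ge0//.
    apply: le_trans (ler_wpM2l D_ge0 HA3) _.
    by rewrite invfM mulrCA ler_piMr // ler_pdivrMr ?mul1r ?lerDl // ltr_wpDl.
  by rewrite exprVn lef_pV2 ?posrE ?exprn_gt0// ler_eXn2l // ltr1n.
apply: ler_sum_uniq_nat => // [k|N].
  by rewrite divr_ge0 ?exprn_ge0 // mulr_ge0 ?expR_ge0.
by apply: sum_geometric_half; rewrite mulr_ge0 ?expR_ge0.
Qed.

(** If no [A] worked, all the events of [escape_or_high_covered] would occur together, which has
    probability 0. For a good [A], the first vertex violating the bound would realise [escape], so
    the bound follows by induction on the path. *)
Lemma ae_level_le : {ae P, forall w, exists A : nat, forall vs,
  path (adj w) x vs -> uniq (x :: vs) ->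
  (level w (last x vs))%:R <= A%:R * b ^+ size vs}.
Proof.
pose N := \bigcap_A ((\bigcup_j (if (A < j)%N then at_level x j else set0)) `|`
    \bigcup_k escape A k.+1).
have N0 : P.-negligible N.
  apply: covered_negligible => e /escape_or_high_covered[A cA].
  by apply: coveredS cA => w; apply.
have nN : {ae P, forall w, ~ N w} by apply: negligibleS N0 => w /= /contrapT.
apply: filterS2 nN ae_weight_ge1 => w nNw w1.
have [A nA] : exists A, ~ ((\bigcup_j (if (A < j)%N then at_level x j else set0)) `|`
    \bigcup_k escape A k.+1) w.
  by apply: contrapT => nex; apply: nNw => A _; apply: contrapT => nA; apply: nex; exists A.
exists A; suff H n vs : (size vs <= n)%N -> path (adj w) x vs -> uniq (x :: vs) ->
  (level w (last x vs))%:R <= A%:R * b ^+ size vs by move=> vs; exact: (H (size vs)).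
elim: n vs => [|n IH] vs.
  rewrite leqn0 size_eq0 => /eqP -> _ _ /=; rewrite expr0 mulr1 ler_nat leqNgt.
  apply/negP => Al; apply: nA; left; exists (level w x) => //.
  by rewrite Al; exact: at_level_level.
case/lastP: vs => [|vs z] sz xvs uvs; first exact: (IH [::]).
rewrite leNgt; apply/negP => lt; apply: nA; right; exists (size vs) => //.
rewrite /escape /=; apply: (extends_path w1 xvs uvs) => // i; rewrite leq_eqVlt => /orP[/eqP->|].
  by rewrite ltnn /= nth_rcons ltnn eqxx; move: lt; rewrite last_rcons size_rcons.
rewrite ltnS => ivs; rewrite ?ltnS ivs -rcons_cons nth_rcons /= ltnS ivs.
(* Vertex i is the end of the prefix of length i, to which the induction hypothesis applies. *)
have sti : size (take i vs) = i by rewrite size_takel.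
have -> : nth x (x :: vs) i = last x (take i vs).
  by rewrite (last_nth x) sti -[in LHS](cat_take_drop i vs) -cat_cons nth_cat /= sti ltnS leqnn.
rewrite -[in X in _ <= X]sti; apply: IH.
- by rewrite sti; apply: leq_trans ivs _; move: sz; rewrite size_rcons ltnS.
- move: xvs; rewrite rcons_path => /andP[+ _].
  by rewrite -{1}(cat_take_drop i vs) cat_path => /andP[].
- move: uvs; rewrite -rcons_cons rcons_uniq => /andP[_].
  by rewrite -{1}(cat_take_drop i vs) -cat_cons cat_uniq => /andP[].
Qed.

(** The first term compensates the growth of the number of truncated paths; the added 1 leaves the
    summable factor e^(- b^k). *)
Let rate (A : nat) : R := (2 * theta - s) * A%:R / (b - 1) + 1.

Let rate_gt0 A : 0 < rate A.
Proof.
have [_ s2] := andP theta_s.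
by rewrite ltr_wpDl // divr_ge0 ?mulr_ge0 ?subr_ge0// ltW.
Qed.

(** [A] is deterministic here. The implication in the constraint leaves the last vertex free and
    truncates only its predecessors. *)
Lemma ae_last_edge (A : nat) : {ae P, forall w, exists K, forall k, (K <= k)%N ->
  ~ (\bigcup_j extends (fun m j => (m < k)%N ==> (j%:R <= A%:R * b ^+ m))
       `]-oo, quantile L (expR (- (rate A * b ^+ k)))[ k.-1 [:: (x, j)]) w}.
Proof.
have [C C0 HC] := geometric_expR_bound D_ge0 b_gt1.
apply: (@borel_cantelli_geometric _ _ _ _ _ (M * C) 1) => k k0.
have b0 m : 0 < b ^+ m by rewrite exprn_gt0 // (lt_trans ltr01).
have y01 : 0 < expR (- (rate A * b ^+ k)) < 1.
  by rewrite expR_gt0 expR_lt1 oppr_lt0 mulr_gt0.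
apply: (covered_le _ (@first_moment_covered _ _ A%:R _ M k k0 _ _
   (prob_lt_quantile L_ge0 y01) _ _)) => //.
- apply: (@le_trans _ _ (M * (D ^+ k * expR (- b ^+ k)))); last first.
    by rewrite -mulrA; apply: ler_wpM2l.
  have -> : expR (- b ^+ k) = expR ((2 * theta - s) * A%:R * (b ^+ k / (b - 1))) *
      expR (- (rate A * b ^+ k)).
    rewrite -expRD; congr expR; rewrite /rate; field.
    by rewrite subr_eq0 gt_eqF.
  have E (a1 a2 a3 a4 : R) : a1 * a2 * (a3 * a4) = a3 * (a1 * (a2 * a4)) by ring.
  by rewrite E.
- by move=> m j -> /=.
- move=> n; rewrite ltnn /=; apply: le_trans (sum_level_tail_theta n).
  by apply: ler_sum => j _; rewrite mulr1.
Qed.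

Lemma ae_last_edge_ge : {ae P, forall w, exists c K, [/\ 0 < c, (0 < K)%N &
  forall vs z, path (adj w) x (rcons vs z) -> uniq (x :: rcons vs z) ->
    (K <= (size vs).+1)%N ->
    quantile L (expR (- (c * b ^+ (size vs).+1))) <= edge_weight G (last x vs) z w]}.
Proof.
(* All integers [A] at once, so that the random truncation of [ae_level_le] can be inserted. *)
have H1 : {ae P, forall w, forall A, exists K, forall k, (K <= k)%N ->
  ~ (\bigcup_j extends (fun m j => (m < k)%N ==> (j%:R <= A%:R * b ^+ m))
       `]-oo, quantile L (expR (- (rate A * b ^+ k)))[ k.-1 [:: (x, j)]) w}.
  exact/ae_foralln/ae_last_edge.
apply: filterS3 H1 ae_level_le ae_weight_ge1 => w + [A HA] w1.
move=> /(_ A)[K HK]; exists (rate A), K.+1; split => // vs z xvs uvs /ltnW Kvs.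
rewrite leNgt; apply/negP => lt; apply: (HK _ Kvs).
apply: (extends_path w1 xvs uvs); last by rewrite /= in_itv.
move=> i; rewrite leq_eqVlt => /orP[/eqP->|]; first by rewrite ltnn.
rewrite ltnS => ivs; apply/implyP => _.
have sti : size (take i vs) = i by rewrite size_takel.
rewrite -rcons_cons nth_rcons /= ltnS ivs.
have -> : nth x (x :: vs) i = last x (take i vs).
  by rewrite (last_nth x) sti -[in LHS](cat_take_drop i vs) -cat_cons nth_cat /= sti ltnS leqnn.
rewrite -[in X in _ <= X]sti; apply: HA.
- move: xvs; rewrite rcons_path => /andP[+ _].
  by rewrite -{1}(cat_take_drop i vs) cat_path => /andP[].
- move: uvs; rewrite -rcons_cons rcons_uniq => /andP[_].
  by rewrite -{1}(cat_take_drop i vs) -cat_cons cat_uniq => /andP[].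
Qed.

(** The expected degree is finite: summing the bound for a single edge over the position of the
    neighbour and both levels gives at most kernel_const Z M^2. *)
Lemma ae_locally_finite : {ae P, forall w, forall v, finite_set [set u | adj w v u]}.
Proof.
apply: ae_forall_countable => v.
pose F u := if u == v then set0 else
  \bigcup_j \bigcup_i path_event G [:: (u, j); (v, i)].
have FC : {ae P, forall w, finite_set [set u | F u w]}.
  apply: (@borel_cantelli_countable _ _ _ _ Zd F
    (fun u => kernel_const * kernel u v * (M * M)) (kernel_const * Z * (M * M))) => [u|us uus].
    rewrite /F; have [_|uv] := eqVneq u v.
      by apply: covered_set0; rewrite !mulr_ge0 // powR_ge0.
    have K0 : 0 <= kernel_const * kernel u v by rewrite mulr_ge0 // powR_ge0.
    apply: (@covered_bigcup _ _ _ _ nat _ (fun j => expR (theta * j%:R) * h j *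
        (kernel_const * kernel u v * M))) => [j|js ujs].
      apply: (@covered_bigcup _ _ _ _ nat _ (fun i => expR (theta * i%:R) * h i *
        (expR (theta * j%:R) * h j * (kernel_const * kernel u v)))) => [i|is_ uis].
        apply: covered_measurable; first by apply: (@sWE_measurable _ _ _ _ _ _ _ _ _ _ _ _ G); exact: sWE_path_event.
        apply: (@le_trans _ _ (@weight_bound R d lambda alpha dS S Q W theta
            [:: (u, j); (v, i)])%:E).
          by apply: prob_path_event_le => //; rewrite /= inE uv.
        rewrite lee_fin /= /pair_bound /= mulrDr expRD.
        have E (a1 a2 a3 a4 a5 a6 : R) : a1 * (a2 * (a3 * a4) * a5) * (a6 * 1 * 1) =
          a4 * a6 * (a3 * a1 * (a2 * a5)) by ring.
        by rewrite E.
      rewrite -mulr_suml mulrC.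
      have -> : expR (theta * j%:R) * h j * (kernel_const * kernel u v * M) =
        expR (theta * j%:R) * h j * (kernel_const * kernel u v) * M by rewrite mulrA.
      apply: ler_wpM2l; first by rewrite !mulr_ge0 ?expR_ge0 ?level_tail_ge0 ?powR_ge0.
      apply: ler_sum_uniq_nat => // [i|n]; last exact: sum_level_tail_theta.
      by rewrite mulr_ge0 ?expR_ge0 ?level_tail_ge0.
    rewrite -mulr_suml mulrC [leRHS]mulrA; apply: ler_wpM2l; first by rewrite mulr_ge0.
    apply: ler_sum_uniq_nat => // [i|n]; last exact: sum_level_tail_theta.
    by rewrite mulr_ge0 ?expR_ge0 ?level_tail_ge0.
  rewrite -mulr_suml -mulr_sumr; apply: ler_wpM2r; first by rewrite mulr_ge0.
  by apply: ler_wpM2l => //; exact: Z_bound.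
apply: filterS2 FC ae_weight_ge1 => w Fw w1.
apply: sub_finite_set Fw => u /=; rewrite /sfp_adj => /asboolP vu.
rewrite /F; have [uv|uv] := eqVneq u v; first by move: vu; rewrite uv edge_irrefl.
exists (level w u) => //; exists (level w v) => //; split.
  by move=> t /=; rewrite !inE => /orP[]/eqP-> /=; exact: at_level_level.
by move=> e /=; rewrite consecutive_cons2 inE => /eqP-> /=; rewrite edge_sym.
Qed.

Lemma ae_edge_weight_ge0 :
  {ae P, forall w, forall u v, adj w u v -> 0 <= edge_weight G u v w}.
Proof.
apply: ae_forall_countable => u; apply: ae_forall_countable => v.
have [->|uv] := eqVneq u v.
  by apply: aeW => w; rewrite /sfp_adj => /asboolP; rewrite edge_irrefl.
have P0 : P (edge G u v `&` edge_weight G u v @^-1` `]-oo, 0%R[) = 0%E.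
  have := @edge_weight_iid _ _ _ _ _ _ _ _ _ _ _ _ G [:: (u, v)] (fun=> `]-oo, 0%R[%classic)
    (edge G u v).
  rewrite big_seq1 /= prob_L_lt0 // mule0 bigcap_seq big_seq1 => -> //.
  - split => // e; rewrite !inE => /eqP-> /=; apply/eqP => -[e1 _].
    by rewrite e1 eqxx in uv.
  - exact: sWE_edge.
  - by move=> e; rewrite inE => /eqP->.
apply: (@negligibleS _ _ _ _ (edge G u v `&` edge_weight G u v @^-1` `]-oo, 0%R[)).
  move=> w /= /not_implyP[]; rewrite /sfp_adj => /asboolP uvw /negP; rewrite -ltNge => lt.
  by split => //=; rewrite in_itv.
apply/negligibleP => //; apply: measurableI; first exact: measurable_edge.
exact: measurable_RV_preimage.
Qed.

End growth.

(** * Greedy path *)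

Section complement_products.
Context {R : realType} {dT : measure_display} {T : measurableType dT}.
Variable P : probability T R.
Context {I : choiceType}.
Implicit Types (phi psi : I -> T -> R) (F U : seq I) (H : set T).

Let mix phi F1 F2 (w : T) : R :=
  \prod_(u <- F1) phi u w * \prod_(u <- F2) (1 - phi u w).

Lemma measurable_prod_seq phi F H : (forall u, measurable_fun setT (phi u)) ->
  measurable_fun H (fun w => \prod_(u <- F) phi u w).
Proof.
move=> mphi; apply: measurable_funTS; elim: F => [|u F IH].
  by under eq_fun do rewrite big_nil; exact: measurable_cst.
by under eq_fun do rewrite big_cons; exact: measurable_funM.
Qed.

Let measurable_mix phi F1 F2 H : (forall u, measurable_fun setT (phi u)) ->
  measurable_fun H (mix phi F1 F2).
Proof.
move=> mphi; apply: measurable_funM; first exact: measurable_prod_seq.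
by apply: measurable_prod_seq => u; exact: measurable_funB.
Qed.

Lemma prod01 phi F w : (forall u, u \in F -> 0 <= phi u w <= 1) ->
  0 <= \prod_(u <- F) phi u w <= 1.
Proof.
move=> phi01; rewrite big_seq; apply: (big_ind (fun y => 0 <= y <= 1)).
- by rewrite ler01 lexx.
- by move=> y z /andP[y0 y1] /andP[z0 z1]; rewrite mulr_ge0 // mulr_ile1.
- exact: phi01.
Qed.

Let mix01 phi F1 F2 w : (forall u, u \in F1 ++ F2 -> 0 <= phi u w <= 1) ->
  0 <= mix phi F1 F2 w <= 1.
Proof.
move=> phi01.
have /andP[a0 a1] : 0 <= \prod_(u <- F1) phi u w <= 1.
  by apply: prod01 => u uF; apply: phi01; rewrite mem_cat uF.
have /andP[b0 b1] : 0 <= \prod_(u <- F2) (1 - phi u w) <= 1.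
  apply: (@prod01 (fun u w => 1 - phi u w)) => u uF.
  have /andP[? ?] : 0 <= phi u w <= 1 by apply: phi01; rewrite mem_cat uF orbT.
  by lra.
by rewrite /mix mulr_ge0 // mulr_ile1.
Qed.

Let integral_mix_split phi F1 u F2 H : measurable H ->
  (forall u, measurable_fun setT (phi u)) ->
  (forall v w, v \in F1 ++ u :: F2 -> H w -> 0 <= phi v w <= 1) ->
  (\int[P]_(w in H) (mix phi F1 F2 w)%:E =
   \int[P]_(w in H) (mix phi F1 (u :: F2) w)%:E +
   \int[P]_(w in H) (mix phi (u :: F1) F2 w)%:E)%E.
Proof.
move=> mH mphi phi01; rewrite -ge0_integralD //; first last.
- by apply/measurable_EFinP; exact: measurable_mix.
- move=> w Hw; rewrite lee_fin; suff /andP[] : 0 <= mix phi (u :: F1) F2 w <= 1 by [].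
  apply: mix01 => v.
  have /permPl pc := perm_catCA F1 [:: u] F2.
  by rewrite -[v \in _](perm_mem pc) => /phi01; apply.
- by apply/measurable_EFinP; exact: measurable_mix.
- move=> w Hw; rewrite lee_fin; suff /andP[] : 0 <= mix phi F1 (u :: F2) w <= 1 by [].
  by apply: mix01 => v /phi01; apply.
apply: eq_integral => w _; rewrite -EFinD; congr EFin.
by rewrite /mix !big_cons; ring.
Qed.

(* The expectation of a product of complements is determined by those of the
   products, by expanding the complements one at a time. *)
Lemma eq_integral_prod_compl phi psi H U : measurable H ->
  (forall u, measurable_fun setT (phi u)) -> (forall u, measurable_fun setT (psi u)) ->
  (forall u w, u \in U -> H w -> 0 <= phi u w <= 1) ->
  (forall u w, u \in U -> H w -> 0 <= psi u w <= 1) ->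
  (forall F, uniq F -> {subset F <= U} ->
    (\int[P]_(w in H) (\prod_(u <- F) phi u w)%:E =
     \int[P]_(w in H) (\prod_(u <- F) psi u w)%:E)%E) ->
  uniq U ->
  (\int[P]_(w in H) (\prod_(u <- U) (1 - phi u w))%:E =
   \int[P]_(w in H) (\prod_(u <- U) (1 - psi u w))%:E)%E.
Proof.
move=> mH mphi mpsi phi01 psi01 eqF uU.
suff E F2 F1 : uniq (F1 ++ F2) -> {subset F1 ++ F2 <= U} ->
    (\int[P]_(w in H) (mix phi F1 F2 w)%:E = \int[P]_(w in H) (mix psi F1 F2 w)%:E)%E.
  have mixE (f : I -> T -> R) : (fun w => (mix f [::] U w)%:E) =
      (fun w => (\prod_(u <- U) (1 - f u w))%:E).
    by apply/funext => w; rewrite /mix big_nil mul1r.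
  by have := E U [::] uU (fun u => id); rewrite !mixE.
elim: F2 F1 => [|u F2 IH] F1 uF sF.
  have mixE (f : I -> T -> R) : (fun w => (mix f F1 [::] w)%:E) =
      (fun w => (\prod_(u <- F1) f u w)%:E).
    by apply/funext => w; rewrite /mix big_nil mulr1.
  by rewrite !mixE; apply: eqF; [move: uF; rewrite cats0|move=> v vF; apply: sF; rewrite cats0].
have pc : perm_eq (F1 ++ u :: F2) (u :: F1 ++ F2) by apply/permPl; exact: (perm_catCA F1 [:: u] F2).
have uF' : uniq ((u :: F1) ++ F2) by rewrite -(perm_uniq pc).
have sF' : {subset (u :: F1) ++ F2 <= U} by move=> v; rewrite -(perm_mem pc); exact: sF.
have uF12 : uniq (F1 ++ F2) by move: uF' => /andP[].
have sF12 : {subset F1 ++ F2 <= U}.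
  by move=> v vF; apply: sF'; rewrite cat_cons in_cons vF orbT.
have phi' v w : v \in F1 ++ u :: F2 -> H w -> 0 <= phi v w <= 1.
  by move=> /sF; exact: phi01.
have psi' v w : v \in F1 ++ u :: F2 -> H w -> 0 <= psi v w <= 1.
  by move=> /sF; exact: psi01.
have := integral_mix_split mH mphi phi'; have := integral_mix_split mH mpsi psi'.
rewrite (IH _ uF12 sF12) => -> /esym; rewrite (IH _ uF' sF').
set X := (\int[P]_(w in H) (mix psi (u :: F1) F2 w)%:E)%E => eqX.
have X01 w : H w -> 0 <= mix psi (u :: F1) F2 w <= 1.
  by move=> Hw; apply: mix01 => v /sF' vU; exact: psi01.
(* Needed to cancel [X] from both sides in the extended reals. *)
have Xfin : X \is a fin_num.
  rewrite ge0_fin_numE; last first.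
    by apply: integral_ge0 => w /X01 /andP[? ?]; rewrite lee_fin.
  apply: (@le_lt_trans _ _ (\int[P]_(w in H) (cst 1%E w))%E); last first.
    rewrite integral_cst // mul1e; apply: (@le_lt_trans _ _ 1%E); last by rewrite ltry.
    exact: probability_le1.
  apply: ge0_le_integral => //.
  - by move=> w /X01 /andP[? ?]; rewrite lee_fin.
  - by apply/measurable_EFinP; exact: measurable_mix.
  - by move=> w /X01 /andP[? ?]; rewrite lee_fin.
by rewrite -[LHS](addeK _ Xfin) eqX addeK.
Qed.

Lemma prod_indic_bigcap (A : I -> set T) F w :
  \prod_(u <- F) \1_(A u) w = \1_(\bigcap_(u in [set` F]) A u) w :> R.
Proof.
elim: F => [|u F IH].
  by rewrite big_nil indicE mem_set.
rewrite big_cons IH !indicE -natrM mulnb; congr (nat_of_bool _)%:R.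
apply/idP/idP; rewrite !inE.
  move=> /andP[]; rewrite !inE => Au AF v /=; rewrite inE => /orP[/eqP->//|vF].
  exact: AF.
move=> AF; apply/andP; rewrite !inE; split; first by apply: AF; rewrite /= inE eqxx.
by move=> v vF; apply: AF; rewrite /= inE vF orbT.
Qed.

Lemma integral_prod_indic (A : I -> set T) F H : measurable H ->
  (forall u, measurable (A u)) ->
  (\int[P]_(w in H) (\prod_(u <- F) \1_(A u) w)%:E =
    P (H `&` \bigcap_(u in [set` F]) A u))%E.
Proof.
move=> mH mA; under eq_integral do rewrite prod_indic_bigcap.
rewrite integral_indic //; first by rewrite setIC.
by rewrite bigcap_seq; apply: (big_ind measurable) => //; exact: measurableI.
Qed.

End complement_products.

Lemma prodr_const_seq {R : comPzRingType} {I : Type} (s : seq I) (y : R) :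
  \prod_(i <- s) y = y ^+ size s.
Proof. by elim: s => [|i s IH]; rewrite ?big_nil ?expr0 // big_cons IH exprS. Qed.

(** * Heavy neighbours reached through light edges *)

Section neighbour.
Context {R : realType} {d : nat} {lambda alpha : R}.
Context {dS : measure_display} {S : measurableType dS} {Q : probability S R}.
Context {W L : {RV Q >-> R}}.
Context {dT : measure_display} {T : measurableType dT} {P : probability T R}.
Variable G : @weighted_sfp R d lambda alpha dS S Q W L dT T P.
Hypothesis lambda_gt0 : 0 < lambda.

Local Notation Zd := 'rV[int]_d.
Local Notation dist := (@euclidean_dist R d).
Local Notation ww := (vertex_weight G).
Local Notation conn w e :=
  (connection_prob lambda alpha (fun x => ww x w) e.1 e.2).

Definition tail_prob (a : R) : R := fine (Q (W @^-1` `[a, +oo[)).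

Lemma tail_prob01 a : 0 <= tail_prob a <= 1.
Proof.
rewrite /tail_prob fine_ge0 //= -lee_fin fineK; last first.
  by apply: fin_num_measure; exact: measurable_RV_preimage.
by apply: probability_le1; exact: measurable_RV_preimage.
Qed.

Lemma prob_weight_ge v a : P (ww v @^-1` `[a, +oo[) = (tail_prob a)%:E.
Proof.
rewrite vertex_weight_law // fineK //.
by apply: fin_num_measure; exact: measurable_RV_preimage.
Qed.

Lemma expr_onem_le (h : R) n : 0 <= h <= 1 -> (1 - h) ^+ n <= expR (- (h * n%:R)).
Proof.
move=> /andP[h0 h1]; rewrite -mulNr expRM_natr.
apply: lerXn2r; rewrite ?nnegrE ?expR_ge0 ?subr_ge0//.
exact: expR_ge1Dx.
Qed.

Lemma prob_no_weight_ge (U : seq Zd) a : uniq U ->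
  (P (\bigcap_(u in [set` U]) ww u @^-1` `]-oo, a[) <=
    (expR (- (tail_prob a * (size U)%:R)))%:E)%E.
Proof.
move=> uU; rewrite (vertex_weight_indep G uU (B := fun=> `]-oo, a[%classic)) //.
rewrite (eq_bigr (fun=> (1 - tail_prob a)%:E)); last first.
  move=> u _; rewrite (_ : _ @^-1` _ = ~` (ww u @^-1` `[a, +oo[)); last first.
    by apply/seteqP; split => s /=; rewrite !in_itv /= andbT ltNge => /negP.
  rewrite probability_setC ?prob_weight_ge//; exact: measurable_RV_preimage.
by rewrite prodEFin prodr_const_seq lee_fin expr_onem_le // tail_prob01.
Qed.

Definition good_neighbour (a' : R) (B : set R) (v u : Zd) : set T :=
  ww u @^-1` `[a', +oo[ `&` edge G v u `&` edge_weight G v u @^-1` B.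

(** Simultaneous success is what the axioms of the model compute: a factor [y] per edge weight, the
    connection probability per edge, an indicator per vertex weight. *)
Lemma prob_good_neighbours v (F : seq Zd) a a' (B : set R) (y : R) :
  0 <= a -> 0 <= a' -> 0 <= y ->
  measurable B -> Q (L @^-1` B) = y%:E -> uniq F -> v \notin F ->
  (forall u, u \in F -> 1 < dist v u) ->
  (P (ww v @^-1` `[a, +oo[ `&` \bigcap_(u in [set` F]) good_neighbour a' B v u) =
   \int[P]_(w in ww v @^-1` `[a, +oo[)
     (\prod_(u <- F) (y * \1_(ww u @^-1` `[a', +oo[) w * conn w (v, u)))%:E)%E.
Proof.
move=> a0 a'0 y0 mB Qy uF vF farF.
pose E := [seq (v, u) | u <- F].
pose K := \bigcap_(u in [set` F]) ww u @^-1` `[a', +oo[.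
pose A := ww v @^-1` `[a, +oo[ `&` K.
have plE : pair_list E.
  split; first by rewrite map_inj_uniq // => u1 u2 [].
  move=> _ /mapP[u uF' ->] /=; apply/negP => /mapP[u' u'F [uv _]].
  by move: vF; rewrite -uv uF'.
have sA : <<s vertex_events ww >> A.
  apply: gen_setI; first exact: sW_vertex.
  by apply: (@gen_bigcap _ _ _ _ F) => u _; exact: sW_vertex.
have sAE : <<s vertex_events ww `|` edge_events (edge G) >>
    (A `&` \bigcap_(e in [set` E]) edge G e.1 e.2).
  apply: gen_setI.
    apply: gen_setI; first exact: sWE_vertex.
    by apply: (@gen_bigcap _ _ _ _ F) => u _; exact: sWE_vertex.
  by apply: (@gen_bigcap _ _ _ _ E) => e _; exact: sWE_edge.
have -> : ww v @^-1` `[a, +oo[ `&` \bigcap_(u in [set` F]) good_neighbour a' B v u =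
   A `&` \bigcap_(e in [set` E]) edge G e.1 e.2 `&`
   \bigcap_(e in [set` E]) edge_weight G e.1 e.2 @^-1` B.
  apply/seteqP; split => w.
    move=> [wv gF]; split; first split; first split => //.
    - by move=> u uF'; case: (gF u uF') => -[].
    - by move=> e /= /mapP[u uF' ->]; case: (gF u uF') => -[].
    - by move=> e /= /mapP[u uF' ->]; case: (gF u uF') => -[].
  move=> [[[wv aF] eF] lF]; split => // u uF'; split; first split.
  - exact: aF.
  - by apply: (eF (v, u)); exact: map_f.
  - by apply: (lF (v, u)); exact: map_f.
rewrite (@edge_weight_iid _ _ _ _ _ _ _ _ _ _ _ _ G E (fun=> B) _ plE) //; last first.
  by move=> e eE w [_]; apply.
rewrite (edge_far plE _ sA); last by move=> _ /mapP[u uF' ->]; exact: farF.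
have mHv : measurable (ww v @^-1` `[a, +oo[) by exact: measurable_RV_preimage.
have mK : measurable K.
  by apply: (@sW_measurable _ _ _ _ _ _ _ _ _ _ _ _ G); apply: (@gen_bigcap _ _ _ _ F) => u _; exact: sW_vertex.
rewrite /A integral_mkcondr muleC.
rewrite (eq_bigr (fun=> y%:E)); last by move=> e _; exact: Qy.
rewrite prodEFin prodr_const_seq size_map.
have -> : (fun w => (\prod_(e <- E) conn w e)%:E) \_ K =
    (fun w => (\1_K w * \prod_(u <- F) conn w (v, u))%:E).
  apply/funext => w; rewrite patchE indicE big_map.
  by case: ifP => wK; rewrite ?mul1r ?mul0r.
rewrite -ge0_integralZl_EFin ?exprn_ge0//; first last.
- apply/measurable_EFinP/measurable_funTS/measurable_funM; first exact: measurable_indic.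
  by apply: measurable_prod_seq => u; exact: measurable_conn.
- move=> w; rewrite /= in_itv /= andbT => aw; rewrite lee_fin indicE.
  have [|_] := boolP (w \in K); last by rewrite mul0r.
  rewrite inE => Kw; rewrite mul1r big_seq; apply: prodr_ge0 => u uF'.
  apply: (@conn_ge0 _ _ _ _ _ _ _ _ _ _ _ _ G w (v, u)) => //.
    exact: le_trans aw.
  by apply: le_trans a'0 _; have := Kw u uF'; rewrite /= in_itv /= andbT.
apply: eq_integral => w _; rewrite !big_split /= prodr_const_seq prod_indic_bigcap -/K.
by rewrite -EFinM mulrA.
Qed.

(** Two exchanges inside the product of complements. Success indicators become conditional success
    probabilities, at least y p0 on heavy candidates; then the indicators of heaviness become their
    common probability, by independence of the vertex weights. *)
Lemma prob_no_good_neighbour v (U : seq Zd) a a' (B : set R) (y p0 : R) :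
  0 <= a -> 0 <= a' -> 0 <= p0 <= 1 ->
  measurable B -> Q (L @^-1` B) = y%:E -> uniq U -> v \notin U ->
  (forall u, u \in U -> 1 < dist v u) ->
  (forall u w, u \in U -> a <= ww v w -> a' <= ww u w -> p0 <= conn w (v, u)) ->
  (P (ww v @^-1` `[a, +oo[ `&` \bigcap_(u in [set` U]) ~` good_neighbour a' B v u) <=
    (expR (- (y * p0 * tail_prob a' * (size U)%:R)))%:E)%E.
Proof.
move=> a0 a'0 /andP[p00 p01] mB Qy uU vU farU p0U.
have /andP[y0 y1] : 0 <= y <= 1.
  rewrite -!lee_fin -Qy measure_ge0 /=; apply: probability_le1.
  exact: measurable_RV_preimage.
have /andP[h0 h1] := tail_prob01 a'.
set H := ww v @^-1` `[a, +oo[.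
have mH : measurable H by exact: measurable_RV_preimage.
have mGood u : measurable (good_neighbour a' B v u).
  apply: measurableI; last exact: measurable_RV_preimage.
  apply: measurableI; last exact: measurable_edge.
  exact: measurable_RV_preimage.
have mind (A : set T) : measurable A -> measurable_fun setT (\1_A : T -> R).
  by move=> mA; exact: measurable_indic.
have indic01 (A : set T) w : 0 <= (\1_A w : R) <= 1.
  by rewrite indicE; case: (w \in A); rewrite ?ler01 ?lexx.
have mW u : measurable (ww u @^-1` `[a', +oo[) by exact: measurable_RV_preimage.
pose phi u w : R := y * \1_(ww u @^-1` `[a', +oo[) w * conn w (v, u).
have mphi u : measurable_fun setT (phi u).
  apply: measurable_funM; last exact: measurable_conn.
  by apply: measurable_funM => //; exact: mind.
have conn_le1 w e : conn w e <= 1 by rewrite /connection_prob gerBl expR_ge0.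
have inH w : H w -> a <= ww v w by rewrite /H /= in_itv /= andbT.
have phi01 u w : u \in U -> H w -> 0 <= phi u w <= 1.
  move=> uU' /inH Hw; rewrite /phi indicE.
  have [|_] := boolP (w \in _); last by rewrite mulr0 mul0r lexx ler01.
  rewrite inE /= in_itv /= andbT => aw.
  have c0 : 0 <= conn w (v, u) by apply: (@conn_ge0 _ _ _ _ _ _ _ _ _ _ _ _ G w (v, u)) => //;
      [exact: le_trans Hw|exact: le_trans aw].
  rewrite mulr1; apply/andP; split; first exact: mulr_ge0.
  by apply: mulr_ile1 => //; exact: (conn_le1 w (v, u)).
rewrite -integral_prod_indic //; last by move=> u; exact: measurableC.
have -> : (fun w => (\prod_(u <- U) \1_(~` good_neighbour a' B v u) w)%:E) =
    (fun w => (\prod_(u <- U) (1 - \1_(good_neighbour a' B v u) w))%:E) :> (T -> \bar R).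
  apply/funext => w; congr EFin; apply: eq_bigr => u _.
  rewrite !indicE in_setC; case: (w \in _); rewrite ?subrr ?subr0//.
rewrite (@eq_integral_prod_compl _ _ _ P _ _ phi) //; first last.
- move=> F uF sF; rewrite integral_prod_indic //.
  rewrite (@prob_good_neighbours v F a a' B y) //.
  + by apply: contra vU; exact: sF.
  + by move=> u /sF; exact: farU.
- by move=> u; exact: mind.
apply: (@le_trans _ _ (\int[P]_(w in H) (\prod_(u <- U)
    (1 - (y * p0) * \1_(ww u @^-1` `[a', +oo[) w))%:E)%E).
  apply: ge0_le_integral => //.
  - move=> w Hw; rewrite lee_fin big_seq; apply: prodr_ge0 => u uU'.
    by rewrite subr_ge0; case/andP: (phi01 u w uU' Hw).
  - by apply/measurable_EFinP/measurable_prod_seq => u; exact: measurable_funB.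
  - apply/measurable_EFinP/measurable_prod_seq => u; apply: measurable_funB => //.
    by apply: measurable_funM => //; exact: mind.
  - move=> w Hw; rewrite lee_fin big_seq [leRHS]big_seq; apply: ler_prod => u uU'.
    have /andP[? ?] := phi01 u w uU' Hw; rewrite subr_ge0; apply/andP; split => //.
    rewrite lerD2l lerN2 /phi indicE.
    have [|_] := boolP (w \in _); last by rewrite !mulr0 mul0r.
    rewrite inE /= in_itv /= andbT !mulr1 => aw.
    by apply: ler_wpM2l => //; apply: p0U => //; exact: inH.
have yp01 : 0 <= y * p0 <= 1 by rewrite mulr_ge0 //= mulr_ile1.
rewrite (@eq_integral_prod_compl _ _ _ P _ (fun u w => y * p0 * \1_(ww u @^-1` `[a', +oo[) w)
   (fun _ _ => y * p0 * tail_prob a')) //; first last.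
- move=> F uF sF; under eq_integral do rewrite big_split /= prodr_const_seq.
  under [RHS]eq_integral do rewrite prodr_const_seq.
  rewrite integral_cst //; under eq_integral do rewrite EFinM.
  have c0 : 0 <= (y * p0) ^+ size F by rewrite exprn_ge0 // mulr_ge0.
  rewrite ge0_integralZl_EFin //; first last.
  + by apply/measurable_EFinP/measurable_prod_seq => u; exact: mind.
  + by move=> w _; rewrite lee_fin; apply: prodr_ge0 => u _; case/andP: (indic01 (ww u @^-1` `[a', +oo[) w).
  rewrite integral_prod_indic //.
  have vF : v \notin F by apply: contra vU; exact: sF.
  (* [v] joins the list with its own threshold, so that independence applies to [v] and [F]
     together. *)
  have -> : H `&` \bigcap_(u in [set` F]) ww u @^-1` `[a', +oo[ =
     \bigcap_(u in [set` v :: F]) ww u @^-1` (if u == v then `[a, +oo[ else `[a', +oo[)%classic.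
    apply/seteqP; split => w.
      move=> [Hw aF] u /=; rewrite in_cons => /orP[/eqP->|uF']; first by rewrite eqxx.
      by rewrite (negbTE (memPn vF _ uF')); exact: aF.
    move=> aF; split; first by have := aF v; rewrite /= in_cons eqxx; apply.
    move=> u uF'; have := aF u; rewrite /= in_cons uF' orbT => /(_ isT).
    by rewrite (negbTE (memPn vF _ uF')).
  rewrite (vertex_weight_indep G (s := v :: F)
    (B := fun u => (if u == v then `[a, +oo[ else `[a', +oo[)%classic)); last 2 first.
  + by rewrite /= vF uF.
  + by move=> u; case: ifP.
  rewrite big_cons eqxx -/H big_seq (eq_bigr (fun=> (tail_prob a')%:E)); last first.
    by move=> u uF'; rewrite (negbTE (memPn vF _ uF')) prob_weight_ge.
  rewrite -big_seq prodEFin prodr_const_seq [in RHS]exprMn [in RHS]EFinM.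
  by rewrite -muleA (muleC (P H)).
- by move=> u w _ _; case/andP: yp01 => ? ?; rewrite mulr_ge0 //= mulr_ile1.
- by move=> u w _ _; case/andP: yp01 => ? ?; case/andP: (indic01 (ww u @^-1` `[a', +oo[) w) => ? ?; rewrite mulr_ge0 //= mulr_ile1.
- by move=> u; apply: measurable_funM => //; exact: mind.
under eq_integral do rewrite prodr_const_seq.
rewrite integral_cst // -[leRHS]mule1; apply: lee_pmul => //.
- by rewrite lee_fin exprn_ge0 // subr_ge0; case/andP: yp01 => ? ?; rewrite mulr_ile1.
- rewrite lee_fin; apply: expr_onem_le; case/andP: yp01 => ? ?.
  by rewrite mulr_ge0 //= mulr_ile1.
- exact: probability_le1.
Qed.

End neighbour.

Section cube.
Context {R : realType} {d : nat}.
Local Notation Zd := 'rV[int]_d.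
Local Notation dist := (@euclidean_dist R d).
Implicit Types (u v : Zd) (o m : nat).

(** The points of v + [o, o + m)^d. Staying in one orthant lets successive cubes fit in a cube based
    at [x], and o = 2 keeps the points at distance more than 1 from [v], where [edge_far]
    applies. *)
Definition cube v o m : seq Zd :=
  [seq v + \row_i (Posz (nat_of_ord (f i) + o)) | f : {ffun 'I_d -> 'I_m}].

Lemma cube_uniq v o m : uniq (cube v o m).
Proof.
rewrite map_inj_uniq ?enum_uniq // => f g /addrI/rowP fg; apply/ffunP => i.
by have := fg i; rewrite !mxE => -[/addIn/val_inj].
Qed.

Lemma size_cube v o m : size (cube v o m) = (m ^ d)%N.
Proof. by rewrite size_map -cardE card_ffun !card_ord. Qed.

Lemma cubeP v o m u : u \in cube v o m <->
  forall i, exists2 n : nat, (n < m)%N & u 0 i = v 0 i + Posz (n + o).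
Proof.
split.
  by move=> /mapP[f _ ->] i; exists (f i) => //; rewrite !mxE.
move=> H; have [g Hg] := choice (fun i => let: ex_intro2 n a b := H i in
  ex_intro (fun n => (n < m)%N /\ u 0 i = v 0 i + Posz (n + o)) n (conj a b)).
apply/mapP; exists [ffun i => Ordinal (Hg i).1]; first by rewrite mem_enum.
by apply/rowP => i; rewrite !mxE ffunE /=; case: (Hg i).
Qed.

Lemma cube_trans v u z o m k n : u \in cube v 0 k -> z \in cube u o m ->
  (k + m + o <= n.+1)%N -> z \in cube v 0 n.
Proof.
move=> /cubeP uv /cubeP zu le; apply/cubeP => i.
have [c cm ->] := zu i; have [a ak ->] := uv i.
by exists (a + c + o)%N; [lia|rewrite -addrA; congr (_ + _); lia].
Qed.

Lemma cube_far v u o m : (0 < d)%N -> (1 < o)%N -> u \in cube v o m -> 1 < dist v u.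
Proof.
move=> d0 o1 /cubeP uv; have [n _ un] := uv (Ordinal d0).
apply: lt_le_trans (euclidean_dist_coord v u (Ordinal d0)).
rewrite un opprD addrA subrr sub0r mulrNz normrN.
rewrite -[ltLHS]/(1%:R) -pmulrn ger0_norm ?ler0n// ltr_nat.
by apply: leq_trans o1 _; rewrite leq_addl.
Qed.

Lemma cube_dist_le v u o m : u \in cube v o m -> dist v u <= (d * (m + o))%:R.
Proof.
move=> /cubeP uv; set N := (d * (m + o))%:R.
have -> : N = Num.sqrt (N ^+ 2) by rewrite sqrtr_sqr ger0_norm.
apply: ler_wsqrtr; apply: (@le_trans _ _ (\sum_(i < d) ((m + o)%:R : R) ^+ 2)).
  apply: ler_sum => i _; have [n nm ->] := uv i.
  rewrite opprD addrA subrr sub0r mulrNz sqrrN -pmulrn.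
  by rewrite lerXn2r ?nnegrE ?ler0n// ler_nat leq_add2r ltnW.
rewrite sumr_const card_ord /N natrM exprMn -[leLHS]mulr_natl; apply: ler_wpM2r.
  by rewrite exprn_ge0.
by rewrite -natrX ler_nat; case: (d) => // k; rewrite leq_pmulr.
Qed.

End cube.

Lemma covered_seq {R : realType} {dT : measure_display} {T : measurableType dT}
    (P : probability T R) {I : eqType} (U : seq I) (F : I -> set T) (c : R) :
  0 <= c -> (forall v, v \in U -> covered P (F v) c) ->
  covered P [set w | exists2 v, v \in U & F v w] ((size U)%:R * c).
Proof.
move=> c0; elim: U => [|v U IH] cF.
  by apply: (@coveredS _ _ _ _ _ set0) => [w [v]//|]; apply: covered_set0; rewrite mul0r.
apply: (@coveredS _ _ _ _ _ (F v `|` [set w | exists2 v, v \in U & F v w])).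
  move=> w [u]; rewrite in_cons => /orP[/eqP->|uU] Fu; first by left.
  by right; exists u.
rewrite /= mulrS mulrDl mul1r; apply: coveredU; first by apply: cF; rewrite in_cons eqxx.
by apply: IH => u uU; apply: cF; rewrite in_cons uU orbT.
Qed.

Section greedy.
Context {R : realType} {d : nat} {lambda alpha : R}.
Context {dS : measure_display} {S : measurableType dS} {Q : probability S R}.
Context {W L : {RV Q >-> R}}.
Context {dT : measure_display} {T : measurableType dT} {P : probability T R}.
Variable G : @weighted_sfp R d lambda alpha dS S Q W L dT T P.
Variables (b sp c0 eta : R) (x : 'rV[int]_d).
Hypothesis d_gt0 : (0 < d)%N.
Hypothesis lambda_gt0 : 0 < lambda.
Hypothesis alpha_gt0 : 0 < alpha.
Hypothesis b_gt1 : 1 < b.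
Hypothesis c0_gt0 : 0 < c0.
Hypothesis eta_gt0 : 0 < eta.
Hypothesis sp_eta : sp * b + 2 * eta <= d%:R * ((1 + b) / alpha).
Hypothesis tail_lower : forall y, 0 <= y ->
  c0 * expR (- (sp * y)) <= @tail_prob R dS S Q W (expR y).
Hypothesis L_ge0 : Q [set t | 0 <= L t] = 1%E.

Local Notation Zd := 'rV[int]_d.
Local Notation dist := (@euclidean_dist R d).
Local Notation ww := (vertex_weight G).
Local Notation adj := (sfp_adj G).
Local Notation tail_prob := (@tail_prob R dS S Q W).

(** At distance e^(mu b^k), weights e^(b^k) and e^(b^(k+1)) give W W' / dist^alpha = 1, so
    connections up to this range have probability bounded below. *)
Let mu : R := (1 + b) / alpha.

Definition reach k : nat := Num.truncn (expR (mu * b ^+ k)).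

(** A step from generation j raises each coordinate by at most [reach j + 1], so a path starting in
    the box of its first generation stays in these boxes. *)
Definition box_size k : nat := (\sum_(j < k) (reach j).+1).+1.

Definition threshold k : R := expR (b ^+ k).

Definition greedy_length k : R := quantile L (expR (- (eta * b ^+ k))).

Let b_gt0 : 0 < b. Proof. exact: lt_trans b_gt1. Qed.

Let mu_gt0 : 0 < mu. Proof. by rewrite divr_gt0 // addr_gt0. Qed.

Let bk_ge1 k : 1 <= b ^+ k. Proof. by rewrite exprn_ege1 // ltW. Qed.

Let bk_gt0 k : 0 < b ^+ k. Proof. exact: lt_le_trans (bk_ge1 k). Qed.

Let expmu_gt1 k : 1 < expR (mu * b ^+ k).
Proof. by rewrite expR_gt1 mulr_gt0. Qed.

Lemma reach_le k : (reach k)%:R <= expR (mu * b ^+ k).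
Proof. by have /andP[] := truncn_itv (expR_ge0 (mu * b ^+ k)). Qed.

Lemma reach_gt0 k : (0 < reach k)%N.
Proof.
have /andP[_] := truncn_itv (expR_ge0 (mu * b ^+ k)); rewrite -/(reach k).
by move=> /(lt_trans (expmu_gt1 k)); rewrite ltr1n.
Qed.

Lemma reach_ge k : expR (mu * b ^+ k) / 2 <= (reach k)%:R.
Proof.
have /andP[_] := truncn_itv (expR_ge0 (mu * b ^+ k)); rewrite -/(reach k) -natr1.
have : (1 : R) <= (reach k)%:R by rewrite ler1n reach_gt0.
lra.
Qed.

Lemma box_sizeS k : box_size k.+1 = (box_size k + (reach k).+1)%N.
Proof. by rewrite /box_size big_ord_recr /= addSn. Qed.

Lemma reach_homo k j : (k <= j)%N -> expR (mu * b ^+ k) <= expR (mu * b ^+ j).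
Proof.
by move=> kj; rewrite ler_expR ler_wpM2l ?(ltW mu_gt0)// ler_weXn2l // ltW.
Qed.

(** The sum is at most (1 + 2 k) e^(mu b^k), and Bernoulli gives 1 + 2 k <= e^(2 b^k / (b - 1)). *)
Lemma box_size_le k : (box_size k)%:R <= expR ((2 / (b - 1) + mu) * b ^+ k).
Proof.
apply: (@le_trans _ _ ((1 + 2 * k%:R) * expR (mu * b ^+ k))).
  elim: k => [|k IH].
    by rewrite /box_size big_ord0 mulr0 addr0 mul1r ltW.
  rewrite box_sizeS natrD -natr1 -[k.+1%:R]natr1.
  apply: (@le_trans _ _ ((1 + 2 * k%:R) * expR (mu * b ^+ k.+1) + (expR (mu * b ^+ k.+1) + 1))).
    apply: lerD; first by apply: le_trans IH _; apply: ler_wpM2l; rewrite ?reach_homo// addr_ge0 // mulr_ge0.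
    by rewrite lerD2r; apply: le_trans (reach_le k) (reach_homo (leqnSn k)).
  by have := expmu_gt1 k.+1; lra.
rewrite [in leRHS]mulrDl expRD; apply: ler_wpM2r; first exact: expR_ge0.
apply: le_trans (expR_ge1Dx _) _; rewrite ler_expR mulrAC ler_pdivlMr ?subr_gt0//.
have := exprn_ge_affine k (ltW b_gt1); lra.
Qed.

(** The factor 3 d comes from dist <= d (reach k + 2) <= 3 d reach k. *)
Let p0 : R := 1 - expR (- (lambda / (3 * d%:R) `^ alpha)).

Let d3_gt0 : 0 < 3 * d%:R :> R. Proof. by rewrite mulr_gt0 // ltr0n. Qed.

Let p0_gt0 : 0 < p0.
Proof. by rewrite subr_gt0 expR_lt1 oppr_lt0 divr_gt0 // powR_gt0. Qed.

Let p0_le1 : p0 <= 1. Proof. by rewrite gerBl expR_ge0. Qed.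

Lemma conn_cube_ge k v u w : u \in cube v 2 (reach k) ->
  threshold k <= ww v w -> threshold k.+1 <= ww u w ->
  p0 <= connection_prob lambda alpha (fun y => ww y w) v u.
Proof.
move=> uv wv wu; rewrite /connection_prob lerD2l lerN2 ler_expR lerN2.
have D0 : 0 < dist v u by apply: lt_trans (cube_far (R := R) d_gt0 _ uv).
have D1 : dist v u <= 3 * d%:R * expR (mu * b ^+ k).
  apply: le_trans (cube_dist_le uv) _; rewrite -mulrA mulrCA natrM ler_wpM2l //.
  apply: (@le_trans _ _ (3 * (reach k)%:R)); last by rewrite ler_wpM2l ?reach_le.
  move: (reach k) (reach_gt0 k) => n n0.
  have -> : 3 * n%:R = (3 * n)%:R :> R by rewrite natrM.
  by rewrite ler_nat; clear -n0; lia.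
rewrite -!mulrA ler_wpM2l ?(ltW lambda_gt0)//.
rewrite mulrA ler_pdivlMr ?powR_gt0// mulrC ler_pdivrMr ?powR_gt0//.
apply: (@le_trans _ _ ((3 * d%:R * expR (mu * b ^+ k)) `^ alpha)).
  by apply: ge0_ler_powR; rewrite ?nnegrE ?(ltW alpha_gt0) ?(ltW D0) ?mulr_ge0 ?expR_ge0.
rewrite powRM ?mulr_ge0 ?expR_ge0// mulrC; apply: ler_wpM2r; first exact: powR_ge0.
rewrite -expRM (_ : mu * b ^+ k * alpha = b ^+ k + b ^+ k.+1); last first.
  rewrite /mu exprS; field; exact: lt0r_neq0.
by rewrite expRD ler_pM ?expR_ge0.
Qed.

(** The actual probability, which exceeds e^(- eta b^k) when L has an atom there;
    [prob_no_good_neighbour] takes the exact value. *)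
Let y_ k : R := fine (cdf L (greedy_length k)).

Let quantile01 k : 0 < expR (- (eta * b ^+ k)) < 1.
Proof. by rewrite expR_gt0 expR_lt1 oppr_lt0 mulr_gt0. Qed.

Let y_E k : Q (L @^-1` `]-oo, greedy_length k]) = (y_ k)%:E.
Proof. by rewrite /y_ fineK // /cdf fin_num_measure. Qed.

Let y_ge k : expR (- (eta * b ^+ k)) <= y_ k.
Proof. by rewrite -lee_fin -y_E; exact: cdf_quantile. Qed.

Let c1 : R := p0 * c0 / 2 ^+ d.

Let c1_gt0 : 0 < c1.
Proof. by rewrite !mulr_gt0 // invr_gt0 exprn_gt0. Qed.

(** About e^(d mu b^k) positions times the tail e^(-sp b^(k+1)) leave e^(2 eta b^k) by [sp_eta], and
    the edge weight uses up one factor e^(eta b^k). The 2^d in [c1] is the rounding in [reach]. *)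
Lemma expected_good_ge k :
  c1 * expR (eta * b ^+ k) <=
    y_ k * p0 * tail_prob (threshold k.+1) * (reach k ^ d)%:R.
Proof.
have tl := tail_lower (ltW (bk_gt0 k.+1)).
apply: (@le_trans _ _ (expR (- (eta * b ^+ k)) * p0 * (c0 * expR (- (sp * b ^+ k.+1))) *
    (expR (mu * b ^+ k) / 2) ^+ d)); last first.
  apply: ler_pM; rewrite ?mulr_ge0 ?expR_ge0 ?exprn_ge0 ?mulr_ge0 ?expR_ge0 ?(ltW c0_gt0) ?(ltW p0_gt0)//.
    apply: ler_pM; rewrite ?mulr_ge0 ?expR_ge0 ?(ltW c0_gt0) ?(ltW p0_gt0)//.
    by apply: ler_wpM2r; [exact: ltW|exact: y_ge].
  rewrite natrX; apply: lerXn2r; rewrite ?nnegrE ?divr_ge0 ?expR_ge0//.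
  exact: reach_ge.
rewrite expr_div_n -expRM_natl /c1.
have E (a1 a2 a3 a4 a5 a6 : R) : a1 * a2 * (a3 * a4) * (a5 / a6) = a2 * a3 / a6 * (a1 * a4 * a5).
  by ring.
rewrite E; apply: ler_wpM2l; first exact: ltW.
rewrite -!expRD ler_expR exprS.
have := ler_wpM2r (ltW (bk_gt0 k)) sp_eta; rewrite -/mu; lra.
Qed.

Definition greedy_failure k : set T :=
  [set w | exists2 v, v \in cube x 0 (box_size k) &
    (ww v @^-1` `[threshold k, +oo[ `&` \bigcap_(u in [set` cube v 2 (reach k)])
       ~` good_neighbour G (threshold k.+1) `]-oo, greedy_length k] v u) w].

Let E_ : R := d%:R * (2 / (b - 1) + mu).

Let failure_bound k : R := expR (E_ * b ^+ k - c1 * expR (eta * b ^+ k)).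

Let E_ge0 : 0 <= E_.
Proof.
rewrite mulr_ge0 // addr_ge0 //; last exact: ltW.
by rewrite divr_ge0 // subr_ge0 ltW.
Qed.

Lemma greedy_failure_covered k : covered P (greedy_failure k) (failure_bound k).
Proof.
apply: (@covered_le _ _ _ _ _ ((size (cube x 0 (box_size k)))%:R *
    expR (- (c1 * expR (eta * b ^+ k))))).
  rewrite size_cube /failure_bound expRD; apply: ler_wpM2r; first exact: expR_ge0.
  rewrite natrX /E_ -mulrA expRM_natl; apply: lerXn2r; rewrite ?nnegrE ?expR_ge0//.
  exact: box_size_le.
apply: covered_seq => [|v vx]; first exact: expR_ge0.
apply: covered_measurable.
  apply: measurableI; first exact: measurable_RV_preimage.
  rewrite bigcap_seq; apply: (big_ind measurable) => //; first exact: measurableI.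
  move=> u _; apply: measurableC; apply: measurableI; last exact: measurable_RV_preimage.
  apply: measurableI; last exact: measurable_edge.
  exact: measurable_RV_preimage.
apply: le_trans (_ : _ <= (expR (- (y_ k * p0 * tail_prob (threshold k.+1) *
    (size (cube v 2 (reach k)))%:R)))%:E)%E _; last first.
  by rewrite lee_fin ler_expR lerN2 size_cube expected_good_ge.
apply: prob_no_good_neighbour => //.
- exact: expR_ge0.
- exact: expR_ge0.
- by rewrite (ltW p0_gt0) p0_le1.
- exact: cube_uniq.
- by apply/negP => /(cube_far (R := R) d_gt0 (o := 2) isT); rewrite euclidean_distxx ltr10.
- by move=> u; exact: cube_far.
- by move=> u w uv wv wu; exact: conn_cube_ge uv wv wu.
Qed.

(** Taken at generation k + 1 to reuse [expected_good_ge] at k: this box has at least as many points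
    as the cube there, and the two remaining factors are at most 1. *)
Definition start_failure k : set T :=
  \bigcap_(u in [set` cube x 0 (box_size k.+1)]) ww u @^-1` `]-oo, threshold k.+1[.

Lemma start_failure_covered k : covered P (start_failure k) (failure_bound k).
Proof.
apply: covered_measurable.
  rewrite /start_failure bigcap_seq; apply: (big_ind measurable) => //.
    exact: measurableI.
  by move=> u _; exact: measurable_RV_preimage.
apply: le_trans (prob_no_weight_ge G _ (cube_uniq _ _ _)) _.
rewrite lee_fin ler_expR size_cube.
have h0 : 0 <= tail_prob (threshold k.+1) by case/andP: (@tail_prob01 R _ _ Q W (threshold k.+1)).
have y01 : 0 <= y_ k <= 1.
  rewrite -!lee_fin -y_E measure_ge0 /=; apply: probability_le1.
  exact: measurable_RV_preimage.
have le1 : c1 * expR (eta * b ^+ k) <= tail_prob (threshold k.+1) * (box_size k.+1 ^ d)%:R.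
  apply: le_trans (expected_good_ge k) _; apply: ler_pM => //.
  - by case/andP: y01 => ? ?; rewrite !mulr_ge0 ?(ltW p0_gt0).
  - case/andP: y01 => ? ?; rewrite ler_piMl // mulr_ile1 ?(ltW p0_gt0)//.
  - by rewrite ler_nat leq_exp2r // box_sizeS addnC; apply: leq_trans (leq_addr _ _); exact: leqnSn.
have : 0 <= E_ * b ^+ k by rewrite mulr_ge0 // ltW.
lra.
Qed.

Lemma failure_bound_summable : exists C, forall k, failure_bound k <= C / 2 ^+ k.
Proof.
have [C C0 HC] := @geometric_expR_bound R 1 b ler01 b_gt1.
(* With X = b^k, e^(eta X) >= 1 + (eta X)^2 / 2. [A] is the maximum of (E_ + 1) X - c1 eta^2 X^2 /
   2, so the exponent is at most A - X. *)
pose A := (E_ + 1) ^+ 2 / (2 * (c1 * eta ^+ 2)).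
exists (expR A * C) => k; rewrite -mulrA.
apply: le_trans (ler_wpM2l (expR_ge0 A) (HC k)); rewrite expr1n mul1r -expRD ler_expR.
set X := b ^+ k.
have X0 : 0 <= eta * X by apply: mulr_ge0; apply: ltW; rewrite ?bk_gt0.
have := expR_ge1Dxn 1 X0; rewrite (_ : 2`!%:R = 2) // => H.
have ce0 : 0 < c1 * eta ^+ 2 by rewrite mulr_gt0 // exprn_gt0.
have AX : (E_ + 1) * X <= A + c1 * eta ^+ 2 * X ^+ 2 / 2.
  rewrite -subr_ge0 (_ : _ - _ = (E_ + 1 - c1 * eta ^+ 2 * X) ^+ 2 / (2 * (c1 * eta ^+ 2))).
    by rewrite divr_ge0 ?sqr_ge0 // mulr_ge0 // ltW.
  rewrite /A; field.
  by rewrite !gt_eqF.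
have H' : c1 * eta ^+ 2 * X ^+ 2 / 2 <= c1 * expR (eta * X).
  apply: le_trans (ler_wpM2l (ltW c1_gt0) H); rewrite exprMn.
  have E (a1 a2 a3 : R) : a1 * a2 * a3 / 2 = a1 * (a2 * a3 / 2) by ring.
  by rewrite E; apply: ler_wpM2l; [exact: ltW|rewrite lerDr].
move: AX H'; move: (c1 * expR _) (c1 * _ * _ / _) A => Y Z A'; lra.
Qed.

Lemma ae_greedy_path : {ae P, forall w, exists K (v : nat -> Zd), forall k, (K <= k)%N ->
  [/\ threshold k <= ww (v k) w, adj w (v k) (v k.+1) &
      edge_weight G (v k) (v k.+1) w <= greedy_length k]}.
Proof.
have [C HC] := failure_bound_summable.
have H1 : {ae P, forall w, exists K, forall k, (K <= k)%N -> ~ greedy_failure k w}.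
  apply: (@borel_cantelli_geometric _ _ _ _ _ C 0) => k _.
  exact: (covered_le (HC k) (greedy_failure_covered k)).
have H2 : {ae P, forall w, exists K, forall k, (K <= k)%N -> ~ start_failure k w}.
  apply: (@borel_cantelli_geometric _ _ _ _ _ C 0) => k _.
  exact: (covered_le (HC k) (start_failure_covered k)).
apply: filterS2 H1 H2 => w [K1 HK1] [K2 HK2].
(* The successor is there because [start_failure k] concerns generation k + 1. *)
pose K := (maxn K1 K2).+1.
pose ok k v := v \in cube x 0 (box_size k) /\ threshold k <= ww v w.
have [v0 v0ok] : exists v, ok K v.
  apply: contrapT => nex; apply: (HK2 (maxn K1 K2) (leq_maxr _ _)) => u /= ux.
  rewrite in_itv /= ltNge; apply/negP => wu; apply: nex; exists u; split => //.
(* Made total in [k] and [v] so that [choice] applies; outside the relevant range any successor will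
   do. *)
have step k v : exists u, (K <= k)%N -> ok k v ->
    [/\ ok k.+1 u, adj w v u & edge_weight G v u w <= greedy_length k].
  have [Kk|kK] := leqP K k; last by exists v.
  have [[vx wv]|nok] := pselect (ok k v); last by exists v => _ /nok.
  apply: contrapT => nex; apply: (HK1 k).
    by apply: leq_trans Kk; rewrite /K leqW // leq_maxl.
  exists v => //; split; first by rewrite /= in_itv /= wv.
  move=> u /= uv [[wu vu] luv]; apply: nex; exists u => _ _; split.
  - split; last by move: wu; rewrite /= in_itv /= andbT.
    by apply: (cube_trans vx uv); rewrite box_sizeS addn2 addnS.
  - exact/asboolP.
  - by move: luv; rewrite /= in_itv.
have [next nextP] := choice (fun kv : nat * Zd => step kv.1 kv.2).
pose f := fix f n := if n is n'.+1 then next ((K + n')%N, f n') else v0.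
have fok n : ok (K + n)%N (f n).
  elim: n => [|n IH]; first by rewrite addn0.
  by rewrite addnS /=; case: (nextP ((K + n)%N, f n) (leq_addr _ _) IH).
exists K, (fun k => f (k - K)%N) => k Kk.
have okk : ok k (f (k - K)%N) by have := fok (k - K)%N; rewrite subnKC.
rewrite subSn //=.
have := nextP ((K + (k - K))%N, f (k - K)%N) (leq_addr _ _); rewrite /= subnKC //.
by move=> /(_ okk)[_ ? ?]; case: okk.
Qed.

End greedy.

(** * Comparison of sums and integrals *)

Section integral_test.
Context {R : realType}.
Variable g : R -> R.
Hypothesis g_ge0 : forall y, 0 <= g y.
Hypothesis g_noninc : {homo g : y z / y <= z >-> z <= y}.
Variable h : R.
Hypothesis h_gt0 : 0 < h.

Let cell k : set R := `[k%:R * h, k.+1%:R * h[.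

Let cell_bigcup : `[0, +oo[%classic = \bigcup_k cell k.
Proof.
apply/seteqP; split => [y|y [k _]] /=; rewrite /cell /= !in_itv /= ?andbT; last first.
  by move=> /andP[+ _]; apply: le_trans; rewrite mulr_ge0 // ltW.
move=> y0; exists (Num.truncn (y / h)) => //=; rewrite in_itv /=.
have /andP[? ?] := truncn_itv (divr_ge0 y0 (ltW h_gt0)).
by rewrite -ler_pdivlMr // -ltr_pdivrMr //; apply/andP.
Qed.

Let cell_trivIset : trivIset setT cell.
Proof.
apply/trivIsetP => i j _ _.
wlog ij : i j / (i < j)%N.
  move=> W nij; have [ij|ji|ij] := ltngtP i j; first exact: W.
    by rewrite setIC; apply: W => //; rewrite eq_sym.
  by rewrite ij eqxx in nij.
move=> _; apply/seteqP; split => // y [] /=; rewrite /cell /= !in_itv /= => /andP[_ y1] /andP[y2 _].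
have := le_lt_trans y2 y1; rewrite ltr_pM2r // ltr_nat ltnS leqNgt.
by move=> /negP; apply.
Qed.

Let measurable_g D : measurable D -> measurable_fun D (fun y => (g y)%:E).
Proof. by move=> mD; apply/measurable_EFinP; exact: nonincreasing_measurable. Qed.

Let cell_measure k : lebesgue_measure (cell k) = h%:E.
Proof.
rewrite /cell lebesgue_measure_itv /= lte_fin ltr_pM2r // ltr_nat ltnSn.
by rewrite -EFinD -mulrBl -natrB // subSnn mul1r.
Qed.

Let cell_integral_ge k :
  ((h * g (k.+1%:R * h))%:E <= \int[lebesgue_measure]_(y in cell k) (g y)%:E)%E.
Proof.
rewrite mulrC EFinM -(cell_measure k) -integral_cst; last exact: measurable_itv.
apply: ge0_le_integral => //; first exact: measurable_itv.
- by move=> y _; rewrite /= lee_fin.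
- by apply: measurable_g; exact: measurable_itv.
- by move=> y; rewrite /cell /= in_itv /= => /andP[_ /ltW yk]; rewrite lee_fin; exact: g_noninc.
Qed.

Let cell_integral_le k :
  (\int[lebesgue_measure]_(y in cell k) (g y)%:E <= (h * g (k%:R * h))%:E)%E.
Proof.
rewrite mulrC EFinM -(cell_measure k) -integral_cst; last exact: measurable_itv.
apply: ge0_le_integral => //; first exact: measurable_itv.
- by move=> y _; rewrite lee_fin.
- by apply: measurable_g; exact: measurable_itv.
- by move=> y; rewrite /cell /= in_itv /= => /andP[yk _]; rewrite lee_fin; exact: g_noninc.
Qed.

Let integral_cells : (\int[lebesgue_measure]_(y in `[0%R, +oo[) (g y)%:E =
  \sum_(0 <= k <oo) \int[lebesgue_measure]_(y in cell k) (g y)%:E)%E.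
Proof.
rewrite cell_bigcup ge0_integral_bigcup //.
- by move=> k; exact: measurable_itv.
- by apply: measurable_g; apply: bigcupT_measurable => k; exact: measurable_itv.
- by move=> y _; rewrite lee_fin.
Qed.

Lemma integral_test_sum_le :
  (\int[lebesgue_measure]_(y in `[0%R, +oo[) (g y)%:E < +oo)%E ->
  exists B, forall N, \sum_(0 <= k < N) g (k.+1%:R * h) <= B.
Proof.
set J := (\int[_]_(_ in _) _)%E => Joo.
have J0 : (0 <= J)%E by apply: integral_ge0 => y _; rewrite lee_fin.
exists (fine J / h) => N; rewrite ler_pdivlMr // mulrC mulr_sumr.
rewrite -lee_fin fineK ?ge0_fin_numE// /J integral_cells.
apply: (@le_trans _ _ (\sum_(0 <= k < N) \int[lebesgue_measure]_(y in cell k) (g y)%:E)%E).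
  by rewrite -sumEFin; apply: lee_sum => k _; exact: cell_integral_ge.
apply: nneseries_lim_ge => k _ _; apply: integral_ge0 => y _; by rewrite lee_fin.
Qed.

Lemma sum_le_integral_test B : (forall N, \sum_(0 <= k < N) g (k.+1%:R * h) <= B) ->
  (\int[lebesgue_measure]_(y in `[0%R, +oo[) (g y)%:E < +oo)%E.
Proof.
move=> gB; rewrite integral_cells.
(* The first cell is bounded by g 0, which the sum does not contain. *)
apply: (@le_lt_trans _ _ (h * (g 0 + B))%:E); last by rewrite ltry.
apply: nneseries_le_bound => [k|N].
  by apply: integral_ge0 => y _; rewrite lee_fin.
apply: (@le_trans _ _ (\sum_(0 <= k < N) (h * g (k%:R * h)))%:E).
  by rewrite -sumEFin; apply: lee_sum => k _; exact: cell_integral_le.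
rewrite lee_fin -mulr_sumr ler_wpM2l ?(ltW h_gt0)//.
case: N => [|N]; first by rewrite big_geq // addr_ge0 //; have := gB 0%N; rewrite big_geq.
by rewrite big_nat_recl //= mul0r lerD2l.
Qed.

End integral_test.

(* Sampling a nonincreasing function at two commensurable scales: group the
   finer sequence i |-> g i into blocks of length m. *)
Section blocks.
Context {R : realType}.
Variable g : nat -> R.
Hypothesis g_noninc : {homo g : i j / (i <= j)%N >-> j <= i}.

Lemma block_sum_le m p q : (p <= q)%N ->
  \sum_(p * m <= i < q * m) g i <= m%:R * \sum_(p <= k < q) g (k * m)%N.
Proof.
elim: q => [|q IH].
  by rewrite leqn0 => /eqP->; rewrite !big_geq // mulr0.
rewrite leq_eqVlt => /orP[/eqP->|]; first by rewrite !big_geq // mulr0.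
rewrite ltnS => pq; rewrite (big_cat_nat (n := q * m)) ?leq_mul2r ?pq ?leqnSn ?orbT//=.
rewrite [X in _ <= _ * X]big_nat_recr //= mulrDr; apply: lerD; first exact: IH.
apply: (@le_trans _ _ (\sum_(q * m <= i < q.+1 * m) g (q * m)%N)).
  by apply: ler_sum_nat => i /andP[qi _]; exact: g_noninc.
by rewrite sumr_const_nat mulSn addnK mulr_natl.
Qed.

Lemma block_sum_ge m p q : (p <= q)%N ->
  m%:R * \sum_(p <= k < q) g (k.+1 * m)%N <= \sum_(p * m <= i < q * m) g i.
Proof.
elim: q => [|q IH].
  by rewrite leqn0 => /eqP->; rewrite !big_geq // mulr0.
rewrite leq_eqVlt => /orP[/eqP->|]; first by rewrite !big_geq // mulr0.
rewrite ltnS => pq; rewrite [leRHS](big_cat_nat (n := q * m)) ?leq_mul2r ?pq ?leqnSn ?orbT//=.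
rewrite big_nat_recr //= mulrDr; apply: lerD; first exact: IH.
apply: (@le_trans _ _ (\sum_(q * m <= i < q.+1 * m) g (q.+1 * m)%N)); last first.
  by apply: ler_sum_nat => i /andP[_ /ltnW qi]; exact: g_noninc.
by rewrite sumr_const_nat mulSn addnK mulr_natl.
Qed.

End blocks.

(** * Transfer between nearby sampling scales *)

Section sampling.
Context {R : realType}.
Variables (f : R -> R) (kappa : R) (N : nat).
Hypothesis f_ge0 : forall y, 0 <= f y.
Hypothesis f_noninc : {homo f : y z / y <= z >-> z <= y}.
Hypothesis kappa_gt0 : 0 < kappa.
Hypothesis N_gt0 : (0 < N)%N.

Lemma linear_eventually_ge (delta c : R) : 0 < delta ->
  exists K : nat, forall k : nat, (K <= k)%N -> c <= delta * k%:R.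
Proof.
move=> d0; exists (Num.bound (`|c| / delta)) => k Kk.
have H : `|c| / delta < k%:R.
  apply: (@lt_le_trans _ _ (Num.bound (`|c| / delta))%:R); last by rewrite ler_nat.
  by apply: archi_boundP; rewrite divr_ge0 // ltW.
move: H; rewrite ltr_pdivrMr // mulrC => /ltW; apply: le_trans.
exact: ler_norm.
Qed.

(* Small enough that 1 + slack < (N + 1) / N, 1 - slack > N / (N + 1) and
   (1 + slack) / (1 - slack) < (N + 1) / N. *)
Definition scale_slack : R := (4 * N%:R + 2)^-1.

Let N0 : 0 < N%:R :> R. Proof. by rewrite ltr0n. Qed.

Let slack_gt0 : 0 < scale_slack.
Proof. by rewrite invr_gt0 addr_gt0 // mulr_gt0. Qed.

Let sample_noninc (delta : R) : 0 <= delta ->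
  {homo (fun i : nat => f (i%:R * delta)) : i j / (i <= j)%N >-> j <= i}.
Proof. by move=> d0 i j ij; apply: f_noninc; rewrite ler_wpM2r // ler_nat. Qed.

Let sumf_ge0 (P : pred nat) (a b : nat) (g : nat -> R) :
  0 <= \sum_(a <= k < b | P k) f (g k).
Proof. by apply: sumr_ge0. Qed.

(** Uses the grid of mesh kappa / N. Its multiples of N are the points k kappa, and its multiples of
    N + 1 eventually lie beyond k kappa (1 + slack) + c because slack < 1/N; the two block
    comparisons give the factors N and N + 1. *)
Lemma faster_sample_sum_ge (K : nat) (c : R) : exists C a, forall n, (a <= n)%N ->
  N%:R * \sum_(1 <= k < n.+1) f (k%:R * kappa) - C <=
  (N%:R + 1) * \sum_(K <= k < n.+1) f (k%:R * (kappa * (1 + scale_slack)) + c).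
Proof.
have d0 : 0 < kappa * (N%:R^-1 - scale_slack).
  by rewrite mulr_gt0 // subr_gt0 ltf_pV2 ?posrE //; move: N0; lra.
have [K1 HK1] := linear_eventually_ge c d0.
pose K' := maxn K K1; pose a := (K' * N.+1)%N; pose g i := f (i%:R * (kappa / N%:R)).
have g_noninc : {homo g : i j / (i <= j)%N >-> j <= i}.
  by apply: sample_noninc; rewrite divr_ge0 // ltW.
exists (N%:R * \sum_(1 <= k < a.+1) f (k%:R * kappa)), a => n an.
have K'a : (K' <= a)%N by rewrite /a leq_pmulr.
have K'n : (K' <= n.+1)%N by rewrite (leq_trans K'a) // (leq_trans an).
have -> : \sum_(1 <= k < n.+1) f (k%:R * kappa) =
    \sum_(1 <= k < a.+1) f (k%:R * kappa) + \sum_(a <= k < n) g (k.+1 * N)%N.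
  rewrite [LHS](big_cat_nat (n := a.+1)) //=; congr (_ + _); rewrite big_add1 /=.
  by apply: eq_bigr => k _; congr f; rewrite natrM; field; rewrite gt_eqF.
rewrite mulrDr addrC addKr.
apply: le_trans (block_sum_ge g_noninc N an) _.
have h1 : \sum_(a * N <= i < n * N) g i <= \sum_(K' * N.+1 <= i < n.+1 * N.+1) g i.
  have le1 : (K' * N.+1 <= a * N)%N by rewrite /a leq_pmulr.
  have le2 : (a * N <= n * N)%N by rewrite leq_mul2r an orbT.
  have le3 : (n * N <= n.+1 * N.+1)%N by rewrite leq_mul.
  rewrite [leRHS](big_cat_nat (n := (a * N)%N)) ?(leq_trans le2)//=.
  rewrite [X in _ <= _ + X](big_cat_nat (n := (n * N)%N)) //=.
  rewrite addrCA lerDl addr_ge0 //; exact: sumf_ge0.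
apply: (le_trans h1); apply: le_trans (block_sum_le g_noninc N.+1 K'n) _.
rewrite natr1; apply: ler_wpM2l => //.
apply: (@le_trans _ _ (\sum_(K' <= k < n.+1) f (k%:R * (kappa * (1 + scale_slack)) + c))).
  apply: ler_sum_nat => k /andP[Kk _]; apply: f_noninc.
  have := HK1 k (leq_trans (leq_maxr _ _) Kk).
  have -> : (k * N.+1)%:R * (kappa / N%:R) = k%:R * kappa * (1 + N%:R^-1).
    by rewrite natrM -natr1; field; rewrite gt_eqF.
  lra.
rewrite [leRHS](big_cat_nat (n := K')) ?leq_maxl//= lerDr; exact: sumf_ge0.
Qed.

(** Mirror image on the grid of mesh kappa / (N + 1), whose multiples of N eventually lie before k
    kappa (1 - slack) + c. The condition on [m] and [n] keeps the slower blocks within the range of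
    the others. *)
Lemma slower_sample_sum_le (K : nat) (c : R) : exists2 C, 0 <= C & forall m n,
  (m * N <= n.+1 * N.+1)%N ->
  N%:R * \sum_(K <= k < m) f (k%:R * (kappa * (1 - scale_slack)) + c) <=
  C + (N%:R + 1) * \sum_(1 <= k < n.+1) f (k%:R * kappa).
Proof.
have d0 : 0 < kappa * (1 - scale_slack - N%:R / (N%:R + 1)).
  rewrite mulr_gt0 //.
  have -> : 1 - scale_slack - N%:R / (N%:R + 1) = (N%:R + 1)^-1 - scale_slack.
    by field; rewrite gt_eqF // addr_gt0.
  by rewrite subr_gt0 ltf_pV2 ?posrE //; move: N0; lra.
have [K1 HK1] := linear_eventually_ge (- c) d0.
pose p := maxn K K1; pose g i := f (i%:R * (kappa / (N%:R + 1))).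
have g_noninc : {homo g : i j / (i <= j)%N >-> j <= i}.
  by apply: sample_noninc; rewrite divr_ge0 ?addr_ge0 // ltW.
pose F k := f (k%:R * (kappa * (1 - scale_slack)) + c).
pose C1 := \sum_(K <= k < p.+1) F k.
have C10 : 0 <= C1 by exact: sumf_ge0.
exists (N%:R * C1 + (N%:R + 1) * f 0) => [|m n mn].
  by rewrite addr_ge0 // mulr_ge0 // addr_ge0.
have S0 : 0 <= \sum_(1 <= k < n.+1) f (k%:R * kappa) by exact: sumf_ge0.
have [mp|pm] := leqP m p.+1.
  apply: (@le_trans _ _ (N%:R * C1)).
    apply: ler_wpM2l => //; rewrite /C1; have [Km|mK] := leqP K m.
      rewrite [leRHS](big_cat_nat (n := m)) //= lerDl; exact: sumf_ge0.
    by rewrite big_geq ?sumf_ge0 // ltnW.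
  by rewrite -addrA lerDl addr_ge0 // mulr_ge0 // addr_ge0.
rewrite (big_cat_nat (n := p.+1)) //=; last 2 first.
- by rewrite leqW // leq_maxl.
- exact: ltnW.
rewrite mulrDr -!addrA; apply: lerD; first by [].
case: m pm mn => [//|q]; rewrite ltnS => pq mn.
have -> : (N%:R + 1) * f 0 + (N%:R + 1) * \sum_(1 <= k < n.+1) f (k%:R * kappa) =
    N.+1%:R * \sum_(0 <= k < n.+1) g (k * N.+1)%N.
  rewrite -mulrDr natr1; congr (_ * _); rewrite [RHS]big_ltn // mul0n /g mul0r; congr (_ + _).
  apply: eq_bigr => k _; congr f; rewrite natrM -natr1; field.
  by rewrite gt_eqF // addr_gt0.
apply: le_trans (block_sum_le g_noninc N.+1 (leq0n _)).
apply: (@le_trans _ _ (N%:R * \sum_(p <= k < q) g (k.+1 * N)%N)).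
  apply: ler_wpM2l => //; rewrite big_add1 /=; apply: ler_sum_nat => k /andP[pk _].
  apply: f_noninc.
  have := HK1 k.+1 (leq_trans (leq_maxr _ _) (leqW pk)).
  have -> : (k.+1 * N)%:R * (kappa / (N%:R + 1)) = k.+1%:R * kappa * (N%:R / (N%:R + 1)).
    by rewrite natrM; field; rewrite gt_eqF // addr_gt0.
  lra.
apply: le_trans (block_sum_ge g_noninc N (ltnW pq)) _.
have qn : (q * N <= n.+1 * N.+1)%N by apply: leq_trans mn; rewrite leq_mul2r leqnSn orbT.
rewrite mul0n [leRHS](big_cat_nat (n := (p * N)%N)) //=; last first.
  by apply: leq_trans qn; rewrite leq_mul2r (ltnW pq) orbT.
rewrite [X in _ <= _ + X](big_cat_nat (n := (q * N)%N)) ?leq_mul2r ?(ltnW pq) ?orbT//=.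
rewrite addrCA lerDl addr_ge0 //; exact: sumf_ge0.
Qed.

(** This places a greedy vertex outside the graph ball of radius [n] while the greedy path uses only
    about n (N + 1) / N edges. *)
Lemma slower_overtakes (A : R) : 0 <= A -> exists n0, forall n, (n0 <= n)%N ->
  A * expR (kappa * (1 + scale_slack)) ^+ n + 1 <
  expR (kappa * (1 - scale_slack)) ^+ ((n.+1 * N.+1) %/ N).
Proof.
(* The slack s solves N (1 + s) + 1/2 = (N + 1) (1 - s), so n (N + 1) / N slower steps exceed n
   faster ones by exactly kappa n / (2 N) in the exponent. *)
move=> A0; have d0 : 0 < kappa / (2 * N%:R) by rewrite divr_gt0 // mulr_gt0.
have [n0 Hn0] := linear_eventually_ge (ln (A + 2)) d0.
exists n0 => n nn; set m := (_ %/ N)%N.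
have A2 : 0 < A + 2 by rewrite ltr_wpDl.
have mN : (n%:R : R) * (N%:R + 1) <= m%:R * N%:R.
  rewrite natr1 -!natrM ler_nat.
  have := divn_eq (n.+1 * N.+1) N; have := ltn_pmod (n.+1 * N.+1) N_gt0; rewrite -/m.
  move: (_ %% _)%N => r rN; rewrite mulSn => E.
  by rewrite -(leq_add2r r) -E addnC leq_add2r ltnW // ltnW.
rewrite -!expRM_natl.
have e1 : 1 <= expR (n%:R * (kappa * (1 + scale_slack))).
  rewrite leNgt expR_lt1 -leNgt !mulr_ge0 ?(ltW kappa_gt0)//.
  by rewrite addr_ge0 // ltW.
have le : expR (n%:R * (kappa * (1 + scale_slack))) * (A + 2) <=
    expR (m%:R * (kappa * (1 - scale_slack))).
  rewrite -[A + 2]lnK ?posrE // -expRD ler_expR.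
  apply: le_trans (lerD (lexx _) (Hn0 n nn)) _.
  rewrite -(ler_pM2r N0).
  have -> : (n%:R * (kappa * (1 + scale_slack)) + kappa / (2 * N%:R) * n%:R) * N%:R =
     n%:R * (N%:R + 1) * (kappa * (1 - scale_slack)).
    have P4 : 0 < 4 * N%:R + 2 :> R by rewrite addr_gt0 // mulr_gt0.
    rewrite /scale_slack; field.
    by rewrite !gt_eqF // addr_gt0 // mulr_gt0.
  rewrite [leRHS]mulrAC; apply: ler_wpM2r => //.
  apply: mulr_ge0; first exact: ltW.
  rewrite subr_ge0 /scale_slack invf_le1; first by move: N0; lra.
  by rewrite addr_gt0 // mulr_gt0.
by lra.
Qed.

End sampling.

(** * Measurability and connectivity *)

(** The value +oo outside [D i] turns an infimum over a random index set into one over all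
    indices. *)
Lemma measurable_ereal_inf_countable {R : realType} {dT : measure_display}
    {T : measurableType dT} (I : countType) (D : I -> set T) (f : I -> T -> \bar R) :
  (forall i, measurable (D i)) -> (forall i, measurable_fun setT (f i)) ->
  measurable_fun setT (fun w => ereal_inf [set f i w | i in [set i | D i w]]).
Proof.
move=> mD mf.
pose g n w := if @pickle_inv I n is Some i then (if w \in D i then f i w else +oo%E) else +oo%E.
have -> : (fun w => ereal_inf [set f i w | i in [set i | D i w]]) =
    (fun w => einfs (g ^~ w) 0).
  apply/funext => w; apply/eqP; rewrite eq_le; apply/andP; split.
    apply/ereal_infP => _ [n _ <-]; rewrite /g; case: pickle_inv => [i|]; last exact: leey.
    case: ifP => [|_]; last exact: leey.
    by rewrite inE => Di; apply: ereal_inf_lbound; exists i.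
  apply/ereal_infP => _ [i Di <-]; apply: ereal_inf_lbound; exists (pickle i) => //.
  by rewrite /g pickleK_inv mem_set.
apply: measurable_fun_einfs => n; rewrite /g; case: pickle_inv => [i|]; last exact: measurable_cst.
apply: measurable_fun_ifT => //.
apply: (measurable_fun_bool true); rewrite setTI.
by rewrite (_ : _ @^-1` _ = D i) //; apply/seteqP; split => w /=; [exact: set_mem|exact: mem_set].
Qed.

Section measurability.
Context {R : realType} {d : nat} {lambda alpha : R}.
Context {dS : measure_display} {S : measurableType dS} {Q : probability S R}.
Context {W L : {RV Q >-> R}}.
Context {dT : measure_display} {T : measurableType dT} {P : probability T R}.
Variable G : @weighted_sfp R d lambda alpha dS S Q W L dT T P.
Local Notation Zd := 'rV[int]_d.
Local Notation adj := (sfp_adj G).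

Lemma measurable_is_path (x y : Zd) p : measurable [set w | is_path (adj w) x y p].
Proof.
have H u : measurable [set w | path (adj w) u p].
  elim: p u => [|v p IH] u /=.
    by rewrite (_ : [set w | _] = setT) //; apply/seteqP; split.
  rewrite (_ : [set w | _] = edge G u v `&` [set w | path (adj w) v p]).
    by apply: measurableI => //; exact: measurable_edge.
  apply/seteqP; split => w /=.
    by move=> /andP[/asboolP].
  by move=> [uv ->]; rewrite andbT; exact/asboolP.
rewrite /is_path; case: eqP => _.
  by rewrite (_ : [set w | _] = [set w | path (adj w) x p]) //; apply/seteqP; split => w /=; rewrite andbT.
by rewrite (_ : [set w | _] = set0) //; apply/seteqP; split => w //=; rewrite andbF.
Qed.

Lemma measurable_path_length (x : Zd) p :
  measurable_fun setT (fun w => path_length (sfp_len G w) x p).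
Proof.
elim: p x => [|y p IH] x.
  by under eq_fun do rewrite path_length_nil; exact: measurable_cst.
by under eq_fun do rewrite path_length_cons; exact: measurable_funD.
Qed.

Lemma measurable_dL (x y : Zd) : measurable_fun setT (fun w => dL (adj w) (sfp_len G w) x y).
Proof.
apply: (@measurable_ereal_inf_countable _ _ _ (seq Zd)) => p; first exact: measurable_is_path.
by apply/measurable_EFinP; exact: measurable_path_length.
Qed.

Lemma measurable_ballG (x y : Zd) (r : R) : measurable [set w | ballG (adj w) r x y].
Proof.
have mdG : measurable_fun setT (fun w => @dG R _ (adj w) x y).
  apply: (@measurable_ereal_inf_countable _ _ _ (seq Zd)) => p; first exact: measurable_is_path.
  exact: measurable_cst.
rewrite -[X in measurable X]setTI.
exact: (emeasurable_fun_infty_c measurableT mdG).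
Qed.

Lemma measurable_M n (x : Zd) : measurable_fun setT (M_ G n x).
Proof.
apply: (@measurable_ereal_inf_countable _ _ _ Zd) => y; last exact: measurable_dL.
apply: measurableI; first exact: measurable_ballG.
by apply: measurableC; exact: measurable_ballG.
Qed.

(** The limit variable of the explosive part; as a supremum it is defined and measurable
    everywhere. *)
Definition explosion_time (x : Zd) (w : T) : \bar R := ereal_sup (range (fun n => M_ G n x w)).

Lemma measurable_explosion_time x : measurable_fun setT (explosion_time x).
Proof.
have -> : explosion_time x = (fun w => esups (fun n => M_ G n x w) 0).
  apply/funext => w; rewrite /explosion_time /esups /sdrop; congr ereal_sup.
  by apply/seteqP; split => y [n _ <-]; exists n.
by apply: measurable_fun_esups => n; exact: measurable_M.
Qed.

HB.instance Definition _ x :=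
  isMeasurableFun.Build _ _ _ _ (explosion_time x) (measurable_explosion_time x).

Definition explosion_time_RV x : {RV P >-> \bar R} := explosion_time x.

End measurability.

Section connectivity.
Context {R : realType} {d : nat} {lambda alpha : R}.
Context {dS : measure_display} {S : measurableType dS} {Q : probability S R}.
Context {W L : {RV Q >-> R}}.
Context {dT : measure_display} {T : measurableType dT} {P : probability T R}.
Variable G : @weighted_sfp R d lambda alpha dS S Q W L dT T P.
Local Notation Zd := 'rV[int]_d.

(** Each unit step towards [y] decreases the l^1 distance, and nearest neighbours are joined in
    every configuration. *)
Lemma lattice_connected w (x y : Zd) : exists p, is_path (sfp_adj G w) x y p.
Proof.
have [n] : exists n, (\sum_(i < d) absz (x 0 i - y 0 i)%R <= n)%N by eexists.
elim: n x => [|n IH] x.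
  rewrite leqn0 sum_nat_eq0 => /forallP xy; exists [::]; rewrite /is_path /=.
  by apply/eqP/rowP => i; have := xy i; rewrite implyTb absz_eq0 subr_eq0 => /eqP.
have [->|xy] := eqVneq x y; first by exists [::]; rewrite /is_path /= eqxx.
have [i xyi] : exists i, x 0 i != y 0 i.
  apply/existsP; rewrite -negb_forall; apply: contra xy => /forallP xy.
  by apply/eqP/rowP => i; apply/eqP.
pose e : int := if x 0 i < y 0 i then 1 else -1.
pose z := \row_j (x 0 j + (if j == i then e else 0)) : Zd.
rewrite (bigD1 i) //= => le.
have [|p zp] := IH z.
  rewrite (bigD1 i) //= (eq_bigr (fun j => absz (x 0 j - y 0 j)%R)); last first.
    by move=> j /negbTE ji; rewrite !mxE ji addr0.
  have : (absz (z 0 i - y 0 i)%R < absz (x 0 i - y 0 i)%R)%N.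
    rewrite !mxE eqxx /e; case: ltP; move: xyi; lia.
  move: le; set s := (\sum_(_ < _ | _) _)%N; clearbody s; clear; lia.
exists (z :: p); move: zp; rewrite /is_path /= => /andP[-> ->]; rewrite !andbT.
apply/asboolP; rewrite edge_near //.
rewrite /euclidean_dist (bigD1 i) //= big1 ?addr0; last first.
  by move=> j /negbTE ji; rewrite !mxE ji addr0 subrr expr0n.
rewrite !mxE eqxx opprD addrA subrr sub0r /e.
by case: ifP => _; rewrite ?opprK ?mulrNz ?sqrrN expr1n sqrtr1.
Qed.

End connectivity.

(** * Two-sided bounds on the sphere hitting times *)

Section bounds.
Context {R : realType} {d : nat} {lambda alpha : R}.
Context {dS : measure_display} {S : measurableType dS} {Q : probability S R}.
Context {W L : {RV Q >-> R}}.
Context {dT : measure_display} {T : measurableType dT} {P : probability T R}.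
Variable G : @weighted_sfp R d lambda alpha dS S Q W L dT T P.
Variables (tau gamma : R) (ell : R -> R) (x : 'rV[int]_d).
Hypothesis d_gt0 : (0 < d)%N.
Hypothesis lambda_gt0 : 0 < lambda.
Hypothesis d_alpha : d%:R < alpha.
Hypothesis W_ge1 : Q [set t | 1 <= W t] = 1%E.
Hypothesis tau_gt1 : 1 < tau.
Hypothesis ell_sv : slowly_varying ell.
Hypothesis tailE : forall t : R, 0 < t -> ccdf W t = (ell t / t `^ (tau - 1))%:E.
Hypothesis L_ge0 : Q [set t | 0 <= L t] = 1%E.
Hypothesis gammaE : gamma = alpha * (tau - 1) / d%:R.
Hypothesis gamma12 : 1 < gamma < 2.

Local Notation Zd := 'rV[int]_d.
Local Notation ww := (vertex_weight G).
Local Notation adj := (sfp_adj G).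

Let dR : 0 < d%:R :> R. Proof. by rewrite ltr0n. Qed.
Let alpha_gt0 : 0 < alpha. Proof. exact: lt_trans d_alpha. Qed.
Let theta0 : R := d%:R / alpha.
Let theta0_gt0 : 0 < theta0. Proof. by rewrite divr_gt0. Qed.
Let theta0_lt1 : theta0 < 1. Proof. by rewrite ltr_pdivrMr // mul1r. Qed.

Let tauE : tau - 1 = gamma * theta0.
Proof. by rewrite gammaE /theta0; field; rewrite !gt_eqF. Qed.

(** The kernel sums require theta > d / alpha and the moment bound s < tau - 1. At these two
    endpoints theta < b (s - theta) reads 1 < b (gamma - 1), so a small perturbation [xi] of both
    suffices. *)
Lemma ae_last_edge_lower_bound (b : R) : 1 < b -> 1 < b * (gamma - 1) ->
  {ae P, forall w,
    (exists A : nat, forall vs, path (adj w) x vs -> uniq (x :: vs) ->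
      (level G w (last x vs))%:R <= A%:R * b ^+ size vs) /\
    exists c K, [/\ 0 < c, (0 < K)%N &
    forall vs z, path (adj w) x (rcons vs z) -> uniq (x :: rcons vs z) ->
    (K <= (size vs).+1)%N ->
    quantile L (expR (- (c * b ^+ (size vs).+1))) <= edge_weight G (last x vs) z w]}
  /\ {ae P, forall w, forall v, finite_set [set u | adj w v u]}.
Proof.
move=> b1 bg; have /andP[g1 g2] := gamma12.
have b0 : 0 < b by apply: lt_trans b1.
have den : 0 < 2 * (1 + b * (gamma + 1)).
  by rewrite mulr_gt0 // addr_gt0 // mulr_gt0 // addr_gt0 // (lt_trans _ g1).
(* The first bound keeps theta <= 1, the second keeps theta < b (s - theta). *)
pose xi := Num.min (theta0^-1 - 1) ((b * (gamma - 1) - 1) / (2 * (1 + b * (gamma + 1)))).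
have xi0 : 0 < xi.
  rewrite lt_min subr_gt0 invf_gt1 // theta0_lt1 /=.
  by rewrite divr_gt0 // subr_gt0.
have xi1 : theta0 * (1 + xi) <= 1.
  rewrite mulrC -ler_pdivlMr // mul1r -lerBrDl ge_min lexx //.
have xi2 : xi * (1 + b * (gamma + 1)) < b * (gamma - 1) - 1.
  have : xi <= (b * (gamma - 1) - 1) / (2 * (1 + b * (gamma + 1))) by rewrite ge_min lexx orbT.
  rewrite ler_pdivlMr // => le.
  have : 0 < b * (gamma - 1) - 1 by rewrite subr_gt0.
  lra.
pose theta := theta0 * (1 + xi); pose s := (tau - 1) * (1 - xi).
have sE : s = theta0 * (gamma * (1 - xi)) by rewrite /s tauE; ring.
have theta_gt0 : 0 < theta by rewrite mulr_gt0 // addr_gt0.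
have b_theta : theta < b * (s - theta).
  rewrite sE /theta -mulrBr mulrCA ltr_pM2l //; lra.
have theta_s : theta < s.
  rewrite -subr_gt0 -(pmulr_rgt0 _ b0); exact: lt_trans b_theta.
have s2theta : s <= 2 * theta.
  rewrite sE /theta [leRHS]mulrCA ler_pM2l //.
  have : 0 < xi * gamma by rewrite mulr_gt0 // (lt_trans _ g1).
  lra.
have s_tau : 0 < s < tau - 1.
  rewrite (lt_trans theta_gt0 theta_s) /= /s gtr_pMr ?subr_gt0//; lra.
have [M M_bound] := level_tail_upper ell_sv tailE s_tau.
have d_theta : d%:R < alpha * theta.
  have -> : alpha * theta = d%:R * (1 + xi) by rewrite /theta /theta0; field; rewrite gt_eqF.
  by rewrite ltr_pMr // ltrDl.
have [Z Z_bound] := kernel_sum_le d_gt0 d_theta.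
have theta01 : 0 < theta <= 1 by rewrite theta_gt0.
have theta_s2 : theta < s <= 2 * theta by rewrite theta_s.
split; last first.
  exact: (ae_locally_finite G lambda_gt0 theta01 theta_s2 Z_bound M_bound W_ge1).
apply: filterS2 (ae_level_le G x lambda_gt0 theta01 theta_s2 b1 b_theta Z_bound M_bound W_ge1)
  (ae_last_edge_ge G x lambda_gt0 theta01 theta_s2 b1 b_theta Z_bound M_bound W_ge1 L_ge0).
by move=> w.
Qed.

Lemma ae_greedy_path_ex (b : R) : 1 < b -> b * (gamma - 1) < 1 ->
  exists2 eta, 0 < eta &
  {ae P, forall w, exists K (v : nat -> Zd), forall k, (K <= k)%N ->
  [/\ expR (b ^+ k) <= ww (v k) w, adj w (v k) (v k.+1) &
      edge_weight G (v k) (v k.+1) w <= quantile L (expR (- (eta * b ^+ k)))]}.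
Proof.
move=> b1 bg; have /andP[g1 g2] := gamma12.
have b0 : 0 < b by apply: lt_trans b1.
have g0 : 0 < gamma by apply: lt_trans g1.
(* The room 1 - b (gamma - 1) is shared equally: one half for the worse tail exponent, the other for
   2 eta, and [sp_eta] then holds with equality. *)
pose xi := (1 - b * (gamma - 1)) / (2 * gamma * b).
have xi0 : 0 < xi by rewrite divr_gt0 ?subr_gt0 // !mulr_gt0.
pose eta := theta0 * (1 - b * (gamma - 1)) / 4.
have eta0 : 0 < eta by rewrite !mulr_gt0 ?subr_gt0 ?invr_gt0.
exists eta => //.
have tau_sp : tau - 1 < (tau - 1) * (1 + xi) by rewrite ltr_pMr ?subr_gt0// ltrDl.
have [c c0 Hc] := level_tail_lower ell_sv tailE tau_gt1 tau_sp.
apply: (@ae_greedy_path _ _ _ _ _ _ _ _ _ _ _ _ G b ((tau - 1) * (1 + xi)) c eta x) => //.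
rewrite tauE le_eqVlt; apply/orP; left; apply/eqP.
rewrite /eta /xi /theta0; field.
by rewrite !gt_eqF.
Qed.

Let kappa : R := ln (gamma - 1)^-1.

Let gamma1 : 0 < gamma - 1 < 1.
Proof. by have /andP[? ?] := gamma12; apply/andP; split; lra. Qed.

Let kappa_gt0 : 0 < kappa.
Proof. by case/andP: gamma1 => g0 g1; rewrite ln_gt0 // invf_gt1. Qed.

Let expR_kappa : expR kappa = (gamma - 1)^-1.
Proof. by case/andP: gamma1 => g0 _; rewrite lnK // posrE invr_gt0. Qed.

Let f (y : R) : R := quantile L (expR (- expR y)).

Let f01 (y : R) : 0 < expR (- expR y) < 1.
Proof. by rewrite expR_gt0 expR_lt1 oppr_lt0 expR_gt0. Qed.

Lemma quantile_expexp_ge0 y : 0 <= f y.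
Proof. exact: quantile_ge0. Qed.

Lemma quantile_expexp_noninc : {homo f : y z / y <= z >-> z <= y}.
Proof.
move=> y z yz; case/andP: (f01 z) => z0 _; case/andP: (f01 y) => _ y1.
by apply: quantile_le => //; rewrite ler_expR lerN2 ler_expR.
Qed.

(** A constant in front of b^k becomes a shift of the argument, which the sampling lemmas
    tolerate. *)
Lemma quantile_expexp (c b : R) k : 0 < c ->
  quantile L (expR (- (c * expR b ^+ k))) = f (k%:R * b + ln c).
Proof. by move=> c0; rewrite /f expRD lnK // expRM_natl mulrC. Qed.

Definition level_sum (n : nat) : R := \sum_(1 <= k < n.+1) f (k%:R * kappa).

(** Nothing is assumed on the limit of [level_sum]: N = 1 decides whether the hitting times stay
    bounded, and large N gives the ratio. *)
Lemma ae_sphere_hitting_time_bounds (N : nat) : (0 < N)%N ->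
  {ae P, forall w, exists C n0, forall n, (n0 <= n)%N -> exists r : R,
    [/\ M_ G n x w = r%:E, N%:R * level_sum n - C <= (N%:R + 1) * r &
        N%:R * r <= C + (N%:R + 1) * level_sum n]}.
Proof.
move=> N0; have NR : 0 < N%:R :> R by rewrite ltr0n.
have eps0 : 0 < scale_slack N :> R by rewrite invr_gt0 addr_gt0 // mulr_gt0.
have eps1 : scale_slack N < 1 :> R.
  by rewrite invf_lt1 ?addr_gt0 ?mulr_gt0//; lra.
(* The rates beta^(1 + slack) and beta^(1 - slack), on either side of the critical one. *)
pose bp := expR (kappa * (1 + scale_slack N)); pose bm := expR (kappa * (1 - scale_slack N)).
case/andP: gamma1 => g0 g1.
have bp1 : 1 < bp by rewrite expR_gt1 mulr_gt0 // addr_gt0.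
have bm1 : 1 < bm by rewrite expR_gt1 mulr_gt0 // subr_gt0.
have bpg : 1 < bp * (gamma - 1).
  rewrite -ltr_pdivrMr // mul1r -expR_kappa ltr_expR ltr_pMr // ltrDl //.
have bmg : bm * (gamma - 1) < 1.
  rewrite -ltr_pdivlMr // mul1r -expR_kappa ltr_expR gtr_pMr // gtrBl //.
have [eta eta0 ae_greedy] := ae_greedy_path_ex bm1 bmg.
have [ae_lower _] := ae_last_edge_lower_bound bp1 bpg.
have ae_len := ae_edge_weight_ge0 G L_ge0.
apply: filterS3 ae_greedy ae_lower ae_len.
move=> w [K1 [v Hv]] [[A HA] [c [K2 [c0 K20 HK2]]]] len0.
pose len := sfp_len G w.
have f_ge0 := quantile_expexp_ge0; have f_noninc := quantile_expexp_noninc.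
have [C1 [a1 HL]] := faster_sample_sum_ge f_ge0 f_noninc kappa_gt0 N0 K2 (ln c).
have [C2 C20 HU] := slower_sample_sum_le f_ge0 f_noninc kappa_gt0 N0 K1 (ln eta).
have [n1 Hn1] := slower_overtakes kappa_gt0 N0 (ler0n R A).
(* Any path to the start of the greedy path; its length is absorbed in the constant. *)
have [p0 /andP[xp0 /eqP lp0]] := lattice_connected G w x (v K1).
pose L0 := path_length len x p0.
have lower n : ((\sum_(K2 <= k < n.+1) f (k%:R * (kappa * (1 + scale_slack N)) + ln c))%:E <=
    M_ G n x w)%E.
  apply: (@sphere_hitting_time_ge _ _ (adj w) len len0 x
    (fun k => f (k%:R * (kappa * (1 + scale_slack N)) + ln c)) K2 n K20) => // p z xp up Kp.
  by rewrite -quantile_expexp //; exact: HK2.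
have greedy_dL m : (K1 <= m)%N -> (dL (adj w) len x (v m) <= (L0 +
    \sum_(K1 <= k < m) f (k%:R * (kappa * (1 - scale_slack N)) + ln eta))%:E)%E.
  move=> K1m; have [p [xp lp le]] : exists p, [/\ path (adj w) x p, last x p = v m &
      path_length len x p <= L0 +
        \sum_(K1 <= k < m) f (k%:R * (kappa * (1 - scale_slack N)) + ln eta)].
    rewrite -(subnKC K1m); elim: (m - K1)%N => [|j [p [xp lp le]]].
      by exists p0; rewrite addn0 big_geq ?addr0.
    rewrite addnS; move: (K1 + j)%N (leq_addr j K1) lp le => i K1i lp le.
    have [_ vadj vlen] := Hv i K1i.
    exists (rcons p (v i.+1)); split.
    - by rewrite rcons_path xp lp.
    - by rewrite last_rcons.
    rewrite -cats1 path_length_cat path_length_cons path_length_nil addr0 lp.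
    rewrite big_nat_recr //= addrA; apply: lerD => //.
    by rewrite -quantile_expexp.
  apply: ge_ereal_inf; exists (path_length len x p)%:E; last by rewrite lee_fin.
  by exists p => //; rewrite /= /is_path xp lp eqxx.
(* A path of at most n edges to [v m] would force a level of at most A bp^n, whereas the weight of
   [v m] forces one above bm^m - 1; the 1 is the rounding in [level]. *)
have far n m : (K1 <= m)%N -> A%:R * bp ^+ n + 1 < bm ^+ m ->
    ~ ballG (R := R) (adj w) n%:R x (v m).
  move=> K1m lt /ballGP[p /andP[xp /eqP lp] pn].
  have [p' [xp' lp' up' sp' _]] := uniq_subpath (len := len) len0 xp.
  have k_n : (size p' <= n)%N by apply: leq_trans pn.
  have [wm _ _] := Hv m K1m.
  have vm1 : 0 < ww (v m) w by apply: lt_le_trans wm; exact: expR_gt0.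
  have lb : bm ^+ m <= ln (ww (v m) w) by rewrite -ler_expR lnK.
  have := HA p' xp' up'; rewrite lp' lp /level => lev.
  have ln0 : 0 <= ln (ww (v m) w).
    by apply: le_trans lb; rewrite exprn_ge0 // ltW // (lt_trans ltr01).
  have /andP[_] := truncn_itv ln0; rewrite -natr1.
  have : A%:R * bp ^+ size p' <= A%:R * bp ^+ n by rewrite ler_wpM2l // ler_weXn2l // ltW.
  lra.
have L00 : 0 <= L0 by exact: (path_length_ge0 (len := len) len0).
(* The index is shifted because a vertex outside the ball of radius n bounds the hitting time of the
   sphere of radius n + 1. *)
exists (`|C1| + N%:R * L0 + C2), (maxn a1 (maxn n1 K1)).+1 => -[//|n].
rewrite ltnS !geq_max => /and3P[an nn Kn].
set m := ((n.+1 * N.+1) %/ N)%N.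
have K1m : (K1 <= m)%N.
  apply: (leq_trans Kn); rewrite /m leq_divRL // (leq_trans (leq_mul (leqnSn n) (leqnSn N)))//.
have upper : (M_ G n.+1 x w <= (L0 +
    \sum_(K1 <= k < m) f (k%:R * (kappa * (1 - scale_slack N)) + ln eta))%:E)%E.
  apply: le_trans (greedy_dL m K1m).
  apply: (sphere_hitting_time_le_dL (len := len) len0).
  by apply: far => //; exact: Hn1.
have Mge0 : (0 <= M_ G n.+1 x w)%E by exact: (sphere_hitting_time_ge0 (len := len) len0).
have Mfin : M_ G n.+1 x w \is a fin_num.
  by rewrite ge0_fin_numE //; apply: le_lt_trans upper _; rewrite ltry.
exists (fine (M_ G n.+1 x w)); rewrite fineK //; split => //.
- apply: (@le_trans _ _ (N%:R * level_sum n.+1 - C1)).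
    have : C1 <= `|C1| by exact: ler_norm.
    have : 0 <= N%:R * L0 by rewrite mulr_ge0.
    lra.
  apply: le_trans (HL n.+1 (leqW an)) _; apply: ler_wpM2l; first by rewrite addr_ge0.
  by rewrite -lee_fin fineK //; exact: lower.
have := upper; rewrite -[X in (X <= _)%E]fineK // lee_fin => /(ler_wpM2l (ltW NR)) /le_trans; apply.
rewrite mulrDr.
have := HU m n (leq_divM _ _); have : level_sum n <= level_sum n.+1.
  by rewrite /level_sum [leRHS]big_nat_recr //= lerDl.
move=> Sle HUm; have := ler_wpM2l (addr_ge0 (ltW NR) ler01) Sle.
have : 0 <= `|C1| by exact: normr_ge0.
rewrite -/(level_sum n) in HUm.
lra.
Qed.

End bounds.

(** * Passage from the two-sided bounds to limits *)

Lemma ratio_cvg1 {R : realType} (u : nat -> \bar R) (S : nat -> R) :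
  (forall B, exists n0, forall n, (n0 <= n)%N -> B <= S n) ->
  (forall N : nat, (0 < N)%N -> exists C n0, forall n, (n0 <= n)%N -> exists r : R,
    [/\ u n = r%:E, N%:R * S n - C <= (N%:R + 1) * r & N%:R * r <= C + (N%:R + 1) * S n]) ->
  (u n / (S n)%:E)%E @[n --> \oo] --> 1%E.
Proof.
move=> Soo uS.
have key (e : R) : 0 < e -> exists n0, forall n, (n0 <= n)%N -> exists r : R,
    [/\ 0 < S n, u n = r%:E & (1 - e) * S n <= r <= (1 + e) * S n].
  (* N >= 2/e keeps (N + 1) / N below 1 + e/2; the other e/2 is left for the additive constant,
     small against [S n]. *)
  move=> e0; pose N := (Num.bound (2 / e)).+1.
  have Ne : 1 <= N%:R * e / 2.
    have : 2 / e < N%:R.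
      apply: (@lt_le_trans _ _ (Num.bound (2 / e))%:R); last by rewrite ler_nat.
      by apply: archi_boundP; rewrite divr_ge0 // ltW.
    by rewrite ltr_pdivrMr //; lra.
  have N1 : 1 <= N%:R :> R by rewrite ler1n.
  have [C [n0 H]] := uS N isT; have [n1 Hn1] := Soo (1 + 2 * `|C| / e).
  exists (maxn n0 n1) => n; rewrite geq_max => /andP[nn0 nn1].
  have [r [-> lo up]] := H n nn0; exists r.
  have C0 : 0 <= `|C| by exact: normr_ge0.
  have SB := Hn1 n nn1.
  have q0 : 0 <= 2 * `|C| / e by rewrite divr_ge0 ?mulr_ge0 // ltW.
  have S0 : 0 < S n by lra.
  have CS : `|C| <= e / 2 * S n.
    have : 2 * `|C| / e <= S n by lra.
    by rewrite ler_pdivrMr //; lra.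
  have h1 : S n <= N%:R * e / 2 * S n by rewrite ler_peMl // ltW.
  have h2 : N%:R * `|C| <= N%:R * (e / 2 * S n) by rewrite ler_wpM2l // ltW // (lt_le_trans ltr01).
  have h3 : `|C| <= N%:R * `|C| by rewrite ler_peMl.
  have h4 : C <= `|C| by exact: ler_norm.
  have eS : 0 <= e * S n by rewrite mulr_ge0 // ltW.
  have N0 : 0 < N%:R :> R by apply: lt_le_trans N1.
  split => //; apply/andP; split.
    have N10 : 0 < N%:R + 1 :> R by rewrite addr_gt0.
    rewrite -(ler_pM2l N10); lra.
  rewrite -(ler_pM2l N0); lra.
apply: cvg_EFin.
  have [n0 H] := key 1 ltr01; exists n0 => // n /= /H[r [S0 -> _]].
  by rewrite inver gt_eqF.
apply/cvgrPdist_le => e e0; have [n0 H] := key e e0; exists n0 => // n /= /H[r [S0 -> /andP[lo up]]].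
rewrite inver gt_eqF //= -(ler_pM2r S0) -{2}(gtr0_norm S0) -normrM mulrBl mul1r divfK ?gt_eqF//.
rewrite ler_norml; apply/andP; split; lra.
Qed.

Theorem theorem1p1 (R : realType) (d : nat) (lambda alpha tau : R)
    (ell : R -> R)
    (dS : measure_display) (S : measurableType dS) (Q : probability S R)
    (W L : {RV Q >-> R})
    (dT : measure_display) (T : measurableType dT) (P : probability T R)
    (G : @weighted_sfp R d lambda alpha dS S Q W L dT T P)
    (gamma : R := alpha * (tau - 1) / d%:R)
    (x : 'rV[int]_d) :
  (1 <= d)%N -> 0 < lambda -> d%:R < alpha ->
  Q [set s | 1 <= W s] = 1%E ->
  1 < tau -> slowly_varying ell ->
  (forall t : R, 0 < t -> ccdf W t = (ell t / t `^ (tau - 1))%:E) ->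
  Q [set s | 0 <= L s] = 1%E ->
  1 < gamma < 2 ->
  ((explosion_integral L < +oo)%E ->
    exists V : {RV P >-> \bar R},
      [/\ {ae P, forall w, (V w < +oo)%E},
          {ae P, forall w, tau_ G n x w @[n --> \oo] --> V w} &
          {ae P, forall w, M_ G n x w @[n --> \oo] --> V w}]) /\
  (explosion_integral L = +oo%E ->
    [/\ {ae P, forall w, tau_ G n x w @[n --> \oo] --> +oo%E},
        {ae P, forall w, M_ G n x w @[n --> \oo] --> +oo%E} &
        {ae P, forall w,
          (M_ G n x w /
            (\sum_(1 <= k < n.+1)
               quantile L (expR (- (1 / (gamma - 1)) ^+ k))%R)%:E)%E
          @[n --> \oo] --> 1%E}]).
Proof.
move=> d1 lambda0 d_alpha W1 tau1 ell_sv tailE L0 gamma12.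
have /andP[g1 g2] := gamma12.
have g10 : 0 < gamma - 1 by rewrite subr_gt0.
pose kappa := ln (gamma - 1)^-1.
have kappa0 : 0 < kappa by rewrite ln_gt0 // invf_gt1 //; lra.
have f_ge0 := quantile_expexp_ge0 L0; have f_noninc := quantile_expexp_noninc L0.
pose Sn := level_sum (L := L) gamma.
have Sn_homo n m : (n <= m)%N -> Sn n <= Sn m.
  move=> nm; rewrite /Sn /level_sum [leRHS](big_cat_nat (n := n.+1)) //= lerDl.
  by apply: sumr_ge0.
have SnE n : Sn n = \sum_(0 <= k < n) quantile L (expR (- expR (k.+1%:R * kappa))).
  by rewrite /Sn /level_sum big_add1.
have ae_bounds : {ae P, forall w, forall N : nat, (0 < N)%N -> exists C n0, forall n, (n0 <= n)%N ->
    exists r : R, [/\ M_ G n x w = r%:E, N%:R * Sn n - C <= (N%:R + 1) * r &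
        N%:R * r <= C + (N%:R + 1) * Sn n]}.
  apply/ae_foralln => N; have [N0|N0] := posnP N; first by apply: aeW => w; rewrite N0.
  have := ae_sphere_hitting_time_bounds G x d1 lambda0 d_alpha W1 tau1 ell_sv tailE L0 erefl gamma12 N0.
  by apply: filterS => w H _.
have ae_len := ae_edge_weight_ge0 G L0.
have ae_lf : {ae P, forall w, forall v, finite_set [set u | sfp_adj G w v u]}.
  (* Local finiteness needs just one admissible rate, here twice the critical one. *)
  have b1 : 1 < 2 / (gamma - 1) by rewrite ltr_pdivlMr // mul1r; lra.
  have b2 : 1 < 2 / (gamma - 1) * (gamma - 1) by rewrite divfK ?gt_eqF // ltr1n.
  by have [] := ae_last_edge_lower_bound G x d1 lambda0 d_alpha W1 tau1 ell_sv tailE L0 erefl gamma12 b1 b2.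
have ae_M : {ae P, forall w, M_ G n x w @[n --> \oo] --> explosion_time G x w}.
  apply: filterS ae_len => w len0; apply: ereal_nondecreasing_cvgn.
  exact: (sphere_hitting_time_nondecreasing (len := sfp_len G w) len0).
have ae_tau : {ae P, forall w, tau_ G n x w @[n --> \oo] --> explosion_time G x w}.
  apply: filterS2 ae_len ae_lf => w len0 lf.
  exact: (size_hitting_time_cvg (len := sfp_len G w) len0).
split.
  move=> /(integral_test_sum_le f_ge0 f_noninc kappa0)[B HB].
  exists (explosion_time_RV G x); split => //.
  (* N = 1 is enough for a finite bound: M_n <= C + 2 B. *)
  apply: filterS2 ae_bounds ae_len => w /(_ 1%N isT)[C [n0 H]] len0.
  apply: (@le_lt_trans _ _ (C + 2 * B)%:E); last by rewrite ltry.
  apply/ereal_supP => _ [n _ <-].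
  have nM := sphere_hitting_time_nondecreasing (len := sfp_len G w) len0 x.
  apply: le_trans (nM _ _ (leq_maxl n n0)) _; have [r [Mr _ up]] := H _ (leq_maxr n n0).
  rewrite -/(M_ G _ x w) Mr lee_fin.
  have := HB (maxn n n0); rewrite -SnE => SB; lra.
move=> Ioo.
have Soo B : exists n0, forall n, (n0 <= n)%N -> B <= Sn n.
  apply: contrapT => nex.
  have SB N : Sn N <= B.
    rewrite leNgt; apply/negP => lt; apply: nex; exists N => n Nn.
    by apply: (le_trans (ltW lt)); exact: Sn_homo.
  have : (explosion_integral L < +oo)%E.
    by apply: (sum_le_integral_test f_ge0 f_noninc kappa0 (B := B)) => N; rewrite -SnE.
  by rewrite Ioo.
have ae_oo : {ae P, forall w, explosion_time G x w = +oo%E}.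
  apply: filterS ae_bounds => w /(_ 1%N isT)[C [n0 H]].
  (* For N = 1 the lower bound reads Sn - C <= 2 M_n, so Sn >= C + 2 A gives M_n >= A. *)
  apply/eqyP => A A0; have [n1 Hn1] := Soo (C + 2 * A).
  have [r [Mr lo _]] := H _ (leq_maxl n0 n1); have SA := Hn1 _ (leq_maxr n0 n1).
  apply: (@le_trans _ _ (M_ G (maxn n0 n1) x w)).
    by rewrite Mr lee_fin; lra.
  by apply: ereal_sup_ubound; exists (maxn n0 n1).
split.
- by apply: filterS2 ae_tau ae_oo => w + <-.
- by apply: filterS2 ae_M ae_oo => w + <-.
- apply: filterS ae_bounds => w H.
  have E : (fun n => (M_ G n x w / (\sum_(1 <= k < n.+1)
      quantile L (expR (- (1 / (gamma - 1)) ^+ k)))%:E)%E) = (fun n => (M_ G n x w / (Sn n)%:E)%E).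
    apply/funext => n; congr (_ * (_%:E)^-1)%E; apply: eq_bigr => k _.
    by rewrite expRM_natl lnK ?posrE ?invr_gt0 // div1r.
  by rewrite E; exact: ratio_cvg1.
Qed.
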